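(* Let $R$ be a commutative ring with many units. Then there is an exact sequence of abelian groups $$0 \longrightarrow H_3(\mathrm{GL}_2(R),\mathbb{Z})/H_3(\mathrm{GL}_1(R),\mathbb{Z}) \longrightarrow \mathcal{P}(R) \overset{\nu}{\longrightarrow} \coprod_{\substack{a_1,a_2 \in R^{\times}\\ (a_1,a_2)\neq (1,1)}} \mathbb{Z}\cdot[a_1,a_2] \longrightarrow K_2^M(R) \longrightarrow 0,$$ where $\mathcal{P}(R)$ and the map $\nu$ are as defined in the context.
   Context: Rings are commutative with unit element $1$. $R^\times$ is the group of units of $R$. A commutative ring $R$ is a ring with many units if for every $n\ge 2$ and every finite family of surjective linear forms $f_i:R^n\to R$ there exists $v\in R^n$ such that $f_i(v)\in R^\times$ for all $i$. The inclusion $\mathrm{GL}_1(R)\to \mathrm{GL}_2(R)$ is $a\mapsto \mathrm{diag}(a,1)$, and $H_3(\mathrm{GL}_2(R),\mathbb{Z})/H_3(\mathrm{GL}_1(R),\mathbb{Z})$ denotes the cokernel of the induced map $H_3(\mathrm{GL}_1(R),\mathbb{Z})\to H_3(\mathrm{GL}_2(R),\mathbb{Z})$ on integral group homology. The Milnor $K$-group $K_2^M(R)$ is the abelian group generated by symbols $\{a_1,a_2\}$, $a_1,a_2\in R^\times$, subject to bimultiplicativity and the relations $\{a_1,a_2\}=0$ whenever $a_1+a_2=0$ or $a_1+a_2=1$. For $l\ge 0$ let $D_l(R^2)$ be the free $\mathbb{Z}$-module with basis the $(l+1)$-tuples $(v_0,\dots,v_l)$ of vectors of $R^2$ such that every $\min\{l+1,2\}$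 of the $v_i$ form a basis of a direct summand of $R^2$; $\mathrm{GL}_2(R)$ acts diagonally. For $l\ge1$ let $\partial_l:D_l(R^2)\to D_{l-1}(R^2)$ be $\partial_l=\sum_{i=0}^l(-1)^i d_i$, where $d_i$ omits the $i$-th vector $v_i$. Set $\mathcal{P}(R):=H_0(\mathrm{GL}_2(R),\partial_3(D_3(R^2)))$, the coinvariants of the submodule $\partial_3(D_3(R^2))\subseteq D_2(R^2)$. There is an isomorphism $H_0(\mathrm{GL}_2(R),D_2(R^2))\simeq \coprod_{a_1,a_2\in R^\times}\mathbb{Z}\cdot[a_1,a_2]$ (free abelian group on the symbols $[a_1,a_2]$), where $[a_1,a_2]$ corresponds to the orbit of $(e_1,e_2,a_1e_1+a_2e_2)$, with $e_1,e_2$ the standard basis of $R^2$. The map $\nu$ is the map $\mathcal{P}(R)\to H_0(\mathrm{GL}_2(R),D_2(R^2))$ induced by the inclusion $\partial_3(D_3(R^2))\subseteq D_2(R^2)$, followed by this isomorphism and by the projection onto $\coprod_{(a_1,a_2)\ne(1,1)}\mathbb{Z}\cdot[a_1,a_2]$ that sends $[1,1]$ to $0$ and fixes all other symbols. *)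

(* Defs.v *)
From HB Require Import structures.
From mathcomp Require Import all_boot all_order all_algebra.
From mathcomp Require Import boolp freeg ring_quotient.

Set Implicit Arguments.
Unset Strict Implicit.
Unset Printing Implicit Defensive.

Import GRing.Theory.
Local Open Scope ring_scope.
Local Open Scope quotient_scope.

Section FreeLift.
Variables (K : choiceType) (A : zmodType) (f : K -> A).

(* fglift needs a module over int: zmodule A is A with this module structure. *)
Definition flift (D : {freeg K}) : A := @fglift int (zmodule A) K f D.

Fact flift_is_zmod_morphism : zmod_morphism flift.
Proof. exact: (@lift_is_additive int K (zmodule A) f). Qed.
HB.instance Definition _ :=
  GRing.isZmodMorphism.Build {freeg K} A flift flift_is_zmod_morphism.

Lemma fliftU z k : flift << z *g k >> = f k *~ z.
Proof. by rewrite /flift liftU. Qed.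

Lemma flift1 k : flift << k >> = f k.
Proof. by rewrite fliftU. Qed.

End FreeLift.

Lemma freegU_mulz1 (K : choiceType) (z : int) (k : K) :
  << z *g k >> = << k >> *~ z :> {freeg K}.
Proof. by rewrite freeg_mulz; congr << _ *g _ >>; rewrite mulrzz mul1r. Qed.

Lemma freeg_ext (K : choiceType) (A : zmodType) (f g : {additive {freeg K} -> A}) :
  (forall k, f << k >> = g << k >>) -> f =1 g.
Proof.
move=> fg D; rewrite -(freeg_sumE D) !raddf_sum; apply: eq_bigr => k _.
by rewrite freegU_mulz1 !raddfMz fg.
Qed.

Section GenSub.
Variables (A : zmodType) (S : A -> Prop).

Inductive gen : A -> Prop :=
| gen0 : gen 0
| genS x of S x : gen x
| genB x y of gen x & gen y : gen (x - y).

Definition gen_pred : pred A := fun x => `[< gen x >].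

Fact gen_zmod_closed : zmod_closed gen_pred.
Proof.
split=> [|x y]; rewrite -!topredE /=; first by apply/asboolP; exact: gen0.
by move=> /asboolP Gx /asboolP Gy; apply/asboolP; exact: genB.
Qed.
HB.instance Definition _ := GRing.isZmodClosed.Build A gen_pred gen_zmod_closed.

Definition gen_closed : zmodClosed A := GRing.ZmodClosed.clone A gen_pred _.

Definition quot_by := Quotient.quot gen_closed.
HB.instance Definition _ := GRing.Zmodule.on quot_by.

Definition qclass (x : A) : quot_by := \pi_(Quotient.quot gen_closed) x.

Fact qclass_is_zmod_morphism : zmod_morphism qclass.
Proof. exact: (raddfB (\pi_(Quotient.quot gen_closed))). Qed.
HB.instance Definition _ :=
  GRing.isZmodMorphism.Build A quot_by qclass qclass_is_zmod_morphism.

Lemma qclass_eq0 x : qclass x = 0 <-> gen x.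
Proof.
rewrite -(raddf0 qclass); split => [/eqP|Gx].
  by rewrite -Quotient.idealrBE subr0 => /asboolP.
by apply/eqP; rewrite -Quotient.idealrBE subr0; apply/asboolP.
Qed.

Lemma qclassP (q : quot_by) : exists x, q = qclass x.
Proof. by exists (repr q); rewrite /qclass reprK. Qed.

End GenSub.

Section QuotLift.
Variables (A B : zmodType) (S : A -> Prop) (f : {additive A -> B}).
Hypothesis f0 : forall x, S x -> f x = 0.

Definition qlift of (forall x, S x -> f x = 0) :=
  fun q : quot_by S => f (repr (q : Quotient.quot (gen_closed S))).

Lemma gen_ker x : gen S x -> f x = 0.
Proof.
elim=> [|y /f0 //|y z _ fy _ fz]; first exact: raddf0.
by rewrite raddfB fy fz subrr.
Qed.

Lemma qlift_class x : qlift f0 (qclass S x) = f x.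
Proof.
apply/eqP; rewrite -subr_eq0 -raddfB; apply/eqP/gen_ker/asboolP.
rewrite -[`[< _ >]]/(_ \in gen_closed S) Quotient.idealrBE.
by rewrite reprK.
Qed.

Fact qlift_is_zmod_morphism : zmod_morphism (qlift f0).
Proof.
move=> p q; have [[x ->] [y ->]] := (qclassP p, qclassP q).
by rewrite -raddfB !qlift_class raddfB.
Qed.
HB.instance Definition _ :=
  GRing.isZmodMorphism.Build (quot_by S) B (qlift f0) qlift_is_zmod_morphism.

End QuotLift.

Definition in_image (X Y : Type) (f : X -> Y) (y : Y) : Prop :=
  exists x, f x = y.

Definition coker (A B : zmodType) (f : {additive A -> B}) :=
  quot_by (in_image f).
HB.instance Definition _ (A B : zmodType) (f : {additive A -> B}) :=
  GRing.Zmodule.on (coker f).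

Section Image.
Variables (A B : zmodType) (f : {additive A -> B}).

Definition im_pred : pred B := fun y => `[< in_image f y >].

Fact im_zmod_closed : zmod_closed im_pred.
Proof.
split=> [|x y]; rewrite -!topredE /=.
  by apply/asboolP; exists 0; rewrite raddf0.
move=> /asboolP[a <-] /asboolP[b <-]; apply/asboolP.
by exists (a - b); rewrite raddfB.
Qed.
HB.instance Definition _ := GRing.isZmodClosed.Build B im_pred im_zmod_closed.

Definition image_of := {y : B | y \in im_pred}.
HB.instance Definition _ := SubChoice.on image_of.
HB.instance Definition _ := [SubChoice_isSubZmodule of image_of by <:].

End Image.

Definition exact_at (A B C : zmodType) (f : A -> B) (g : B -> C) : Prop :=
  forall y, g y = 0 <-> exists x, f x = y.

Section Bar.
Variable G : groupType.

Local Notation bar n := {freeg {ffun 'I_n -> G}}.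

(* With g = [g_0|...|g_n]: the face 0 drops g_0, the face n.+1 drops g_n,  *)
(* and the face i, 0 < i < n.+1, replaces g_(i-1), g_i by their product.   *)
Definition bar_face n (i : 'I_n.+2) (g : {ffun 'I_n.+1 -> G}) :
    {ffun 'I_n -> G} :=
  [ffun j : 'I_n =>
    let g_j := g (widen_ord (leqnSn n) j) in
    let g_j1 := g (fintype.lift ord0 j) in
    if (j.+1 < i)%N then g_j
    else if j.+1 == i :> nat then (g_j * g_j1)%g
    else g_j1].

Definition bar_bd n : bar n.+1 -> bar n :=
  flift (fun g => \sum_(i < n.+2) << (-1) ^+ i *g bar_face i g >>).
Fact bar_bd_is_zmod_morphism n : zmod_morphism (@bar_bd n).
Proof. exact: flift_is_zmod_morphism. Qed.
HB.instance Definition _ n :=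
  GRing.isZmodMorphism.Build _ _ (@bar_bd n) (@bar_bd_is_zmod_morphism n).

Lemma bar_bd1 n (g : {ffun 'I_n.+1 -> G}) :
  bar_bd << g >> = \sum_(i < n.+2) << (-1) ^+ i *g bar_face i g >>.
Proof. exact: flift1. Qed.

Definition bar_cycle n : pred (bar n) :=
  match n return pred (bar n) with
  | 0 => xpredT
  | m.+1 => fun x => bar_bd x == 0
  end.

Fact bar_cycle_zmod_closed n : zmod_closed (@bar_cycle n).
Proof.
case: n => [|n]; split=> // [|x y]; rewrite !unfold_in /= ?raddf0 //.
by move=> /eqP dx /eqP dy; rewrite raddfB /= dx dy subrr.
Qed.
HB.instance Definition _ n :=
  GRing.isZmodClosed.Build (bar n) (@bar_cycle n) (@bar_cycle_zmod_closed n).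

Definition cycles n := {x : bar n | x \in @bar_cycle n}.
HB.instance Definition _ n := SubChoice.on (cycles n).
HB.instance Definition _ n := [SubChoice_isSubZmodule of cycles n by <:].

Definition homology n :=
  quot_by (fun z : cycles n => in_image (@bar_bd n) (val z)).
HB.instance Definition _ n := GRing.Zmodule.on (homology n).

End Bar.

Section BarMap.
Variables (G H : groupType) (phi : {multiplicative G -> H}) (n : nat).
Local Notation bar G n := {freeg {ffun 'I_n -> G}}.

Definition bar_map m : bar G m -> bar H m :=
  flift (fun g : {ffun 'I_m -> G} => << [ffun i => phi (g i)] >>).
Fact bar_map_is_zmod_morphism m : zmod_morphism (@bar_map m).
Proof. exact: flift_is_zmod_morphism. Qed.
HB.instance Definition _ m :=
  GRing.isZmodMorphism.Build _ _ (@bar_map m) (@bar_map_is_zmod_morphism m).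

Lemma bar_mapU m z (g : {ffun 'I_m -> G}) :
  bar_map << z *g g >> = << z *g [ffun i => phi (g i)] >>.
Proof. by rewrite /bar_map fliftU -freegU_mulz1. Qed.

Lemma bar_map_bd m (x : bar G m.+1) : bar_map (bar_bd x) = bar_bd (bar_map x).
Proof.
pose F := @bar_map m \o @bar_bd G m; pose F' := @bar_bd H m \o @bar_map m.+1.
rewrite -[LHS]/(F x) -[RHS]/(F' x); move: x; apply: freeg_ext => g.
rewrite /F /F' /= bar_mapU !bar_bd1 raddf_sum; apply: eq_bigr => i _ /=.
rewrite bar_mapU; congr (<< _ *g _ >>); apply/ffunP => j.
by rewrite !ffunE /=; do 2?case: ifP => _ //; exact: gmulfM.
Qed.

Fact bar_map_cycle (z : cycles G n) : bar_map (val z) \in @bar_cycle H n.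
Proof.
case: z; case: n => [|m] //= x; rewrite -!topredE /= => /eqP dx.
by rewrite -bar_map_bd dx raddf0.
Qed.

Definition cycles_map (z : cycles G n) : cycles H n :=
  exist _ (bar_map (val z)) (bar_map_cycle z).

Fact cycles_map_is_zmod_morphism : zmod_morphism cycles_map.
Proof. by move=> x y; apply/val_inj; rewrite /= !raddfB. Qed.
HB.instance Definition _ := GRing.isZmodMorphism.Build
  (cycles G n) (cycles H n) cycles_map cycles_map_is_zmod_morphism.

Local Notation bdH := (fun z : cycles H n => in_image (@bar_bd H n) (val z)).

Fact homology_map_subproof (z : cycles G n) :
  in_image (@bar_bd G n) (val z) -> (qclass bdH \o cycles_map) z = 0.
Proof.
case=> b db; apply/qclass_eq0/genS; exists (bar_map b).
by rewrite -bar_map_bd db.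
Qed.

Definition homology_map : homology G n -> homology H n :=
  qlift homology_map_subproof.
Fact homology_map_is_zmod_morphism : zmod_morphism homology_map.
Proof. exact: qlift_is_zmod_morphism. Qed.
HB.instance Definition _ := GRing.isZmodMorphism.Build
  (homology G n) (homology H n) homology_map homology_map_is_zmod_morphism.

End BarMap.

Arguments homology_map {G H} phi n%_N z.

Definition coinv_rel (G : Type) (A : zmodType) (act : G -> A -> A) (x : A) :=
  exists g a, x = act g a - a.

Definition coinv (G : Type) (A : zmodType) (act : G -> A -> A) :=
  quot_by (coinv_rel act).
HB.instance Definition _ (G : Type) (A : zmodType) (act : G -> A -> A) :=
  GRing.Zmodule.on (coinv act).

Section CoinvMap.
Variables (G : Type) (A B : zmodType) (actA : G -> A -> A) (actB : G -> B -> B).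
Variables (f : {additive A -> B}).
Hypothesis fE : forall g a, f (actA g a) = actB g (f a).

Fact coinv_map_subproof (x : A) :
  coinv_rel actA x -> (qclass (coinv_rel actB) \o f) x = 0.
Proof.
case=> g [a ->]; apply/qclass_eq0/genS; exists g, (f a).
by rewrite raddfB /= fE.
Qed.

Definition coinv_map : coinv actA -> coinv actB := qlift coinv_map_subproof.

Fact coinv_map_is_zmod_morphism : zmod_morphism coinv_map.
Proof. exact: qlift_is_zmod_morphism. Qed.
HB.instance Definition _ := GRing.isZmodMorphism.Build
  (coinv actA) (coinv actB) coinv_map coinv_map_is_zmod_morphism.

End CoinvMap.

Section Units.
Variable R : comUnitRingType.

Definition units := {a : R | a \is a GRing.unit}.
HB.instance Definition _ := SubChoice.on units.

Definition units_one : units := exist _ 1 (unitr1 R).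
Definition units_mul (a b : units) : units :=
  exist _ (val a * val b) (etrans (unitrM _ _) (introT andP (conj (valP a) (valP b)))).
Definition units_inv (a : units) : units :=
  exist _ (val a)^-1 (etrans (unitrV _) (valP a)).

Fact units_mulA : associative units_mul.
Proof. by move=> a b c; apply/val_inj; rewrite /= mulrA. Qed.
Fact units_mul1 : left_id units_one units_mul.
Proof. by move=> a; apply/val_inj; rewrite /= mul1r. Qed.
Fact units_1mul : right_id units_one units_mul.
Proof. by move=> a; apply/val_inj; rewrite /= mulr1. Qed.
Fact units_mulV : left_inverse units_one units_inv units_mul.
Proof. by move=> a; apply/val_inj; rewrite /= mulVr ?(valP a). Qed.
Fact units_Vmul : right_inverse units_one units_inv units_mul.
Proof. by move=> a; apply/val_inj; rewrite /= mulrV ?(valP a). Qed.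
HB.instance Definition _ := isGroup.Build units
  units_mulA units_mul1 units_1mul units_mulV units_Vmul.

Definition GL n := {A : 'M[R]_n | A \in unitmx}.
HB.instance Definition _ n := SubChoice.on (GL n).

Section GLgroup.
Variable n : nat.

Definition GL_one : GL n := exist _ 1%:M (unitmx1 R n).
Definition GL_mul (A B : GL n) : GL n :=
  exist _ (val A *m val B)
    (etrans (unitmx_mul _ _) (introT andP (conj (valP A) (valP B)))).
Definition GL_inv (A : GL n) : GL n :=
  exist _ (invmx (val A)) (etrans (unitmx_inv _) (valP A)).

Fact GL_mulA : associative GL_mul.
Proof. by move=> A B C; apply/val_inj; rewrite /= mulmxA. Qed.
Fact GL_mul1 : left_id GL_one GL_mul.
Proof. by move=> A; apply/val_inj; rewrite /= mul1mx. Qed.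
Fact GL_1mul : right_id GL_one GL_mul.
Proof. by move=> A; apply/val_inj; rewrite /= mulmx1. Qed.
Fact GL_mulV : left_inverse GL_one GL_inv GL_mul.
Proof. by move=> A; apply/val_inj; rewrite /= mulVmx ?(valP A). Qed.
Fact GL_Vmul : right_inverse GL_one GL_inv GL_mul.
Proof. by move=> A; apply/val_inj; rewrite /= mulmxV ?(valP A). Qed.
HB.instance Definition _ := isGroup.Build (GL n)
  GL_mulA GL_mul1 GL_1mul GL_mulV GL_Vmul.
End GLgroup.

Fact GL1_GL2_subproof (A : GL 1) :
  (block_mx (val A) 0 0 1%:M : 'M_(1 + 1)) \in unitmx.
Proof. by rewrite unitmxE det_ublock det1 mulr1 -unitmxE (valP A). Qed.

Definition GL1_GL2 (A : GL 1) : GL 2 :=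
  exist (fun M : 'M_(1 + 1) => M \in unitmx) _ (GL1_GL2_subproof A).

Fact GL1_GL2M : {morph GL1_GL2 : A B / (A * B)%g}.
Proof.
move=> A B; apply/val_inj => /=; rewrite -[RHS]/(
  (block_mx (val A) 0 0 1%:M : 'M_(1 + 1)) *m block_mx (val B) 0 0 1%:M).
by rewrite mulmx_block !(mulmx0, mul0mx, addr0, add0r, mulmx1).
Qed.
HB.instance Definition _ := isMultiplicative.Build (GL 1) (GL 2) GL1_GL2 GL1_GL2M.

End Units.

Definition many_units (R : comUnitRingType) : Prop :=
  forall (n m : nat) (f : 'I_m -> {linear 'cV[R]_n -> R^o}),
    (2 <= n)%N -> (forall i y, exists x, f i x = y) ->
  exists v, forall i, (f i v : R) \is a GRing.unit.

Section MilnorK2.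
Variable R : comUnitRingType.
Notation U := (units R).

Inductive K2M_rel : {freeg (U * U)%type} -> Prop :=
| K2M_mull a b c : K2M_rel (<< ((a * b)%g, c) >> - << (a, c) >> - << (b, c) >>)
| K2M_mulr a b c : K2M_rel (<< (a, (b * c)%g) >> - << (a, b) >> - << (a, c) >>)
| K2M_opp a b of val a + val b = 0 : K2M_rel << (a, b) >>
| K2M_steinberg a b of val a + val b = 1 : K2M_rel << (a, b) >>.

Definition K2M := quot_by K2M_rel.
HB.instance Definition _ := GRing.Zmodule.on K2M.

End MilnorK2.

Section Summand.
Variables (R : comUnitRingType) (V : lmodType R).

Definition lin_indep k (w : 'I_k -> V) : Prop :=
  forall c : 'I_k -> R, \sum_i c i *: w i = 0 -> forall i, c i = 0.

Definition fspan k (w : 'I_k -> V) (v : V) : Prop :=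
  exists c : 'I_k -> R, v = \sum_i c i *: w i.

Definition direct_summand (M : V -> Prop) : Prop :=
  exists N : {pred V}, [/\ GRing.submod_closed N,
    forall v, exists x y, [/\ M x, y \in N & v = x + y]
    & forall v, M v -> v \in N -> v = 0].

Definition summand_basis k (w : 'I_k -> V) : Prop :=
  lin_indep w /\ direct_summand (fspan w).


Lemma span_submod k (w : 'I_k -> V) a u v :
  fspan w u -> fspan w v -> fspan w (a *: u + v).
Proof.
case=> c -> [d ->]; exists (fun i => a * c i + d i).
rewrite scaler_sumr -big_split; apply: eq_bigr => i _.
by rewrite scalerDl scalerA.
Qed.

Lemma summand_basis1 k (w : 'I_k -> V) i :
  summand_basis w -> summand_basis (fun _ : 'I_1 => w i).
Proof.
case=> wfree [N [[N0 Nlin] decN disjN]].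
have sum1 (c : 'I_1 -> R) : \sum_j c j *: w i =
    \sum_j (if j == i then c ord0 else 0) *: w j.
  rewrite big_ord1 (bigD1 i) //= eqxx big1 ?addr0 // => j /negPf ->.
  by rewrite scale0r.
split=> [c /[!sum1] /wfree/(_ i)|]; first by rewrite eqxx => c0 j; rewrite ord1.
pose N' v := `[< exists (d : 'I_k -> R) y,
  [/\ d i = 0, y \in N & v = \sum_j d j *: w j + y] >].
exists N'; split; first split.
- apply/asboolP; exists (fun=> 0), 0; split=> //.
  by rewrite big1 ?addr0 // => j _; rewrite scale0r.
- move=> a u v /asboolP[d [y [d0 Ny ->]]] /asboolP[e [z [e0 Nz ->]]].
  apply/asboolP; exists (fun j => a * d j + e j), (a *: y + z); split.
  + by rewrite d0 e0 mulr0 addr0.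
  + exact: Nlin.
  + rewrite scalerDr addrACA scaler_sumr -big_split /=; congr (_ + _).
    by apply: eq_bigr => j _; rewrite scalerDl scalerA.
- move=> v; have [x [y [[c ->] Ny ->]]] := decN v.
  exists (c i *: w i), (\sum_(j | j != i) c j *: w j + y); split.
  + by exists (fun=> c i); rewrite big_ord1.
  + apply/asboolP; exists (fun j => if j == i then 0 else c j), y.
    rewrite eqxx; split=> //; congr (_ + _).
    rewrite [RHS](bigD1 i) //= eqxx scale0r add0r.
    by apply: eq_bigr => j /negPf ->.
  + by rewrite addrA (bigD1 i).
- move=> v [c ->] /asboolP[d [y [d0 Ny eqv]]].
  rewrite sum1 in eqv *.
  pose e j := if j == i then c ord0 else 0; rewrite -/(\sum_j e j *: w j) in eqv *.
  have yE : y = \sum_j (e j - d j) *: w j.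
    apply/eqP; rewrite -[y](addKr (\sum_j d j *: w j)) -eqv addrC -sumrB.
    by apply/eqP/eq_bigr => j _; rewrite scalerBl.
  have /wfree/(_ i) : \sum_j (e j - d j) *: w j = 0.
    by rewrite -yE; apply: disjN => //; exists (fun j => e j - d j).
  rewrite d0 subr0 /e eqxx => c0; apply: big1 => j _.
  by case: ifP => _; rewrite ?c0 scale0r.
Qed.

Lemma summand_basis_ext k (w w' : 'I_k -> V) :
  w =1 w' -> summand_basis w -> summand_basis w'.
Proof. by move/funext ->. Qed.

End Summand.

Section SummandLinear.
Variables (R : comUnitRingType) (V W : lmodType R).
Variables (f : {linear V -> W}) (g : {linear W -> V}).
Hypotheses (fK : cancel f g) (gK : cancel g f).

Lemma summand_basis_lin k (w : 'I_k -> V) :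
  summand_basis w -> summand_basis (f \o w).
Proof.
have fsum (c : 'I_k -> R) : \sum_i c i *: (f \o w) i = f (\sum_i c i *: w i).
  by rewrite linear_sum; apply: eq_bigr => i _; rewrite linearZ.
case=> wfree [N [[N0 Nlin] decN disjN]]; split=> [c|].
  by rewrite fsum -(linear0 f) => /(can_inj fK)/wfree.
exists (fun v => g v \in N); split; first split.
- by rewrite unfold_in linear0.
- by move=> a u v; rewrite !unfold_in /= linearP; apply: Nlin.
- move=> v; have [x [y [[c xE] Ny gv]]] := decN (g v).
  exists (f x), (f y); split; first by exists c; rewrite fsum xE.
    by rewrite unfold_in fK.
  by rewrite -linearD -gv gK.
- move=> v [c ->]; rewrite fsum unfold_in fK => /disjN ->; rewrite ?linear0 //.
  by exists c.
Qed.
End SummandLinear.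

Section SquareBasis.
Variables (R : comUnitRingType) (n : nat) (w : 'I_n -> 'cV[R]_n).

Definition colsmx : 'M[R]_n := \matrix_(i, j) w j i 0.

Lemma colsmxE (c : 'I_n -> R) : \sum_j c j *: w j = colsmx *m (\col_j c j).
Proof.
apply/colP => i; rewrite summxE !mxE; apply: eq_bigr => j _.
by rewrite !mxE mulrC.
Qed.

Lemma summand_basis_unitmx : summand_basis w <-> colsmx \in unitmx.
Proof.
split=> [[wfree [N [[N0 Nlin] decN disjN]]] | Wu].
- have decE (i : 'I_n) : exists p : 'cV[R]_n * 'cV[R]_n,
      p.2 \in N /\ delta_mx i 0 = colsmx *m p.1 + p.2 :> 'cV_n.
    have [x [y [[c ->] Ny xE]]] := decN (delta_mx i 0).
    by exists (\col_j c j, y); rewrite -colsmxE.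
  have [p pP] := choice decE.
  pose S : 'M[R]_n := \matrix_(r, i) (p i).1 r 0.
  have SW (u : 'cV[R]_n) : u = S *m (colsmx *m u).
    set z := colsmx *m u.
    have zE : z = colsmx *m (S *m z) + \sum_i z i 0 *: (p i).2.
      have Sz : S *m z = \sum_i z i 0 *: (p i).1.
        apply/colP => r; rewrite summxE mxE; apply: eq_bigr => i _.
        by rewrite !mxE mulrC.
      rewrite Sz mulmx_sumr -big_split /= [LHS]matrix_sum_delta.
      apply: eq_bigr => i _; rewrite big_ord1 {1}(pP i).2 -scalemxAr scalerDr.
      by [].
    apply/eqP; rewrite -subr_eq0; apply/eqP/colP => i.
    have := wfree (fun i => (u - S *m z) i 0); rewrite colsmxE.
    have -> : \col_j (u - S *m z) j 0 = u - S *m z.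
      by apply/colP => j; rewrite mxE.
    move=> -> //; first by rewrite [RHS]mxE.
    apply: disjN.
      exists (fun i => (u - S *m z) i 0); rewrite colsmxE; congr (_ *m _).
      by apply/colP => j; rewrite [RHS]mxE.
    rewrite mulmxBr -/z {1}zE addrC addKr.
    by elim/big_rec: _ => // j x _ Nx; apply: Nlin => //; have [] := pP j.
  have /mulmx1_unit[] // : S *m colsmx = 1%:M.
  apply/matrixP => i j.
  have /colP/(_ i) := SW (delta_mx j 0).
  by rewrite mulmxA -colE !mxE andbT => <-.
split=> [c|].
  rewrite colsmxE => /(congr1 (mulmx (invmx colsmx))).
  by rewrite mulKmx // mulmx0 => /colP cE i; have := cE i; rewrite !mxE.
exists (fun v => v == 0); split; first split; rewrite ?unfold_in ?eqxx //.
- move=> a u v; rewrite !unfold_in => /eqP -> /eqP ->.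
  by rewrite scaler0 addr0.
- move=> v; exists v, 0; rewrite unfold_in eqxx addr0; split=> //.
  exists (fun i => (invmx colsmx *m v) i 0); rewrite colsmxE.
  rewrite -[LHS](mulKVmx Wu); congr (_ *m _).
  by apply/colP => j; rewrite [RHS]mxE.
- by move=> v _; rewrite unfold_in => /eqP.
Qed.
End SquareBasis.

Lemma det22 (R : comUnitRingType) (A : 'M[R]_2) :
  \det A = A 0 0 * A 1 1 - A 0 1 * A 1 0.
Proof.
rewrite (expand_det_row _ 0) !big_ord_recl big_ord0 addr0 /cofactor !det_mx11 !mxE.
rewrite /= expr0 expr1 mul1r mulN1r mulrN; congr (_ * _ - _ * _).
- by congr (A _ _); apply/val_inj.
- by congr (A _ _); apply/val_inj.
- by congr (A _ _); apply/val_inj.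
Qed.

Section Delta.
Variable R : comUnitRingType.
Notation V := 'cV[R]_2.
Notation U := (units R).

(* The injections s range over the choices of min(l+1, 2) of the v_i, in all *)
(* orders. *)
Definition gen_position l (v : 'I_l.+1 -> V) : Prop :=
  forall s : 'I_(minn l.+1 2) -> 'I_l.+1, injective s -> summand_basis (v \o s).

Definition frame l := {v : {ffun 'I_l.+1 -> V} | `[< gen_position v >]}.
HB.instance Definition _ l := SubChoice.on (frame l).

Definition Frame l (v : {ffun 'I_l.+1 -> V}) (vP : gen_position v) : frame l :=
  exist (fun v : {ffun 'I_l.+1 -> V} => `[< gen_position v >]) v (asboolT vP).

Notation D l := {freeg (frame l)}.

Fact frame_face_subproof l (v : frame l.+1) (i : 'I_l.+2) :
  gen_position [ffun j : 'I_l.+1 => val v (fintype.lift i j)].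
Proof.
move=> s sI; have /asboolP vP := valP v.
case: l v i s sI vP => [|l] v i s sI vP; last first.
  have := vP (fintype.lift i \o s) (inj_comp (@lift_inj _ i) sI).
  by apply: summand_basis_ext => j; rewrite /= ffunE.
have := @summand_basis1 _ _ _ _ (fintype.lift i (s ord0)) (vP id (@inj_id _)).
by apply: summand_basis_ext => j /=; rewrite ffunE (ord1 j).
Qed.

Definition frame_face l (i : 'I_l.+2) (v : frame l.+1) : frame l :=
  Frame (frame_face_subproof v i).

(* Degrees are shifted: D_bd l is the boundary written \partial_(l+1). *)
Definition D_bd l : D l.+1 -> D l :=
  flift (fun v => \sum_(i < l.+2) << (-1) ^+ i *g frame_face i v >>).
Fact D_bd_is_zmod_morphism l : zmod_morphism (@D_bd l).
Proof. exact: flift_is_zmod_morphism. Qed.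
HB.instance Definition _ l :=
  GRing.isZmodMorphism.Build _ _ (@D_bd l) (@D_bd_is_zmod_morphism l).

Lemma D_bd1 l (v : frame l.+1) :
  D_bd << v >> = \sum_(i < l.+2) << (-1) ^+ i *g frame_face i v >>.
Proof. exact: flift1. Qed.

Lemma GL_mulVmx (g : GL R 2) : cancel (mulmx (val g) : V -> V) (mulmx (invmx (val g))).
Proof. by move=> v; rewrite mulKmx ?(valP g). Qed.

Lemma GL_mulmxV (g : GL R 2) : cancel (mulmx (invmx (val g))) (mulmx (val g) : V -> V).
Proof. by move=> v; rewrite mulKVmx ?(valP g). Qed.

Fact frame_act_subproof l (g : GL R 2) (v : frame l) :
  gen_position [ffun j => val g *m val v j].
Proof.
move=> s sI; have /asboolP/(_ s sI) := valP v.
move/(summand_basis_lin (GL_mulVmx g) (GL_mulmxV g)).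
by apply: summand_basis_ext => j; rewrite /= ffunE.
Qed.

Definition frame_act l (g : GL R 2) (v : frame l) : frame l :=
  Frame (frame_act_subproof g v).

Definition D_act l (g : GL R 2) : D l -> D l :=
  flift (fun v : frame l => << frame_act g v >>).
Fact D_act_is_zmod_morphism l g : zmod_morphism (@D_act l g).
Proof. exact: flift_is_zmod_morphism. Qed.
HB.instance Definition _ l g :=
  GRing.isZmodMorphism.Build _ _ (@D_act l g) (@D_act_is_zmod_morphism l g).

Lemma D_actU l g z (v : frame l) : D_act g << z *g v >> = << z *g frame_act g v >>.
Proof. by rewrite /D_act fliftU -freegU_mulz1. Qed.

Lemma D_bd_act l g (x : D l.+1) : D_bd (D_act g x) = D_act g (D_bd x).
Proof.
pose F := @D_bd l \o D_act g; pose F' := D_act g \o @D_bd l.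
rewrite -[LHS]/(F x) -[RHS]/(F' x); move: x; apply: freeg_ext => v.
rewrite /F /F' /= D_actU !D_bd1 raddf_sum; apply: eq_bigr => i _ /=.
rewrite D_actU; congr (<< _ *g _ >>); apply/val_inj/ffunP => j.
by rewrite !ffunE.
Qed.

Definition im_bd3 := image_of (@D_bd 2).
HB.instance Definition _ := GRing.Zmodule.on im_bd3.

Fact im_act_subproof (g : GL R 2) (x : im_bd3) : D_act g (val x) \in im_pred (@D_bd 2).
Proof.
by have /asboolP[y <-] := valP x; apply/asboolP; exists (D_act g y); exact: D_bd_act.
Qed.

Definition im_act (g : GL R 2) (x : im_bd3) : im_bd3 :=
  exist (fun y => y \in im_pred (@D_bd 2)) _ (im_act_subproof g x).

Definition calP := coinv im_act.
HB.instance Definition _ := GRing.Zmodule.on calP.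

Definition H0D2 := coinv (@D_act 2).
HB.instance Definition _ := GRing.Zmodule.on H0D2.

Definition im_incl (x : im_bd3) : D 2 := val x.
Fact im_incl_is_zmod_morphism : zmod_morphism im_incl.
Proof. exact: raddfB. Qed.
HB.instance Definition _ :=
  GRing.isZmodMorphism.Build _ _ im_incl im_incl_is_zmod_morphism.

Fact im_incl_act g x : im_incl (im_act g x) = D_act g (im_incl x).
Proof. by []. Qed.

Definition calP_incl : calP -> H0D2 := coinv_map im_incl_act.
Fact calP_incl_is_zmod_morphism : zmod_morphism calP_incl.
Proof. exact: coinv_map_is_zmod_morphism. Qed.
HB.instance Definition _ :=
  GRing.isZmodMorphism.Build _ _ calP_incl calP_incl_is_zmod_morphism.

Definition frame_basis (v : frame 2) : 'M[R]_2 :=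
  colsmx (fun j : 'I_2 => val v (widen_ord (leqnSn 2) j)).

(* The coordinates (a_1, a_2) of v_2 in the basis (v_0, v_1): the triple v is in  *)
(* the orbit of (e_1, e_2, a_1 e_1 + a_2 e_2), see frame_units_std.             *)
Definition frame_coord (v : frame 2) : V :=
  invmx (frame_basis v) *m val v ord_max.

Lemma frame_basis_unit v : frame_basis v \in unitmx.
Proof.
apply/summand_basis_unitmx; have /asboolP vP := valP v.
apply: (vP (widen_ord (leqnSn 2) : 'I_(minn 3 2) -> 'I_3)).
by move=> i j /(congr1 val) /= ij; apply/val_inj.
Qed.

Fact frame_coord_unit v i : frame_coord v i 0 \is a GRing.unit.
Proof.
have /asboolP vP := valP v.
pose s (j : 'I_(minn 3 2)) : 'I_3 :=
  if j == i :> nat then ord_max else widen_ord (leqnSn 2) j.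
have sI : injective s.
  move=> j k /(congr1 val); rewrite /s; case: eqP => ji; case: eqP => ki /= E.
  - by apply/val_inj; rewrite /= ji ki.
  - by have := ltn_ord k; rewrite -E.
  - by have := ltn_ord j; rewrite E.
  - exact/val_inj.
have /(@summand_basis_unitmx R 2) := vP s sI.
pose E : 'M[R]_2 := \matrix_(r, c) if c == i then frame_coord v r 0 else (r == c)%:R.
have -> : colsmx (val v \o s) = frame_basis v *m E.
  apply/matrixP => r c; rewrite !mxE /s /=.
  have [ci|ci] := eqVneq c i.
    rewrite ci eqxx -[LHS]/(val v ord_max r 0).
    rewrite -{1}(mulKVmx (frame_basis_unit v) (val v ord_max)) mxE.
    by apply: eq_bigr => k _; rewrite !mxE eqxx.
  rewrite (_ : (c == i :> nat) = false); last exact/negbTE.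
  rewrite (bigD1 c) //= big1 ?addr0 => [|k /negPf kc].
    by rewrite !mxE (negPf ci) eqxx mulr1.
  by rewrite !mxE (negPf ci) kc mulr0.
rewrite unitmx_mul frame_basis_unit /= unitmxE det22 !mxE.
clear; case: i => [[|[|//]] ilt] /=; rewrite !(mulr0, mul0r, subr0, mulr1, mul1r).
  by rewrite (_ : Ordinal ilt = 0) //; exact/val_inj.
by rewrite (_ : Ordinal ilt = 1) //; exact/val_inj.
Qed.

Definition frame_units (v : frame 2) : (U * U)%type :=
  (exist (fun a => a \is a GRing.unit) _ (frame_coord_unit v 0),
   exist (fun a => a \is a GRing.unit) _ (frame_coord_unit v 1)).

Lemma frame_coord_act g v : frame_coord (frame_act g v) = frame_coord v.
Proof.
have E : frame_basis (frame_act g v) = val g *m frame_basis v.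
  apply/matrixP => i j; rewrite !mxE /= ffunE mxE.
  by apply: eq_bigr => k _; rewrite mxE.
have gvu : frame_basis (frame_act g v) \in unitmx by exact: frame_basis_unit.
apply: (can_inj (mulKmx gvu)); rewrite mulKVmx // E -mulmxA.
by rewrite mulKVmx ?frame_basis_unit //= ffunE.
Qed.

Lemma frame_units_act g v : frame_units (frame_act g v) = frame_units v.
Proof. by congr pair; apply/val_inj; rewrite /= frame_coord_act. Qed.

Definition std_vec (a : U * U) (i : 'I_3) : V :=
  if i == 0 then delta_mx 0 0
  else if i == 1 then delta_mx 1 0
  else val a.1 *: delta_mx 0 0 + val a.2 *: delta_mx 1 0.

Fact std_frame_subproof a : @gen_position 2 (finfun (std_vec a)).
Proof.
move=> s sI; apply/(@summand_basis_unitmx R 2); rewrite unitmxE det22 !mxE /=.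
have : s 0 != s 1 by apply/eqP => /sI.
rewrite !ffunE; move: (s 0) (s 1) => i j {s sI}.
case: i => [[|[|[|//]]] ?]; case: j => [[|[|[|//]]] ?] //= _;
  rewrite /std_vec /= !mxE /= ?(mulr0, mul0r, mulr1, mul1r, addr0, add0r, subr0, sub0r) //
  ?unitrN ?unitr1 ?(valP a.1) ?(valP a.2) //.
Qed.

Definition std_frame (a : U * U) : frame 2 := Frame (std_frame_subproof a).

Lemma std_frameK : cancel std_frame frame_units.
Proof.
move=> a.
have cE : frame_coord (std_frame a) = val a.1 *: delta_mx 0 0 + val a.2 *: delta_mx 1 0.
  rewrite /frame_coord (_ : frame_basis _ = 1%:M); last first.
    apply/matrixP => i j; rewrite !mxE /= ffunE /std_vec.
    case: j => [[|[|//]] ?]; case: i => [[|[|//]] ?];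
    by rewrite /= !mxE.
  by rewrite invmx1 mul1mx /= ffunE.
case: a cE => a1 a2 cE; congr pair; apply/val_inj; rewrite /= cE !mxE /=.
  by rewrite mulr1 mulr0 addr0.
by rewrite mulr1 mulr0 add0r.
Qed.

Lemma frame_units_std v :
  std_frame (frame_units v) =
  frame_act (GL_inv (exist (fun A => A \in unitmx) _ (frame_basis_unit v))) v.
Proof.
have e j : invmx (frame_basis v) *m val v (widen_ord (leqnSn 2) j) = delta_mx j 0.
  have -> : val v (widen_ord (leqnSn 2) j) = frame_basis v *m delta_mx j 0.
    by rewrite -colE; apply/colP => i; rewrite !mxE.
  by rewrite mulKmx ?frame_basis_unit.
apply/val_inj/ffunP => i; rewrite !ffunE /= /std_vec.
case: eqP => [->|i0]; first by rewrite -e; congr (_ *m val v _); apply/val_inj.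
case: eqP => [->|i1]; first by rewrite -e; congr (_ *m val v _); apply/val_inj.
have -> : i = ord_max.
  apply/val_inj; case: i i0 i1 => [[|[|[|//]]] ?] i0 i1 //.
    by case: i0; apply/val_inj.
  by case: i1; apply/val_inj.
rewrite -/(frame_coord v) [RHS]matrix_sum_delta.
by rewrite !big_ord_recl !big_ord0 !addr0; congr (_ *: _ + _ *: delta_mx _ _); try congr (frame_coord v _ _); apply/val_inj.
Qed.

Fact H0D2_iso_subproof x : coinv_rel (@D_act 2) x ->
  flift (fun v => << frame_units v >> : {freeg (U * U)%type}) x = 0.
Proof.
case=> g [a ->]; rewrite raddfB; apply/eqP; rewrite subr_eq0; apply/eqP.
pose F := flift (fun v => << frame_units v >> : {freeg (U * U)%type}).
rewrite -[LHS]/((F \o D_act g) a) -[RHS]/(F a); move: a; apply: freeg_ext => v.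
by rewrite /F /= D_actU !flift1 frame_units_act.
Qed.

Definition H0D2_iso : H0D2 -> {freeg (U * U)%type} := qlift H0D2_iso_subproof.
Fact H0D2_iso_is_zmod_morphism : zmod_morphism H0D2_iso.
Proof. exact: qlift_is_zmod_morphism. Qed.
HB.instance Definition _ :=
  GRing.isZmodMorphism.Build _ _ H0D2_iso H0D2_iso_is_zmod_morphism.

Lemma H0D2_iso_std a :
  H0D2_iso (qclass (coinv_rel (@D_act 2)) << std_frame a >>) = << a >>.
Proof. by rewrite /H0D2_iso qlift_class /= flift1 std_frameK. Qed.

Lemma H0D2_iso_bij : bijective H0D2_iso.
Proof.
pose q := qclass (coinv_rel (@D_act 2)).
pose h := flift (fun a => q << std_frame a >>).
exists h => [x|y].
  have [y ->] := qclassP x.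
  rewrite -[RHS]/(q y) -[LHS]/((h \o H0D2_iso \o q) y).
  move: y; apply: freeg_ext => v; rewrite /= /H0D2_iso qlift_class /= flift1 /h flift1.
  apply/eqP; rewrite frame_units_std -subr_eq0 -raddfB; apply/eqP/qclass_eq0/genS.
  by eexists _, << v >>; rewrite D_actU.
rewrite -[RHS]/(idfun y) -[LHS]/((H0D2_iso \o h) y).
by move: y; apply: freeg_ext => a; rewrite /= /h flift1 H0D2_iso_std.
Qed.

Definition symbols := {a : U * U | a != (1%g, 1%g)}.
HB.instance Definition _ := SubChoice.on symbols.

Definition drop11 : {freeg (U * U)%type} -> {freeg symbols} :=
  flift (fun a => if insub a is Some s then << s >> else 0).
Fact drop11_is_zmod_morphism : zmod_morphism drop11.
Proof. exact: flift_is_zmod_morphism. Qed.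
HB.instance Definition _ :=
  GRing.isZmodMorphism.Build _ _ drop11 drop11_is_zmod_morphism.

Lemma drop11_11 : drop11 << (1%g, 1%g) >> = 0.
Proof. by rewrite /drop11 flift1 insubF // eqxx. Qed.

Lemma drop11_symbol (s : symbols) : drop11 << val s >> = << s >>.
Proof. by rewrite /drop11 flift1 valK. Qed.

Definition nu : calP -> {freeg symbols} := drop11 \o H0D2_iso \o calP_incl.
Fact nu_is_zmod_morphism : zmod_morphism nu.
Proof. by move=> x y; rewrite /nu /= !raddfB. Qed.
HB.instance Definition _ :=
  GRing.isZmodMorphism.Build _ _ nu nu_is_zmod_morphism.

End Delta.

(* Main.v *)
(* Let D_l be the complex of frames of R^2.  As R has many units, any finite    *)
(* set of frames can be coned off by a generic vector, so the augmented complex *)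
(* D_* -> Z is exact; for l >= 1 the GL_2-set of frames is free, while D_0 is   *)
(* the permutation module on the orbit of e_2.  In the double complex           *)
(* C_q(GL_2; D_p) the columns p >= 1 are thus acyclic, column 0 computes the    *)
(* homology of the stabilizer of e_2, and a diagram chase identifies the        *)
(* cokernel of H_3(stabilizer) -> H_3(GL_2) with the kernel of                  *)
(* H_0(im d_3) -> H_0(D_2), granted that H_2(stabilizer) -> H_2(GL_2) is        *)
(* injective.  The latter kernel is that of nu because the boundary             *)
(* D_2 -> D_1 sends every orbit [a1, a2] to the same class of infinite order.   *)
(*   The stabilizer is the affine group of R, and its inclusion of R^* is a     *)
(* homology isomorphism: a scalar a in R acts on H_q by an endomorphism which   *)
(* is polynomial of degree <= q in a and the identity at all units; as there    *)
(* are q + 1 scalars all of whose nonempty partial sums are units, it is also   *)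
(* the identity at 0, where it factors through the homology of R^*.             *)
(*   Finally, the boundaries of the frames (e1, e2, x e1 + y e2, xs e1 + yt e2) *)
(* give a presentation of the cokernel of nu which, by elementary               *)
(* manipulations, is equivalent to bimultiplicativity plus the Steinberg        *)
(* relations.                                                                   *)

From HB Require Import structures.
Require Import Defs.
From mathcomp Require Import all_boot all_order all_algebra.
From mathcomp Require Import boolp freeg ring.

Set Implicit Arguments.
Unset Strict Implicit.
Unset Printing Implicit Defensive.

Import GRing.Theory.
Local Open Scope ring_scope.

(** * Identities in abelian groups *)

(** The left half compares two filtrations of one double complex by hand. A 3-cycle of [GL_2] and an
    element of the image of the third boundary correspond when a [staircase] joins them. Descending
    uses exactness of the rows ([row_exact], [row_exact0]); the outcome is unique up to
    coinvariants, and cycles from [GL_1] go to zero ([staircase_zero]). Climbing back uses exactness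
    of the columns of positive index ([column_exact]) and, in column 0, [column0_surj] and
    [column0_inj]. The injectivity in column 0 comes from the determinant, which recovers the [GL_1]
    part of the stabilizer. Hence [alpha] is injective with image the kernel of [calP_incl]. By
    [ker_nu] this is the kernel of [nu]: classes coming from the third boundary have augmentation 0,
    so dropping [1,1] loses nothing.

    Column 0 rests on [affine_homology]. For scalars a_0, ..., a_q the alternating sum, over subsets
    J, of the endomorphisms given by multiplication by a_J (the sum over J) is null on q-cycles
    ([kills_null], [kills_line]). If every a_J with J nonempty is a unit, those endomorphisms are
    inner and homotopic to the identity ([scal_null]), so multiplication by 0, the term of the empty
    set, is homologous to the identity as well.

    For the right half, [faces_units] turns the boundary of a frame of four vectors into the
    relation [cocycle]. A Steinberg symbol satisfies it ([symbol_cocycle]). Conversely, the mixed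
    differences of a cocycle are invariant under scaling ([cross_scale]), hence bimultiplicative,
    and generic units kill the remaining one-variable parts ([p_eq0], [q_eq0]). So the cokernel of
    [nu] and [K2M] have equivalent presentations, which gives [beta_exact]. *)

Inductive zexp := ZVar of nat | ZZero | ZAdd of zexp & zexp | ZOpp of zexp.

Section Zexp.
Variable A : zmodType.

Fixpoint zeval (s : seq A) (e : zexp) : A :=
  match e with
  | ZVar n => nth 0 s n
  | ZZero => 0
  | ZAdd e1 e2 => zeval s e1 + zeval s e2
  | ZOpp e1 => - zeval s e1
  end.

(** The flag [b] carries the pending sign down to the leaves, so comparing two expressions amounts
    to comparing computed integers. *)
Fixpoint zcoef (b : bool) (e : zexp) (n : nat) : int :=
  match e with
  | ZVar m => if m == n then (if b then (-1)%Z else 1%Z) else 0%Z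
  | ZZero => 0%Z
  | ZAdd e1 e2 => (zcoef b e1 n + zcoef b e2 n)%R
  | ZOpp e1 => zcoef (~~ b) e1 n
  end.

Lemma zevalE s b e :
  (if b then - zeval s e else zeval s e) =
  \sum_(n < size s) nth 0 s n *~ zcoef b e n.
Proof.
elim: e b => [m||e1 IH1 e2 IH2|e IH] b /=.
- have [ms|ms] := ltnP m (size s).
    rewrite (bigD1 (Ordinal ms)) //= eqxx big1 ?addr0 => [|i /negPf im].
      by case: b; rewrite ?mulrN1z ?mulr1z.
    by rewrite eq_sym -val_eqE /= in im; rewrite im mulr0z.
  rewrite nth_default ?oppr0 // big1 => [|i _]; first by case: b.
  by rewrite gtn_eqF ?mulr0z // (leq_trans _ ms).
- by rewrite oppr0 big1 => [|i _]; [case: b | rewrite mulr0z].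
- under eq_bigr do rewrite mulrzDr.
  by rewrite big_split /= -IH1 -IH2; case: b; rewrite ?opprD.
- by rewrite -IH; case: b; rewrite ?opprK.
Qed.

Lemma zexp_eq s e1 e2 :
  all (fun n => zcoef false e1 n == zcoef false e2 n) (iota 0 (size s)) ->
  zeval s e1 = zeval s e2.
Proof.
move=> /allP e12; rewrite (zevalE s false e1) (zevalE s false e2).
by apply: eq_bigr => i _; rewrite (eqP (e12 i _)) // mem_iota /=.
Qed.

Lemma zmod_transfer (a b c d : A) : c = d -> a - b = c - d -> a = b.
Proof. by move=> -> /eqP; rewrite subrr subr_eq0 => /eqP. Qed.

End Zexp.

Create HintDb zatom.
#[global] Hint Opaque flift : zatom.

(* Two occurrences of an atom may differ in the canonical structures they      *)
(* mention, so that the arguments are compared up to conversion.               *)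
Ltac zsame a b :=
  first [ constr_eq a b
        | lazymatch a with ?f ?x => lazymatch b with ?g ?y =>
            zsame f g; first [ zsame x y | unify x y with zatom ] end end ].
Ltac zmember a s :=
  lazymatch s with
  | nil => constr:(false)
  | ?b :: ?s' => match constr:(true) with
                 | _ => let _ := match constr:(true) with _ => zsame a b end in constr:(true)
                 | _ => zmember a s'
                 end
  end.
Ltac zatoms s t :=
  lazymatch t with
  | (?a + ?b)%R => let s1 := zatoms s a in zatoms s1 b
  | (- ?a)%R => zatoms s a
  | 0%R => s
  | _ => lazymatch zmember t s with
         | true => s
         | false => constr:(t :: s)
         end
  end.
Ltac zindex a s :=
  lazymatch s with
  | ?b :: ?s' => match constr:(true) with
                 | _ => let _ := match constr:(true) with _ => zsame a b end in constr:(0%N)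
                 | _ => let n := zindex a s' in constr:(S n)
                 end
  end.
Ltac zquote s t :=
  lazymatch t with
  | (?a + ?b)%R => let x := zquote s a in let y := zquote s b in constr:(ZAdd x y)
  | (- ?a)%R => let x := zquote s a in constr:(ZOpp x)
  | 0%R => constr:(ZZero)
  | _ => let n := zindex t s in constr:(ZVar n)
  end.
Ltac zmod :=
  lazymatch goal with
  | |- @eq ?A ?a ?b =>
    let s0 := zatoms (@nil A) a in
    let s := zatoms s0 b in
    let x := zquote s a in
    let y := zquote s b in
    refine (@zexp_eq _ s x y _); vm_compute; reflexivity
  end.
(* Closes a goal a = b from an equation e : c = d when a - b = c - d holds in   *)
(* every abelian group.                                                       *)
Ltac zmod_from e := refine (zmod_transfer e _); zmod.

(** * Free abelian groups *)

Definition bas (K : choiceType) (k : K) : {freeg K} := << k >>.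

Lemma flift_bas (K : choiceType) (A : zmodType) (f : K -> A) k : flift f (bas k) = f k.
Proof. exact: flift1. Qed.

Lemma freegU_bas (K : choiceType) (z : int) (k : K) : << z *g k >> = bas k *~ z.
Proof. exact: freegU_mulz1. Qed.

Section Spanned.
Variable K : choiceType.
Implicit Types (P : K -> Prop) (A : zmodType).

(** Stands in for a condition on supports. It is used with [P] a degree, a fixed leading vertex,
    general position with a vector, or a bound on a count, and it reduces claims about additive maps
    to basis elements. *)
Definition spanned P : {freeg K} -> Prop :=
  gen (fun x => exists2 k, P k & x = (bas k)).

Lemma spannedU P k : P k -> spanned P (bas k).
Proof. by move=> Pk; apply: genS; exists k. Qed.

Lemma spanned_dom (y : {freeg K}) : spanned (fun k => k \in dom y) y.
Proof.
rewrite -{2}(freeg_sumE y) big_seq; set S := spanned _.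
have S0 : S 0 by exact: gen0.
have SN x : S x -> S (- x) by rewrite -sub0r; apply: genB.
have SD x z : S x -> S z -> S (x + z).
  by move=> Sx /SN Sz; rewrite -[z]opprK; apply: genB.
elim/big_ind: _ => // k kd; rewrite freegU_mulz1 -/(bas k).
have Sk : S (bas k) by exact: spannedU.
have Sn n : S ((bas k) *+ n) by elim: n => [|n IH] //; rewrite mulrS; apply: SD.
by case: (coeff k y) => n; rewrite ?NegzE ?mulrNz; [|apply: SN]; apply: Sn.
Qed.

Lemma spanned_sub P P' y : (forall k, P k -> P' k) -> spanned P y -> spanned P' y.
Proof.
move=> PP'; elim=> [|_ [k Pk ->]|x z _ Sx _ Sz]; first exact: gen0.
- exact/spannedU/PP'.
- exact: genB.
Qed.

Lemma spannedB P x y : spanned P x -> spanned P y -> spanned P (x - y).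
Proof. exact: genB. Qed.

Lemma spannedN P x : spanned P x -> spanned P (- x).
Proof. by rewrite -sub0r; apply/genB/gen0. Qed.

Lemma spannedD P x y : spanned P x -> spanned P y -> spanned P (x + y).
Proof. by move=> Px /spannedN Py; rewrite -[y]opprK; apply: genB. Qed.

Lemma spanned_add A (S : A -> Prop) (f : {additive {freeg K} -> A}) P y :
  spanned P y -> (forall k, P k -> gen S (f (bas k))) -> gen S (f y).
Proof.
move=> Py Pf; elim: Py => [|_ [k Pk ->]|x z _ Sx _ Sz].
- by rewrite raddf0; exact: gen0.
- exact: Pf.
- by rewrite raddfB; exact: genB.
Qed.

Lemma spanned_eq A (f g : {additive {freeg K} -> A}) P y :
  spanned P y -> (forall k, P k -> f (bas k) = g (bas k)) -> f y = g y.
Proof.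
move=> Py Pfg; elim: Py => [|_ [k Pk ->]|x z _ Sx _ Sz].
- by rewrite !raddf0.
- exact: Pfg.
- by rewrite !raddfB Sx Sz.
Qed.

Lemma freeg_ind (Q : {freeg K} -> Prop) :
  (forall k, Q (bas k)) -> Q 0 -> (forall x y, Q x -> Q y -> Q (x - y)) ->
  forall y, Q y.
Proof.
by move=> QU Q0 QB y; elim: (spanned_dom y) => [|_ [k _ ->]|x z _ Sx _ Sz] //; apply: QB.
Qed.

Lemma eq_freeg A (f g : {additive {freeg K} -> A}) :
  (forall k, f (bas k) = g (bas k)) -> f =1 g.
Proof. exact: freeg_ext. Qed.

End Spanned.

(** * Bar complex of a group action *)

Record gset (G : groupType) := Gset {
  gset_sort :> choiceType;
  gact : G -> gset_sort -> gset_sort;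
  gact1 : forall x, gact 1%g x = x;
  gactM : forall g h x, gact (g * h)%g x = gact g (gact h x) }.

Definition gset1 (G : groupType) : gset G :=
  @Gset G unit (fun _ x => x) (fun _ => erefl) (fun _ _ _ => erefl).

(* The pair ([:: g1; ..; gq], x) is the simplex [g1|...|gq]x of the action      *)
(* groupoid, whose last face is [g1|...|g(q-1)](gq x).  All degrees share one   *)
(* group, the degree of a simplex being the length of its list.                 *)
Definition chain (G : groupType) (X : gset G) := {freeg (seq G * X)%type}.

Section Bar.
Variables (G : groupType) (X : gset G).
Local Notation C := (chain X).
Local Notation simp := (seq G * X)%type.
Implicit Types (w : simp) (x : X) (g : G).

Definition scons g w : simp := (g :: w.1, w.2).
Definition slmul g w : simp :=
  if w.1 is h :: l then ((g * h)%g :: l, w.2) else ([::], gact g w.2).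

Lemma simp_ind (P : simp -> Prop) :
  (forall x, P ([::], x)) -> (forall g w, P w -> P (scons g w)) -> forall w, P w.
Proof. by move=> P0 PS [l x]; elim: l => [|g l IH]; [exact: P0 | exact: (PS g (l, x))]. Qed.

(** Faces are handled recursively rather than by index: [slmul g w] is the second face of
    [scons g w], and the rule [Nop_K] replaces the simplicial identities. *)
Definition Kop g : C -> C := flift (fun w => (bas (scons g w))).
HB.instance Definition _ g :=
  GRing.isZmodMorphism.Build _ _ (Kop g) (flift_is_zmod_morphism _).
Definition Lop g : C -> C := flift (fun w => (bas (slmul g w))).
HB.instance Definition _ g :=
  GRing.isZmodMorphism.Build _ _ (Lop g) (flift_is_zmod_morphism _).
Definition d0 : C -> C := flift (fun w : simp => if w.1 is _ :: l then (bas (l, w.2)) else 0).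
HB.instance Definition _ :=
  GRing.isZmodMorphism.Build _ _ d0 (flift_is_zmod_morphism _).

(* The alternating sum of the faces other than the first one. *)
Fixpoint Nlist (l : seq G) x : C :=
  if l is g :: l' then (bas (slmul g (l', x))) - Kop g (Nlist l' x) else 0.
Definition Nop : C -> C := flift (fun w => Nlist w.1 w.2).
HB.instance Definition _ :=
  GRing.isZmodMorphism.Build _ _ Nop (flift_is_zmod_morphism _).
Definition bd : C -> C := flift (fun w => d0 (bas w) - Nop (bas w)).
HB.instance Definition _ :=
  GRing.isZmodMorphism.Build _ _ bd (flift_is_zmod_morphism _).

Lemma bdE y : bd y = d0 y - Nop y.
Proof. by move: y; apply: (eq_freeg (g := d0 \- Nop)) => w; exact: flift_bas. Qed.

Lemma KopU g w : Kop g (bas w) = (bas (scons g w)). Proof. exact: flift_bas. Qed.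
Lemma LopU g w : Lop g (bas w) = (bas (slmul g w)). Proof. exact: flift_bas. Qed.
Lemma d0_nil x : d0 (bas ([::], x)) = 0. Proof. exact: flift_bas. Qed.
Lemma d0_cons g w : d0 (bas (scons g w)) = (bas w).
Proof. by case: w => l x; rewrite /d0 /= flift_bas. Qed.
Lemma Nop_nil x : Nop (bas ([::], x)) = 0. Proof. exact: flift_bas. Qed.
Lemma Nop_cons g w :
  Nop (bas (scons g w)) = Lop g (bas w) - Kop g (Nop (bas w)).
Proof. by rewrite LopU /Nop /= !flift_bas /=; case: w. Qed.

Lemma d0_K g y : d0 (Kop g y) = y.
Proof.
move: y; apply: (eq_freeg (f := d0 \o Kop g) (g := idfun)) => w /=.
by rewrite KopU d0_cons.
Qed.

Lemma Nop_K g y : Nop (Kop g y) = Lop g y - Kop g (Nop y).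
Proof.
move: y; apply: (eq_freeg (f := Nop \o Kop g) (g := Lop g \- (Kop g \o Nop))) => w /=.
by rewrite KopU Nop_cons.
Qed.

Lemma LK g h y : Lop g (Kop h y) = Kop (g * h)%g y.
Proof.
move: y; apply: (eq_freeg (f := Lop g \o Kop h)) => w /=.
by rewrite !KopU LopU.
Qed.

Lemma LL g h y : Lop g (Lop h y) = Lop (g * h)%g y.
Proof.
move: y; apply: (eq_freeg (f := Lop g \o Lop h)) => -[[|k l] x] /=.
  by rewrite !LopU /slmul /= gactM.
by rewrite !LopU /slmul /= mulgA.
Qed.

Lemma NL g y : Nop (Lop g y) = Lop g (Nop y).
Proof.
move: y; apply: (eq_freeg (f := Nop \o Lop g) (g := Lop g \o Nop)) => w /=.
elim/simp_ind: w => [x|h w _]; first by rewrite LopU !Nop_nil raddf0.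
by rewrite -KopU LK !Nop_K raddfB /= LK LL.
Qed.

Lemma NN y : Nop (Nop y) = 0.
Proof.
move: y; apply: (eq_freeg (f := Nop \o Nop) (g := \0)) => w /=.
elim/simp_ind: w => [x|h w IH]; first by rewrite Nop_nil raddf0.
by rewrite -KopU Nop_K raddfB /= Nop_K NL IH raddf0; zmod.
Qed.

Lemma d0L g y : d0 (Lop g y) = d0 y.
Proof.
move: y; apply: (eq_freeg (f := d0 \o Lop g)) => w /=.
elim/simp_ind: w => [x|h w _]; first by rewrite LopU !d0_nil.
by rewrite -KopU LK !d0_K.
Qed.

(** The sum of the simplicial identities in which the first face is applied last. Together with [NN]
    it gives that the square of [d0 - Nop] is zero. *)
Lemma d0_d0 y : d0 (d0 y) = d0 (Nop y) + Nop (d0 y).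
Proof.
move: y; apply: (eq_freeg (f := d0 \o d0) (g := (d0 \o Nop) \+ (Nop \o d0))) => w /=.
elim/simp_ind: w => [x|h w _]; first by rewrite d0_nil Nop_nil !raddf0 addr0.
by rewrite -KopU Nop_K raddfB /= !d0_K d0L; zmod.
Qed.

Lemma bd_bd y : bd (bd y) = 0.
Proof. by rewrite !bdE !raddfB /= d0_d0 NN; zmod. Qed.

Lemma bd_K g y : bd (Kop g y) = y - Lop g y + Kop g (Nop y).
Proof. by rewrite !bdE d0_K Nop_K; zmod. Qed.

Fixpoint vert (l : seq G) x : X := if l is g :: l' then gact g (vert l' x) else x.
Definition v0 w := vert w.1 w.2.

Lemma v0_slmul g w : v0 (slmul g w) = gact g (v0 w).
Proof. by case: w => -[|h l] x; rewrite /v0 //= gactM. Qed.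

(** Only the first face changes the leading vertex. Operators that depend on it, such as [etacons],
    are therefore uniform on all terms of [Nop (bas w)]. *)
Lemma Nop_spanned w : spanned (fun w' => v0 w' = v0 w) (Nop (bas w)).
Proof.
elim/simp_ind: w => [x|g w IH]; first by rewrite Nop_nil; exact: gen0.
rewrite Nop_cons LopU; apply: spannedB; first by apply: spannedU; rewrite v0_slmul.
apply: spanned_add IH _ => w' w'w; rewrite /= KopU; apply: spannedU.
by rewrite /v0 /= -/(v0 w') w'w.
Qed.

(* The functor x |-> eta(x)^-1 x, g |-> eta(g x)^-1 g eta(x) of the action     *)
(* groupoid is isomorphic to the identity; prism is the resulting homotopy.    *)
Section Gauge.
Variable eta : X -> G.

Fixpoint gauge_list (l : seq G) x : seq G :=
  if l is g :: l' then
    ((eta (gact g (vert l' x)))^-1 * g * eta (vert l' x))%g :: gauge_list l' x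
  else [::].
Definition gauge_simp w : simp := (gauge_list w.1 w.2, gact (eta w.2)^-1%g w.2).
Definition gauge : C -> C := flift (fun w => (bas (gauge_simp w))).
HB.instance Definition _ :=
  GRing.isZmodMorphism.Build _ _ gauge (flift_is_zmod_morphism _).
Definition etacons : C -> C := flift (fun w => (bas (scons (eta (v0 w)) (gauge_simp w)))).
HB.instance Definition _ :=
  GRing.isZmodMorphism.Build _ _ etacons (flift_is_zmod_morphism _).
Fixpoint prism_list (l : seq G) x : C :=
  etacons (bas (l, x)) - (if l is g :: l' then Kop g (prism_list l' x) else 0).
Definition prism : C -> C := flift (fun w => prism_list w.1 w.2).
HB.instance Definition _ :=
  GRing.isZmodMorphism.Build _ _ prism (flift_is_zmod_morphism _).

Lemma gaugeU w : gauge (bas w) = (bas (gauge_simp w)). Proof. exact: flift_bas. Qed.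
Lemma etaconsU w : etacons (bas w) = Kop (eta (v0 w)) (gauge (bas w)).
Proof. by rewrite gaugeU KopU; apply: flift_bas. Qed.

Lemma gauge_K g w :
  gauge (Kop g (bas w)) =
  Kop ((eta (gact g (v0 w)))^-1 * g * eta (v0 w))%g (gauge (bas w)).
Proof. by rewrite !(gaugeU, KopU). Qed.

Lemma prism_nil x : prism (bas ([::], x)) = etacons (bas ([::], x)).
Proof. by rewrite /prism flift_bas /= subr0. Qed.

Lemma prism_K g y : prism (Kop g y) = etacons (Kop g y) - Kop g (prism y).
Proof.
move: y; apply: (eq_freeg (f := prism \o Kop g)
  (g := (etacons \o Kop g) \- (Kop g \o prism))) => -[l x] /=.
by rewrite KopU /prism !flift_bas.
Qed.

Lemma gauge_L g w :
  gauge (Lop g (bas w)) =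
  Lop ((eta (gact g (v0 w)))^-1 * g * eta (v0 w))%g (gauge (bas w)).
Proof.
elim/simp_ind: w => [x|h w _].
  rewrite !(LopU, gaugeU) /gauge_simp /slmul /= /v0 /=; congr (bas (_, _)).
  by rewrite !gactM -(gactM (eta x)) mulgV gact1.
rewrite -KopU LK !gauge_K LK /v0 /= -/(v0 w) gactM; congr (Kop _ _).
by rewrite !mulgA mulgK.
Qed.

Lemma gauge_N y : gauge (Nop y) = Nop (gauge y).
Proof.
move: y; apply: (eq_freeg (f := gauge \o Nop) (g := Nop \o gauge)) => w /=.
elim/simp_ind: w => [x|g w IH]; first by rewrite gaugeU !Nop_nil raddf0.
rewrite -KopU gauge_K !Nop_K raddfB /= gauge_L -IH; congr (_ - _).
apply: (spanned_eq (f := gauge \o Kop g) (g := Kop _ \o gauge) (Nop_spanned w)).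
by move=> w' w'w /=; rewrite gauge_K w'w.
Qed.

Lemma gauge_d0 y : gauge (d0 y) = d0 (gauge y).
Proof.
move: y; apply: (eq_freeg (f := gauge \o d0) (g := d0 \o gauge)) => w /=.
elim/simp_ind: w => [x|g w IH]; first by rewrite gaugeU !d0_nil raddf0.
by rewrite -KopU gauge_K !d0_K.
Qed.

Lemma gauge_bd y : gauge (bd y) = bd (gauge y).
Proof. by rewrite !bdE raddfB /= gauge_d0 gauge_N. Qed.

(** The homotopy formula splits: first faces contribute the gauged end of the prism, and the other
    faces contribute the original end ([prism_N]). *)
Lemma prism_d0 y : d0 (prism y) + prism (d0 y) = gauge y.
Proof.
move: y; apply: (eq_freeg (f := (d0 \o prism) \+ (prism \o d0)) (g := gauge)) => w /=.
elim/simp_ind: w => [x|g w _].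
  by rewrite prism_nil d0_nil raddf0 addr0 etaconsU d0_K.
rewrite -KopU prism_K raddfB /= !d0_K KopU etaconsU d0_K; zmod.
Qed.

Lemma prism_L g w :
  prism (Lop g (bas w)) - Lop g (prism (bas w)) =
  etacons (Lop g (bas w)) - Kop (g * eta (v0 w))%g (gauge (bas w)).
Proof.
elim/simp_ind: w => [x|h w _].
  by rewrite LopU !prism_nil /= !etaconsU LK.
rewrite -KopU LK !prism_K raddfB /= LK !KopU !etaconsU LK; zmod.
Qed.

Lemma prism_N y : Nop (prism y) + prism (Nop y) = y.
Proof.
move: y; apply: (eq_freeg (f := (Nop \o prism) \+ (prism \o Nop)) (g := idfun)) => w /=.
elim/simp_ind: w => [x|g w IH].
  rewrite prism_nil Nop_nil raddf0 addr0 etaconsU Nop_K gaugeU Nop_nil raddf0 subr0.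
  by rewrite LopU /slmul /= /v0 /= -gactM mulgV gact1.
rewrite -KopU prism_K Nop_K !raddfB /= Nop_K prism_K {1}KopU etaconsU -KopU Nop_K.
(* All terms of [Nop (bas w)] share the leading vertex of [w], so [etacons] prepends the same group
   element to each. *)
have -> : etacons (Kop g (Nop (bas w))) =
          Kop (eta (gact g (v0 w))) (gauge (Kop g (Nop (bas w)))).
  apply: (spanned_eq (f := etacons \o Kop g)
    (g := Kop (eta (gact g (v0 w))) \o gauge \o Kop g) (Nop_spanned w)).
  by move=> w' w'w /=; rewrite KopU etaconsU /v0 /= -/(v0 w') w'w.
have -> : v0 (scons g w) = gact g (v0 w) by [].
rewrite -gauge_N Nop_K raddfB /=.
have E1 : prism (Lop g (bas w)) = Lop g (prism (bas w)) +
  etacons (Lop g (bas w)) - Kop (g * eta (v0 w))%g (gauge (bas w)).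
  zmod_from (prism_L g w).
rewrite E1 gauge_K LK !mulgA mulgV mul1g LopU etaconsU v0_slmul -LopU raddfB /=.
have := congr1 (Kop g) IH; rewrite raddfD /= => E2; zmod_from E2.
Qed.

Lemma prism_bd y : bd (prism y) + prism (bd y) = gauge y - y.
Proof. rewrite !bdE raddfB /= -prism_d0; zmod_from (esym (prism_N y)). Qed.

End Gauge.
End Bar.

(** * Functoriality and degrees *)

Section Cmap.
Variables (G H : groupType) (X : gset G) (Y : gset H) (phi : G -> H) (f : X -> Y).

Definition cmap : chain X -> chain Y := flift (fun w => bas (map phi w.1, f w.2)).
HB.instance Definition _ :=
  GRing.isZmodMorphism.Build _ _ cmap (flift_is_zmod_morphism _).

Lemma cmapU w : cmap (bas w) = bas (map phi w.1, f w.2).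
Proof. exact: flift_bas. Qed.

Hypothesis phiM : {morph phi : x y / (x * y)%g}.
Hypothesis fE : forall g x, f (gact g x) = gact (phi g) (f x).

Lemma cmap_K g y : cmap (Kop g y) = Kop (phi g) (cmap y).
Proof.
move: y; apply: (eq_freeg (f := cmap \o Kop g) (g := Kop (phi g) \o cmap)) => w /=.
by rewrite KopU !cmapU KopU.
Qed.

Lemma cmap_L g y : cmap (Lop g y) = Lop (phi g) (cmap y).
Proof.
move: y; apply: (eq_freeg (f := cmap \o Lop g) (g := Lop (phi g) \o cmap)).
by move=> [[|h l] x] /=; rewrite LopU !cmapU LopU /slmul /= ?fE ?phiM.
Qed.

Lemma cmap_N y : cmap (Nop y) = Nop (cmap y).
Proof.
move: y; apply: (eq_freeg (f := cmap \o @Nop G X) (g := @Nop H Y \o cmap)) => w /=.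
elim/simp_ind: w => [x|g w IH]; first by rewrite cmapU !Nop_nil raddf0.
by rewrite -KopU cmap_K !Nop_K raddfB /= cmap_L cmap_K IH.
Qed.

Lemma cmap_bd y : cmap (bd y) = bd (cmap y).
Proof.
rewrite !bdE raddfB /= cmap_N; congr (_ - _); move: y.
apply: (eq_freeg (f := cmap \o @d0 G X) (g := @d0 H Y \o cmap)) => w /=.
elim/simp_ind: w => [x|g w IH]; first by rewrite cmapU !d0_nil raddf0.
by rewrite -KopU cmap_K !d0_K.
Qed.

End Cmap.

Lemma cmap_comp (G H J : groupType) (X : gset G) (Y : gset H) (Z : gset J)
    (phi : G -> H) (f : X -> Y) (psi : H -> J) (g : Y -> Z) y :
  cmap psi g (cmap phi f y) = cmap (psi \o phi) (g \o f) y.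
Proof.
move: y; apply: (eq_freeg (f := cmap psi g \o cmap phi f)) => w /=.
by rewrite !cmapU -map_comp.
Qed.

Lemma eq_cmap (G H : groupType) (X : gset G) (Y : gset H)
    (phi phi' : G -> H) (f f' : X -> Y) : phi =1 phi' -> f =1 f' ->
  cmap phi f =1 cmap phi' f'.
Proof. by move=> /funext -> /funext ->. Qed.

Lemma cmap_id (G : groupType) (X : gset G) (y : chain X) : cmap id id y = y.
Proof.
move: y; apply: (eq_freeg (f := cmap id id) (g := idfun)) => -[l x] /=.
by rewrite cmapU map_id.
Qed.

Section Degree.
Variables (G : groupType) (X : gset G).
Local Notation C := (chain X).

Definition homog q : C -> Prop := spanned (fun w => size w.1 = q).
(** Homotopies are defined on all degrees at once; [pr] cuts the chains they produce down to one
    degree, compatibly with boundaries and induced maps. *)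
Definition pr q : C -> C := flift (fun w => if size w.1 == q then bas w else 0).
HB.instance Definition _ q :=
  GRing.isZmodMorphism.Build _ _ (pr q) (flift_is_zmod_morphism _).

Lemma prU q w : pr q (bas w) = if size w.1 == q then bas w else 0.
Proof. exact: flift_bas. Qed.

Lemma homog_pr q y : homog q (pr q y).
Proof.
apply: spanned_add (spanned_dom y) _ => w _; rewrite /= prU.
by case: eqP => [wq|_]; [exact: spannedU | exact: gen0].
Qed.

Lemma pr_homog q y : homog q y -> pr q y = y.
Proof.
move=> qy; apply: (spanned_eq (f := pr q) (g := idfun) qy) => w wq /=.
by rewrite prU wq eqxx.
Qed.

Lemma pr_K q g y : pr q.+1 (Kop g y) = Kop g (pr q y).
Proof.
move: y; apply: (eq_freeg (f := pr q.+1 \o Kop g) (g := Kop g \o pr q)) => w /=.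
by rewrite KopU !prU /= eqSS; case: ifP; rewrite ?KopU ?raddf0.
Qed.

Lemma pr_0K g y : pr 0 (Kop g y) = 0.
Proof. by move: y; apply: (eq_freeg (f := pr 0 \o Kop g) (g := \0)) => w /=; rewrite KopU prU. Qed.

Lemma pr_L q g y : pr q (Lop g y) = Lop g (pr q y).
Proof.
move: y; apply: (eq_freeg (f := pr q \o Lop g) (g := Lop g \o pr q)) => -[[|h l] x] /=;
by rewrite LopU /slmul /= !prU /=; case: ifP; rewrite ?LopU ?raddf0.
Qed.

Lemma pr_N q y : pr q (Nop y) = Nop (pr q.+1 y).
Proof.
move: y; apply: (eq_freeg (f := pr q \o @Nop G X) (g := @Nop G X \o pr q.+1)) => w /=.
elim/simp_ind: w q => [x|g w IH] q; first by rewrite prU /= Nop_nil !raddf0.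
rewrite -KopU pr_K !Nop_K raddfB /= pr_L; congr (_ - _).
case: q => [|q]; last by rewrite pr_K IH.
rewrite pr_0K prU; case: eqP; last by rewrite !raddf0.
by case: w IH => -[|h l] x //= _ _; rewrite Nop_nil raddf0.
Qed.

Lemma pr_bd q y : pr q (bd y) = bd (pr q.+1 y).
Proof.
rewrite !bdE raddfB /= pr_N; congr (_ - _); move: y.
apply: (eq_freeg (f := pr q \o @d0 G X) (g := @d0 G X \o pr q.+1)) => w /=.
elim/simp_ind: w => [x|g w IH]; first by rewrite prU /= d0_nil !raddf0.
by rewrite -KopU pr_K !d0_K.
Qed.

Lemma homog_bd q y : homog q.+1 y -> homog q (bd y).
Proof. by move=> qy; rewrite -(pr_homog qy) -pr_bd; exact: homog_pr. Qed.

End Degree.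

Lemma pr_cmap (G H : groupType) (X : gset G) (Y : gset H) (phi : G -> H)
    (f : X -> Y) q y : pr q (cmap phi f y) = cmap phi f (pr q y).
Proof.
move: y; apply: (eq_freeg (f := pr q \o cmap phi f) (g := cmap phi f \o pr q)) => w /=.
by rewrite cmapU !prU /= size_map; case: ifP; rewrite ?cmapU ?raddf0.
Qed.

Lemma homog_cmap (G H : groupType) (X : gset G) (Y : gset H) (phi : G -> H)
    (f : X -> Y) q y : homog q y -> homog q (cmap phi f y).
Proof. by move/pr_homog <-; rewrite -pr_cmap; exact: homog_pr. Qed.

(** * Acyclicity of free actions *)

Section Free.
Variables (G : groupType) (X : gset G) (h : X -> G) (t : X -> X).
Hypothesis ht : forall x, gact (h x) (t x) = x.
Hypothesis hE : forall g x, h (gact g x) = (g * h x)%g.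
Hypothesis tE : forall g x, t (gact g x) = t x.

(** Here [t] picks an orbit representative and [h x] carries it to [x]. The contraction inserts
    [h x] at the far end, with sign (-1)^q on q-simplices, so that the last face gives the simplex
    back. *)
Fixpoint contr_list (l : seq G) (x : X) : chain X :=
  if l is g :: l' then - Kop g (contr_list l' x) else bas ([:: h x], t x).
Definition contr : chain X -> chain X := flift (fun w => contr_list w.1 w.2).
HB.instance Definition _ :=
  GRing.isZmodMorphism.Build _ _ contr (flift_is_zmod_morphism _).

Lemma contr_nil x : contr (bas ([::], x)) = Kop (h x) (bas ([::], t x)).
Proof. by rewrite KopU; exact: flift_bas. Qed.

Lemma contr_K g y : contr (Kop g y) = - Kop g (contr y).
Proof.
move: y; apply: (eq_freeg (f := contr \o Kop g) (g := \- (Kop g \o contr))) => w /=.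
by rewrite KopU /contr !flift_bas.
Qed.

Lemma contr_L g y : contr (Lop g y) = Lop g (contr y).
Proof.
move: y; apply: (eq_freeg (f := contr \o Lop g) (g := Lop g \o contr)) => w /=.
elim/simp_ind: w => [x|k w _].
  by rewrite LopU /slmul /= !contr_nil LK hE tE.
by rewrite -KopU LK !contr_K raddfN /= LK.
Qed.

Lemma contr_N y : Nop (contr y) + contr (Nop y) = y.
Proof.
move: y; apply: (eq_freeg (f := (@Nop G X \o contr) \+ (contr \o @Nop G X)) (g := idfun)) => w /=.
elim/simp_ind: w => [x|g w IH].
  by rewrite contr_nil Nop_K !Nop_nil !raddf0 !addr0 LopU /slmul /= ht.
rewrite -KopU Nop_K contr_K raddfN raddfB /= Nop_K contr_K contr_L.
have := congr1 (Kop g) IH; rewrite raddfD /= => E; zmod_from E.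
Qed.

(** Positive degree is essential: on a vertex [x], the first face of the contraction is the vertex
    [t x]. *)
Lemma contr_d0 q y : homog q.+1 y -> d0 (contr y) + contr (d0 y) = 0.
Proof.
move=> qy; apply: (spanned_eq (f := (@d0 G X \o contr) \+ (contr \o @d0 G X)) (g := \0) qy).
case=> -[|g l] x //= _; rewrite -[(g :: l, x)]/(scons g (l, x)) -KopU.
by rewrite contr_K raddfN /= !d0_K; zmod.
Qed.

Lemma free_exact q (y : chain X) : homog q.+1 y -> bd y = 0 ->
  exists2 y' : chain X, homog q.+2 y' & bd y' = y.
Proof.
move=> qy dy; exists (pr q.+2 (- contr y)); first exact: homog_pr.
rewrite -pr_bd raddfN /= -[RHS](pr_homog qy); congr (pr _ _).
have E1 := contr_N y; have E2 := contr_d0 qy.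
have E3 : contr (d0 y) - contr (Nop y) = 0.
  by rewrite -raddfB -[RHS](raddf0 contr) -dy bdE.
have E4 : Nop (contr y) + contr (Nop y) - (d0 (contr y) + contr (d0 y)) +
   (contr (d0 y) - contr (Nop y)) = y - 0 + 0 by rewrite E1 E2 E3.
by rewrite !bdE; zmod_from E4.
Qed.

End Free.

(** * Comparison with the bar complex on finite functions *)

Section BarChain.
Variable G : groupType.
Local Notation bar n := {freeg {ffun 'I_n -> G}}.

Local Notation pt := (tt : gset1 G).

Definition glist n (g : {ffun 'I_n -> G}) : seq G := [seq g i | i <- enum 'I_n].
Definition gtail n (g : {ffun 'I_n.+1 -> G}) : {ffun 'I_n -> G} :=
  [ffun i => g (fintype.lift ord0 i)].

Lemma glist0 (g : {ffun 'I_0 -> G}) : glist g = [::].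
Proof. by rewrite /glist; case: (enum _) => // -[]. Qed.

Lemma glistS n (g : {ffun 'I_n.+1 -> G}) : glist g = g ord0 :: glist (gtail g).
Proof.
rewrite /glist enum_ordSl /= -map_comp; congr (_ :: _).
by apply: eq_map => i; rewrite ffunE.
Qed.

Lemma size_glist n (g : {ffun 'I_n -> G}) : size (glist g) = n.
Proof. by rewrite size_map size_enum_ord. Qed.

Lemma nth_glist n (g : {ffun 'I_n -> G}) (i : 'I_n) : nth 1%g (glist g) i = g i.
Proof. by rewrite (nth_map i) ?size_enum_ord // nth_ord_enum. Qed.

Definition to_chain n : bar n -> chain (gset1 G) := flift (fun g => bas (glist g, pt)).
HB.instance Definition _ n :=
  GRing.isZmodMorphism.Build _ _ (@to_chain n) (flift_is_zmod_morphism _).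

Definition of_chain n : chain (gset1 G) -> bar n :=
  flift (fun w : seq G * unit =>
    if size w.1 == n then bas [ffun i : 'I_n => nth 1%g w.1 i] else 0).
HB.instance Definition _ n :=
  GRing.isZmodMorphism.Build _ _ (@of_chain n) (flift_is_zmod_morphism _).

Lemma to_chainU n (g : {ffun 'I_n -> G}) : to_chain (bas g) = bas (glist g, pt).
Proof. exact: flift_bas. Qed.

Lemma to_chainK n (y : bar n) : of_chain n (to_chain y) = y.
Proof.
move: y; apply: (eq_freeg (f := @of_chain n \o @to_chain n) (g := idfun)) => g /=.
rewrite to_chainU /of_chain flift_bas /= size_glist eqxx; congr bas.
by apply/ffunP => i; rewrite ffunE nth_glist.
Qed.

Lemma of_chainK n (y : chain (gset1 G)) : to_chain (of_chain n y) = pr n y.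
Proof.
move: y; apply: (eq_freeg (f := @to_chain n \o of_chain n) (g := pr n)) => -[l []] /=.
rewrite prU /of_chain flift_bas /=; case: eqP => [ln|_]; last by rewrite raddf0.
rewrite to_chainU; congr (bas (_, pt)); apply: (@eq_from_nth _ 1%g).
  by rewrite size_glist.
by rewrite size_glist => i i_n; rewrite (nth_glist _ (Ordinal i_n)) ffunE.
Qed.

Lemma to_chain_face_sum n (g : {ffun 'I_n.+1 -> G}) :
  Nop (bas (glist g, pt) : chain (gset1 G)) =
  \sum_(i < n.+1) (bas (glist (bar_face (fintype.lift ord0 i) g), pt) : chain (gset1 G))
     *~ (-1) ^+ i.
Proof.
elim: n g => [|n IH] g; rewrite glistS.
  rewrite big_ord1 mulr1z !glist0 -[([:: g ord0], pt)]/(scons (g ord0) ([::], pt)).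
  by rewrite -KopU Nop_K Nop_nil raddf0 subr0 LopU.
rewrite -[(_ :: _, pt)]/(scons (g ord0) (glist (gtail g), pt)) -KopU Nop_K IH.
rewrite [RHS]big_ord_recl mulr1z LopU; congr (_ + _).
  rewrite [in LHS]glistS /slmul [in RHS]glistS /=; congr (bas (_ :: _, pt)).
    rewrite !ffunE /=; congr (g _ * g _)%g; exact/val_inj.
  congr glist; apply/ffunP => i; rewrite !ffunE /=.
  by congr (g _); apply/val_inj.
rewrite raddf_sum -sumrN; apply: eq_bigr => i _ /=.
rewrite raddfMz /= -mulrNz /= exprS mulN1r; congr (_ *~ _); rewrite KopU; congr bas.
rewrite /scons /= [in RHS]glistS.
have <- : bar_face (fintype.lift ord0 i) (gtail g) =
          gtail (bar_face (fintype.lift ord0 (fintype.lift ord0 i)) g).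
  apply/ffunP => j; rewrite !ffunE /= /bump /= !add1n !ltnS !eqSS.
  have -> : fintype.lift ord0 (widen_ord (leqnSn n) j) =
            widen_ord (leqnSn n.+1) (fintype.lift ord0 j) by apply/val_inj.
  by [].
by rewrite ffunE /=; have -> : widen_ord (leqnSn n.+1) ord0 = ord0 by exact/val_inj.
Qed.

Lemma to_chain_bd n (y : bar n.+1) : to_chain (bar_bd y) = bd (to_chain y).
Proof.
move: y; apply: (eq_freeg (f := @to_chain n \o @bar_bd G n)
  (g := @bd G (gset1 G) \o @to_chain n.+1)) => g /=.
rewrite bar_bd1 to_chainU raddf_sum big_ord_recl /= bdE to_chain_face_sum.
congr (_ + _).
  rewrite freegU_bas mulr1z to_chainU glistS.
  rewrite -[(_ :: _, pt)]/(scons (g ord0) (glist (gtail g), pt)) d0_cons.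
  by congr (bas (glist _, pt)); apply/ffunP => j; rewrite !ffunE.
rewrite -sumrN; apply: eq_bigr => i _; rewrite freegU_bas raddfMz.
by rewrite /= to_chainU -mulrNz /= exprS mulN1r.
Qed.

Lemma of_chain_bd n (y : chain (gset1 G)) : of_chain n (bd y) = bar_bd (of_chain n.+1 y).
Proof.
apply: (can_inj (@to_chainK n)); rewrite to_chain_bd !of_chainK.
exact: pr_bd.
Qed.

Lemma homog_to_chain n (y : bar n) : homog n (to_chain y).
Proof. by rewrite -[y]to_chainK of_chainK; exact: homog_pr. Qed.

End BarChain.

Notation cmap1 phi := (@cmap _ _ (gset1 _) (gset1 _) phi id).
Notation forget := (@cmap _ _ _ (gset1 _) id (fun=> tt)).

Lemma to_chain_map (G H : groupType) (phi : {multiplicative G -> H}) n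
    (y : {freeg {ffun 'I_n -> G}}) :
  to_chain (bar_map phi y) = cmap1 phi (to_chain y).
Proof.
move: y; apply: (eq_freeg (f := @to_chain H n \o @bar_map G H phi n)
  (g := cmap1 phi \o @to_chain G n)) => g /=.
have -> : bar_map phi (bas g) = bas [ffun i => phi (g i)] by exact: flift_bas.
rewrite !to_chainU cmapU; congr bas; congr pair.
rewrite /glist /= -map_comp; apply/eq_map => i; by rewrite /= ffunE.
Qed.

(** * Homology of affine groups *)

Section Null.
Variables (G : groupType) (X : gset G).
Definition null (y : chain X) := exists w, bd w = y.

Lemma null0 : null 0. Proof. by exists 0; rewrite raddf0. Qed.
Lemma nullB x y : null x -> null y -> null (x - y).
Proof. by move=> [v <-] [w <-]; exists (v - w); rewrite raddfB. Qed.
Lemma nullN x : null x -> null (- x).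
Proof. by rewrite -sub0r; apply/nullB/null0. Qed.
Lemma nullD x y : null x -> null y -> null (x + y).
Proof. by move=> nx /nullN ny; rewrite -[y]opprK; apply: nullB. Qed.
End Null.

Lemma null_cmap (G H : groupType) (X : gset G) (Y : gset H) (phi : G -> H)
    (f : X -> Y) y : {morph phi : x y / (x * y)%g} ->
    (forall g x, f (gact g x) = gact (phi g) (f x)) ->
  null y -> null (cmap phi f y).
Proof. by move=> phiM fE [w <-]; exists (cmap phi f w); rewrite cmap_bd. Qed.

Lemma null_cmap1 (G H : groupType) (phi : G -> H) (y : chain (gset1 G)) :
  {morph phi : x y / (x * y)%g} -> null y -> null (cmap1 phi y).
Proof. by move=> phiM; apply: null_cmap. Qed.

Lemma cmap1_bd (G H : groupType) (phi : G -> H) (y : chain (gset1 G)) :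
  {morph phi : x y / (x * y)%g} -> cmap1 phi (bd y) = bd (cmap1 phi y).
Proof. by move=> phiM; apply: cmap_bd. Qed.

Lemma cmap1_comp (G H J : groupType) (phi : G -> H) (psi : H -> J)
  (y : chain (gset1 G)) : cmap1 psi (cmap1 phi y) = cmap1 (psi \o phi) y.
Proof. exact: cmap_comp. Qed.

Section Aff.
Variables (R : comUnitRingType) (M : lmodType R).

Definition aff : Type := (M * units R)%type.
HB.instance Definition _ := Choice.on aff.

Implicit Types p q : aff.
Definition aff_one : aff := (0, 1%g).
Definition aff_mul p q : aff := (p.1 + val p.2 *: q.1, (p.2 * q.2)%g).
Definition aff_inv p : aff := (- ((val p.2)^-1 *: p.1), (p.2^-1)%g).

Fact aff_mulA : associative aff_mul.
Proof.
move=> p q r; rewrite /aff_mul /= mulgA; congr (_, _).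
by rewrite scalerDr scalerA addrA.
Qed.
Fact aff_mul1 : left_id aff_one aff_mul.
Proof. by case=> m u; rewrite /aff_mul /= scale1r add0r mul1g. Qed.
Fact aff_1mul : right_id aff_one aff_mul.
Proof. by case=> m u; rewrite /aff_mul /= scaler0 addr0 mulg1. Qed.
Fact aff_mulV : left_inverse aff_one aff_inv aff_mul.
Proof. by case=> m u; rewrite /aff_mul /= addNr mulVg. Qed.
Fact aff_Vmul : right_inverse aff_one aff_inv aff_mul.
Proof.
case=> m u; rewrite /aff_mul /= scalerN scalerA mulrV ?(valP u) //.
by rewrite scale1r subrr mulgV.
Qed.
HB.instance Definition _ := isGroup.Build aff
  aff_mulA aff_mul1 aff_1mul aff_mulV aff_Vmul.
End Aff.

Definition affG (R : comUnitRingType) (M : lmodType R) : groupType :=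
  Group.clone (aff M) _.

Definition amap (R : comUnitRingType) (M M' : lmodType R) (f : M -> M')
  (p : affG M) : affG M' := (f p.1, p.2).

Lemma amapM (R : comUnitRingType) (M M' : lmodType R) (f : {linear M -> M'}) :
  {morph amap f : x y / (x * y)%g}.
Proof. by move=> p q; congr (_, _); rewrite linearD linearZ. Qed.

(* With T = aff M acting on M through e, the translations by e(y) conjugate    *)
(* the stabilizer of y into the stabilizer of 0; hence 1 - pi, where pi kills  *)
(* the e-component, is homotopic to the operator qop, each term of which is    *)
(* obtained from a simplex by trading its last entry for a translation by an   *)
(* element of the image of e.                                                  *)
Section KillCoordinate.
Variables (R : comUnitRingType) (M : lmodType R) (e : {linear M -> M}).
Hypothesis ee : forall m, e (e m) = e m.
Local Notation T := (affG M).

Definition affset_act (p : T) (y : M) : M := e p.1 + val p.2 *: y.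
Fact affset_act1 y : affset_act 1%g y = y.
Proof. by rewrite /affset_act linear0 add0r scale1r. Qed.
Fact affset_actM p q y : affset_act (p * q)%g y = affset_act p (affset_act q y).
Proof.
by rewrite /affset_act linearD linearZ scalerDr scalerA addrA.
Qed.
Definition affset : gset T := Gset affset_act1 affset_actM.

Definition kill : T -> T := amap (fun m => m - e m).
Lemma killM : {morph kill : x y / (x * y)%g}.
Proof.
move=> p q; congr (_, _); rewrite /= linearD linearZ /= scalerBr; zmod.
Qed.

Definition transl (y : affset) : T := (e y, 1%g).
Definition kappa : chain (gset1 T) -> chain affset :=
  @cmap T T (gset1 T) affset id (fun=> 0 : M).
HB.instance Definition _ :=
  GRing.isZmodMorphism.Build _ _ kappa (flift_is_zmod_morphism _).

(** Putting every simplex at base point 0 commutes with all faces except the last, which moves 0.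
    This operator is the defect. *)
Definition delta : chain (gset1 T) -> chain affset :=
  flift (fun w => Nop (kappa (bas w)) - kappa (Nop (bas w))).
HB.instance Definition _ :=
  GRing.isZmodMorphism.Build _ _ delta (flift_is_zmod_morphism _).

Lemma deltaE y : delta y = Nop (kappa y) - kappa (Nop y).
Proof.
move: y; apply: (eq_freeg (g := (@Nop T affset \o kappa) \- (kappa \o @Nop T (gset1 T)))).
by move=> w; exact: flift_bas.
Qed.

Definition qop (y : chain (gset1 T)) : chain (gset1 T) :=
  forget (prism transl (delta y)).
Fact qop_is_zmod_morphism : zmod_morphism qop.
Proof. by move=> x y; rewrite /qop (raddfB delta) !raddfB. Qed.
HB.instance Definition _ := GRing.isZmodMorphism.Build _ _ qop qop_is_zmod_morphism.

Lemma forget_kappa y : forget (kappa y) = y.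
Proof.
rewrite /kappa cmap_comp -[RHS]cmap_id; apply: eq_cmap => //.
by case.
Qed.

Lemma gauge_list_transl l y : gauge_list transl l y = map kill l.
Proof.
elim: l => [|p l IH] //=; rewrite IH; congr (_ :: _).
set v := vert l y; congr (_, _); last by rewrite /= invg1 mul1g mulg1.
rewrite /= invr1 !scale1r /= linearD linearZ /= ee mul1r; zmod.
Qed.

Lemma forget_gauge y : forget (gauge transl y) = cmap1 kill (forget y).
Proof.
move: y; apply: (eq_freeg (f := forget \o gauge transl) (g := cmap1 kill \o forget)) => w /=.
by rewrite gaugeU !cmapU /= gauge_list_transl !map_id.
Qed.

(** For a cycle [y] the boundary of [kappa y] is [- delta y]. Forgetting base points in the prism
    formula for [kappa y] turns the gauged end into the image of [y] under [kill]. *)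
Lemma kill_homotopy y : bd y = 0 ->
  y - cmap1 kill y = qop y - bd (forget (prism transl (kappa y))).
Proof.
move=> dy; have E := prism_bd transl (kappa y).
have E1 : bd (kappa y) = - delta y.
  have d0k : d0 (kappa y) = kappa (d0 y).
    move: (y); apply: (eq_freeg (f := @d0 T affset \o kappa)
      (g := kappa \o @d0 T (gset1 T))) => w /=.
    elim/simp_ind: w => [x|p w _]; first by rewrite /kappa cmapU !d0_nil raddf0.
    by rewrite -(KopU (X := gset1 T)) /kappa cmap_K !d0_K.
  have := congr1 kappa dy; rewrite !bdE raddfB raddf0 /= d0k deltaE => E2.
  zmod_from E2.
move: E; rewrite E1 raddfN /=.
move=> /(congr1 (@cmap T T affset (gset1 T) id (fun=> tt))).
rewrite raddfD raddfN raddfB /=.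
rewrite forget_gauge forget_kappa cmap_bd // /qop => E2; zmod_from E2.
Qed.

Lemma qop_bd y : bd y = 0 -> bd (qop y) = 0.
Proof.
move=> dy; have := congr1 (@bd T (gset1 T)) (kill_homotopy dy).
rewrite !raddfB /= bd_bd dy -(cmap1_bd _ killM) dy raddf0 => E; zmod_from (esym E).
Qed.

Section Count.
Variables B B' : pred T.
Hypotheses (Be : forall p, e p.1 != 0 -> B p) (B't : forall y, ~~ B' (transl y)).
Hypotheses (B'k : forall p, B' (kill p) -> B p) (B'B : forall p, B' p -> B p).

(** Each surviving term has lost its last entry [p]. If [e p.1 = 0] then [p] fixes 0 and the terms
    cancel; otherwise [p] was counted by [B]. *)
Lemma delta_count l x :
  spanned (fun w => (count B w.1 < count B l)%N) (delta (bas (l, x))).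
Proof.
elim: l => [|p l IH].
  by rewrite deltaE /kappa cmapU !Nop_nil raddf0 subr0; exact: gen0.
rewrite -[(p :: l, x)]/(scons p (l, x)) -KopU.
have -> : delta (Kop p (bas (l, x))) =
    Lop p (kappa (bas (l, x))) - kappa (Lop p (bas (l, x)))
    - Kop p (delta (bas (l, x))).
  by rewrite !deltaE /kappa cmap_K // !Nop_K !raddfB /= cmap_K //; zmod.
apply: spannedB; last first.
  apply: spanned_add IH _ => w lt_w; rewrite /= KopU.
  by apply: spannedU; rewrite /= ltn_add2l.
case: l {IH} => [|q l]; last first.
  by rewrite /kappa cmapU !LopU cmapU /= subrr; exact: gen0.
rewrite /kappa cmapU !LopU cmapU /slmul /= /affset_act scaler0 !addr0 addn0.
have [->|e0] := eqVneq (e p.1) 0; first by rewrite subrr; exact: gen0.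
by apply: spannedB; apply: spannedU => /=; rewrite Be.
Qed.

(** The prism inserts a translation, which [B'] ignores, and otherwise keeps entries or replaces
    them by their images under [kill]. *)
Lemma prism_count l y :
  spanned (fun w => (count B' w.1 <= count B l)%N) (prism transl (bas (l, y))).
Proof.
have map_count s : (count B' (map kill s) <= count B s)%N.
  by rewrite count_map; apply: sub_count => p; apply: B'k.
elim: l => [|p l IH].
  rewrite prism_nil etaconsU gaugeU KopU; apply: spannedU.
  by rewrite /= (negPf (B't _)).
rewrite -[(p :: l, y)]/(scons p (l, y)) -KopU prism_K; apply: spannedB; last first.
  apply: spanned_add IH _ => w le_w; rewrite /= KopU; apply: spannedU => /=.
  by apply: leq_add => //; move: (@B'B p); case: (B' p) => // ->.
rewrite KopU etaconsU gaugeU KopU; apply: spannedU.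
apply: leq_trans (map_count (p :: l)).
by rewrite -(gauge_list_transl (p :: l) y) /= (negPf (B't _)).
Qed.

Lemma qop_count k y : spanned (fun w => (count B w.1 <= k)%N) y ->
  spanned (fun w => (count B' w.1 < k)%N) (qop y).
Proof.
move=> yk; apply: spanned_add yk _ => -[l x] /= lk.
apply: (spanned_add (f := forget \o prism transl) (delta_count l x)) => -[l' m] /= l'l.
apply: (spanned_add (f := forget) (prism_count l' m)) => w wl' /=.
rewrite cmapU map_id; apply: spannedU => /=.
exact: leq_ltn_trans wl' (leq_trans l'l lk).
Qed.
End Count.

End KillCoordinate.

(** * Polynomial dependence on the scalar *)

Section Coordinates.
Variable R : comUnitRingType.

(** Polynomials serve as a free module with coordinates indexed by the naturals; [eval1] is then the
    sum of the coordinates. *)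
Definition coordp j (p : {poly R}) : {poly R} := p`_j *: 'X^j.
Fact coordp_is_linear j : linear (coordp j).
Proof. by move=> a p q; rewrite /coordp coefD coefZ scalerDl scalerA. Qed.
HB.instance Definition _ j :=
  GRing.isLinear.Build R {poly R} {poly R} *:%R (coordp j) (@coordp_is_linear j).

Lemma coef_coordp j p i : (coordp j p)`_i = if i == j then p`_j else 0.
Proof. by rewrite coefZ coefXn; case: eqP; rewrite ?mulr1 ?mulr0. Qed.

Lemma coordp_idem j p : coordp j (coordp j p) = coordp j p.
Proof. by rewrite {1}/coordp coef_coordp eqxx. Qed.

Definition eval1 (p : {poly R}) : R^o := p.[1].
Fact eval1_is_linear : linear eval1.
Proof. by move=> a p q; rewrite /eval1 hornerD hornerZ. Qed.
HB.instance Definition _ :=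
  GRing.isLinear.Build R {poly R} R^o *:%R eval1 eval1_is_linear.

Definition line (A : {poly R}) (r : R^o) : {poly R} := (r : R) *: A.
Fact line_is_linear A : linear (line A).
Proof. by move=> a r s; rewrite /line scalerDl scalerA. Qed.
HB.instance Definition _ A :=
  GRing.isLinear.Build R R^o {poly R} *:%R (line A) (@line_is_linear A).

Definition scal (b : R) (r : R^o) : R^o := b * (r : R).
Fact scal_is_linear b : linear (scal b).
Proof. by move=> a r s; rewrite /scal mulrDr mulrCA. Qed.
HB.instance Definition _ b :=
  GRing.isLinear.Build R R^o R^o *:%R (scal b) (@scal_is_linear b).

Local Notation P := (affG {poly R}).
Local Notation S := (affG R^o).

Fixpoint kills (js : seq nat) (y : chain (gset1 P)) : chain (gset1 P) :=
  if js is j :: js' then kills js' (y - cmap1 (kill (coordp j)) y) else y.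
Fact kills_is_zmod_morphism js : zmod_morphism (kills js).
Proof.
elim: js => [|j js IH] x y //=; rewrite -IH; congr kills.
rewrite raddfB /=; zmod.
Qed.
HB.instance Definition _ js :=
  GRing.isZmodMorphism.Build _ _ (kills js) (@kills_is_zmod_morphism js).

Lemma kills_bd js y : kills js (bd y) = bd (kills js y).
Proof.
elim: js y => [|j js IH] y //=; rewrite -IH [in RHS]raddfB /= cmap1_bd //.
exact: (killM (coordp j)).
Qed.

Definition moved (js : seq nat) (p : P) : bool := has (fun j => (p.1 : {poly R})`_j != 0) js.

(** Modulo boundaries, each factor 1 - [kill] may be replaced by [qop], which trades one coordinate
    for a strictly smaller count of moved entries. With no coordinate left the count would be
    negative, so the chain is 0. *)
Lemma kills_null js y : uniq js -> bd y = 0 ->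
  spanned (fun w => (count (moved js) w.1 < size js)%N) y -> null (kills js y).
Proof.
elim: js y => [|j js IH] y /= => [_ _ y0|/andP[jjs ujs] dy yj].
  suff -> : y = 0 by exact: null0.
  exact: (spanned_eq (f := idfun) (g := \0) y0).
have idem := @coordp_idem j.
have kM := killM (coordp j).
rewrite (kill_homotopy idem) // raddfB /= kills_bd; apply: nullB; last by eexists.
apply: IH => //.
  exact: (qop_bd idem).
apply: (qop_count idem (B := moved (j :: js))); last exact: yj.
- move=> p; apply: contraNT; rewrite /= negb_or => /andP[/negPn/eqP p0 _].
  by rewrite /coordp p0 scale0r.
- move=> p; apply/hasPn => i ijs; rewrite /= coef_coordp.
  by case: (i =P j) jjs => [<-|_ _]; rewrite ?ijs ?eqxx.
- move=> p /hasP[i ijs]; rewrite /= coefB coef_coordp.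
  case: (i =P j) jjs => [<-|_ _]; rewrite ?ijs // subr0 => pi0.
  by apply/orP; right; apply/hasP; exists i.
- by move=> p pjs; rewrite /= pjs orbT.
Qed.

(* The alternating sum of the endomorphisms r |-> (b + a_J) r, where a_J runs   *)
(* over the sums of the sublists J of xs.                                       *)
Fixpoint psi (b : R) (xs : seq R) (z : chain (gset1 S)) : chain (gset1 S) :=
  if xs is a :: xs' then psi (b + a) xs' z - psi b xs' z else cmap1 (amap (scal b)) z.

(** Embedding by [line A], killing a set of coordinates and summing the rest is multiplication by
    the sum of the surviving coefficients of [A]. *)
Lemma kills_line A js z : uniq js ->
  cmap1 (amap eval1) (kills js (cmap1 (amap (line A)) z)) =
  psi (A.[1] - \sum_(j <- js) A`_j) [seq A`_j | j <- js] z.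
Proof.
elim: js A => [|j js IH] A /=.
  rewrite big_nil subr0 cmap1_comp => _; apply: eq_cmap => // -[r u].
  by rewrite /amap /= /eval1 /line hornerZ /scal mulrC.
case/andP=> jjs ujs; rewrite big_cons raddfB /= cmap1_comp.
rewrite (raddfB (cmap1 (amap eval1))) /= IH //.
have -> : cmap1 (kill (coordp j) \o amap (line A)) z = cmap1 (amap (line (A - coordp j A))) z.
  apply: eq_cmap => // -[r u]; rewrite /kill /amap /=; congr (_, _).
  by rewrite /coordp /line coefZ scalerBr scalerA.
rewrite IH //; congr (psi _ _ z - psi _ _ z); first by zmod.
  have E i : i \in js -> (A - coordp j A)`_i = A`_i.
    move=> ijs; rewrite coefB coef_coordp.
    by case: (i =P j) ijs jjs => [-> ->|_ _ _] //; rewrite subr0.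
  rewrite hornerD hornerN /coordp hornerZ hornerXn expr1n mulr1.
  by rewrite (eq_big_seq _ E); zmod.
apply/eq_in_map => i ijs; rewrite coefB coef_coordp.
by case: (i =P j) ijs jjs => [-> ->|_ _ _] //; rewrite subr0.
Qed.

Fixpoint subsums (xs : seq R) : seq R :=
  if xs is a :: xs' then [seq a + s | s <- subsums xs'] ++ subsums xs' else [:: 0].
Definition usums b xs := all (fun s => b + s \is a GRing.unit) (subsums xs).

Lemma usums_cons b a xs : usums b (a :: xs) = usums (b + a) xs && usums b xs.
Proof.
rewrite /usums /= all_cat all_map; congr (_ && _).
by apply: eq_all => s /=; rewrite addrA.
Qed.

(** Multiplication by a unit is conjugation by (0, b), that is, the gauge of a constant function. *)
Lemma scal_null b z : b \is a GRing.unit -> bd z = 0 -> null (cmap1 (amap (scal b)) z - z).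
Proof.
move=> bu dz; pose u : units R := exist (fun a => a \is a GRing.unit) b bu.
pose eta (x : gset1 S) : S := (0, (u^-1)%g).
exists (prism eta z); have := prism_bd eta z; rewrite dz raddf0 addr0 => ->.
congr (_ - _); move: (z); apply: (eq_freeg (f := gauge eta) (g := cmap1 (amap (scal b)))).
case=> l x; rewrite /= gaugeU cmapU /=; congr bas; congr pair.
elim: l => [|[r v] l IH] //=; rewrite IH; congr (_ :: _).
have -> : ((eta (gact ((r, v) : S) (vert l x)))^-1)%g = ((0, u) : S).
  transitivity ((- ((val (u^-1)%g)^-1 *: (0 : R^o)), (u^-1^-1)%g) : S); first by [].
  by rewrite scaler0 oppr0 invgK.
congr pair; first by rewrite /= scaler0 addr0 add0r.
by apply/val_inj; rewrite /= mulrAC mulrV // mul1r.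
Qed.

(** All scalars involved are units, so every term is homologous to [z]; the signs cancel unless [xs]
    is empty and there is a single term. *)
Lemma psi_null b xs z : bd z = 0 -> usums b xs -> null (psi b xs z - z *~ (xs == [::])).
Proof.
move=> dz; elim: xs b => [|a xs IH] b.
  rewrite /usums /= addr0 andbT mulr1z => bu; exact: scal_null.
rewrite usums_cons => /andP[/IH n1 /IH n2] /=; rewrite mulr0z subr0.
have := nullB n1 n2; set x := psi _ _ _; set y := psi _ _ _.
have -> : x - z *~ (xs == [::]) - (y - z *~ (xs == [::])) = x - y by zmod.
by [].
Qed.

Fixpoint usums0 xs := if xs is a :: xs' then usums a xs' && usums0 xs' else true.

(** The half of the alternating sum containing the head of [xs] is controlled by [psi_null].
    Dropping it shortens the list until only z and multiplication by 0 remain. *)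
Lemma psi0_null xs z : bd z = 0 -> xs != [::] -> usums0 xs ->
  null (psi 0 xs z) -> null (z - cmap1 (amap (scal 0)) z).
Proof.
move=> dz; elim: xs => [|a xs IH] //= _ /andP[ua u0]; rewrite add0r => n1.
have := psi_null dz ua.
have [xs0|xs0] := eqVneq xs [::].
  rewrite xs0 /= in n1 *; rewrite mulr1z => n2; have := nullB n1 n2.
  by congr null; zmod.
rewrite mulr0z subr0 => n2; apply: IH => //; have := nullB n2 n1.
by congr null; zmod.
Qed.

Lemma exists_unit_shift (cs : seq R) : many_units R ->
  exists2 a, a \is a GRing.unit & all (fun c => a + c \is a GRing.unit) cs.
Proof.
(* The forms are v_1 and v_0 + c v_1 for c in 0 :: cs; once v_1 is a unit, the shift is v_0 /
   v_1. *)
move=> hR; pose f (i : 'I_(size cs).+2) (v : 'cV[R]_2) : R^o :=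
  if i == ord_max then v 1 0 else v 0 0 + nth 0 (0 :: cs) i * v 1 0.
have f_lin i : linear (f i).
  move=> a u v; rewrite /f; case: ifP => _; rewrite !mxE //.
  by rewrite mulrDr scalerDr addrACA /GRing.scale /= mulrCA.
pose F i : {linear 'cV[R]_2 -> R^o} :=
  HB.pack (f i) (GRing.isLinear.Build _ _ _ _ (f i) (f_lin i)).
have F_surj i y : exists v, F i v = y.
  have [->|/negPf i_max] := eqVneq i ord_max.
    by exists (\col_j y); rewrite /F /= /f eqxx mxE.
  exists (\col_j (if j == 0 then y else 0)).
  by rewrite /F /= /f i_max !mxE /= mulr0 addr0.
have [v vP] := hR 2%N _ F isT F_surj.
have v1 : v 1 0 \is a GRing.unit by have := vP ord_max; rewrite /F /= /f eqxx.
have vc i : (i < (size cs).+1)%N -> v 0 0 / v 1 0 + nth 0 (0 :: cs) i \is a GRing.unit.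
  move=> ics; have := vP (widen_ord (leqnSn _) (Ordinal ics)).
  rewrite /F /= /f ifF; last by apply/negbTE; rewrite -val_eqE /= ltn_eqF.
  rewrite -{1}[v 0 0](mulrVK v1) -mulrDl unitrM => /andP[] //.
exists (v 0 0 / v 1 0); first by have := vc 0%N isT; rewrite addr0.
by apply/(all_nthP 0) => i ics; apply: (vc i.+1).
Qed.

Lemma exists_usums0 n : many_units R -> exists2 xs, size xs = n & usums0 xs.
Proof.
move=> hR; elim: n => [|n [xs <- xs0]]; first by exists [::].
have [a _ aP] := exists_unit_shift (subsums xs) hR.
by exists (a :: xs) => //=; rewrite xs0 andbT.
Qed.

Theorem affine_homology q z : many_units R -> homog q z -> bd z = 0 ->
  null (z - cmap1 (amap (scal 0)) z).
Proof.
move=> hR zq dz; have [xs sxs xs0] := exists_usums0 q.+1 hR.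
have xsn : xs != [::] by rewrite -size_eq0 sxs.
apply: (psi0_null dz xsn xs0).
have lineM := amapM (line (Poly xs)).
have := kills_line (Poly xs) z (iota_uniq 0 (size xs)).
have -> : [seq (Poly xs)`_j | j <- iota 0 (size xs)] = xs.
  by rewrite (eq_map (coef_Poly xs)) map_nth_iota0 // take_size.
have -> : \sum_(j <- iota 0 (size xs)) (Poly xs)`_j = \sum_(j < size xs) (Poly xs)`_j.
  by rewrite -(big_mkord xpredT (fun j => (Poly xs)`_j)) /index_iota subn0.
(* The value at 1 is the sum of all coefficients, so the constant in [kills_line] is 0 and
   [psi 0 xs] results. *)
rewrite (horner_coef_wide _ (size_Poly xs)).
under eq_bigr do rewrite expr1n mulr1.
rewrite subrr => <-; apply: (null_cmap1 (amapM eval1)); apply: kills_null.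
- exact: iota_uniq.
- by rewrite -(cmap1_bd _ lineM) dz raddf0.
have := @homog_cmap _ _ (gset1 S) (gset1 P) (amap (line (Poly xs))) id q z zq.
apply: spanned_sub => w wq; rewrite size_iota sxs ltnS -wq; exact: count_size.
Qed.

End Coordinates.

(** * Frames and the double complex *)

Section GeneralPosition.
Variable R : comUnitRingType.
Local Notation V := 'cV[R]_2.

Definition det2 (u v : V) : R := u 0 0 * v 1 0 - v 0 0 * u 1 0.

Lemma det2C u v : det2 v u = - det2 u v.
Proof. by rewrite /det2 opprB mulrC [in RHS]mulrC; ring. Qed.

Lemma det2_unitC u v : (det2 v u \is a GRing.unit) = (det2 u v \is a GRing.unit).
Proof. by rewrite det2C unitrN. Qed.

Lemma colsmx_det2 (w : 'I_2 -> V) : \det (colsmx w) = det2 (w 0) (w 1).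
Proof. by rewrite det22 !mxE /det2. Qed.

Lemma summand_basis2 (w : 'I_2 -> V) :
  summand_basis w <-> det2 (w 0) (w 1) \is a GRing.unit.
Proof. by rewrite -colsmx_det2 -unitmxE; exact: summand_basis_unitmx. Qed.

Lemma gen_position2 l (v : 'I_l.+2 -> V) :
  gen_position v <-> forall i j, i != j -> det2 (v i) (v j) \is a GRing.unit.
Proof.
split=> [vP i j ij|vP s sI].
  pose s (k : 'I_2) := if k == 0 then i else j.
  have sI : injective s.
    move=> k k'; rewrite /s; case: (k =P 0) => k0; case: (k' =P 0) => k'0.
    - by rewrite k0 k'0.
    - by move/eqP: ij.
    - by move=> ji; rewrite ji eqxx in ij.
    - by move=> _; case: k k' k0 k'0 => [[|[|[]//]] ?] [[|[|[]//]] ?] // k0 k'0;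
        apply/val_inj => //; [case: k0 | case: k'0]; apply/val_inj.
  by have /summand_basis2 := vP s sI.
apply/(@summand_basis2 (v \o s))/vP.
by apply/eqP => /sI.
Qed.

Lemma gen_position1 (v : 'I_1 -> V) :
  gen_position v <-> exists u, det2 u (v ord0) \is a GRing.unit.
Proof.
split=> [vP|[u uv] s sI].
  have /(_ id (@inj_id _)) [vfree [N [[N0 Nlin] decN disjN]]] := vP.
  set w := v ord0.
  (* The c_i define a linear form. Its value [a] at [w] is 1, because [w - a w] lies both in the
     line and in its complement; the form then supplies [u]. *)
  have dec (i : 'I_2) : exists c : R, (delta_mx i 0 - c *: w : V) \in N.
    have [x [y [[c ->] Ny xE]]] := decN (delta_mx i 0).
    exists (c ord0); rewrite xE big_ord1 /= /w.
    rewrite (_ : _ - _ = y) //; zmod.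
  have [c cP] := choice dec.
  pose a := w 0 0 * c 0 + w 1 0 * c 1.
  have Nw : w - a *: w \in N.
    have -> : w - a *: w = w 0 0 *: (delta_mx 0 0 - c 0 *: w) +
        (w 1 0 *: (delta_mx 1 0 - c 1 *: w) + 0).
      apply/colP => i; rewrite !mxE /a; case: i => [[|[|//]] ilt] /=.
        by rewrite (_ : Ordinal ilt = 0); [ring | exact/val_inj].
      by rewrite (_ : Ordinal ilt = 1); [ring | exact/val_inj].
    by do 2!apply: (Nlin) => //.
  have /disjN : fspan (v \o id) (w - a *: w).
    by exists (fun=> 1 - a); rewrite big_ord1 /= scalerBl scale1r.
  move=> /(_ Nw) w0; have /(_ ord0) a1 : forall i : 'I_1, 1 - a = 0.
    by apply: (vfree (fun=> 1 - a)); rewrite big_ord1 /= scalerBl scale1r.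
  exists (\col_i if i == 0 then c 1 else - c 0).
  rewrite (_ : det2 _ _ = 1) ?unitr1 // /det2 !mxE /= -/w.
  by move/eqP: a1; rewrite subr_eq0 => /eqP ->; rewrite /a; ring.
pose w (k : 'I_2) := if k == 0 then u else v ord0.
have /summand_basis2/(@summand_basis1 _ _ _ w 1) : det2 (w 0) (w 1) \is a GRing.unit by [].
by apply: summand_basis_ext => k; rewrite /= (ord1 (s k)).
Qed.

Lemma frame_det2 l (v : frame R l) i j : i != j ->
  det2 (val v i) (val v j) \is a GRing.unit.
Proof.
case: l v i j => [|l] v i j; first by rewrite !ord1.
by move: i j; apply/gen_position2/asboolP/(valP v).
Qed.

Lemma frame_unimodular l (v : frame R l) i : exists u, det2 u (val v i) \is a GRing.unit.
Proof.
case: l v i => [|l] v i.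
  by rewrite (ord1 i); apply/gen_position1/asboolP/(valP v).
have [j ji] : exists j, j != i.
  by exists (fintype.lift i ord0); rewrite eq_sym neq_lift.
by exists (val v j); apply: frame_det2.
Qed.

Definition vgood l (u : V) (v : frame R l) : bool :=
  [forall j, det2 u (val v j) \is a GRing.unit].

Definition vcons l (u : V) (v : {ffun 'I_l.+1 -> V}) : {ffun 'I_l.+2 -> V} :=
  [ffun i => if unlift ord0 i is Some j then v j else u].

Lemma vcons0 l u (v : {ffun 'I_l.+1 -> V}) : vcons u v ord0 = u.
Proof. by rewrite ffunE unlift_none. Qed.

Lemma vconsS l u (v : {ffun 'I_l.+1 -> V}) j : vcons u v (fintype.lift ord0 j) = v j.
Proof. by rewrite ffunE liftK. Qed.

Lemma vcons_gen l u (v : frame R l) : vgood u v -> gen_position (vcons u (val v)).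
Proof.
move/forallP=> uv; apply/gen_position2 => i j.
case: (unliftP ord0 i) => [i'|] ->; case: (unliftP ord0 j) => [j'|] ->.
- by rewrite !vconsS (inj_eq lift_inj); exact: frame_det2.
- by rewrite vcons0 vconsS det2_unitC => _.
- by rewrite vcons0 vconsS => _.
- by rewrite eqxx.
Qed.

Definition cone l u (v : frame R l) (uv : vgood u v) : frame R l.+1 :=
  Frame (vcons_gen uv).

Lemma face0_cone l u (v : frame R l) (uv : vgood u v) : frame_face ord0 (cone uv) = v.
Proof. by apply/val_inj/ffunP => j; rewrite ffunE /= vconsS. Qed.

Lemma vgood_face l u (v : frame R l.+1) i : vgood u v -> vgood u (frame_face i v).
Proof. by move/forallP=> uv; apply/forallP => j; rewrite /= ffunE. Qed.

Lemma faceS_cone l u (v : frame R l.+1) (uv : vgood u v) (i : 'I_l.+2) :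
  frame_face (fintype.lift ord0 i) (cone uv) = cone (vgood_face i uv).
Proof.
apply/val_inj/ffunP => j; rewrite ffunE /=.
case: (unliftP ord0 j) => [j'|] ->; last first.
  have -> : @fintype.lift l.+3 (fintype.lift ord0 i) ord0 = ord0 by exact/val_inj.
  by rewrite !vcons0.
rewrite vconsS /=.
have -> : @fintype.lift l.+3 (fintype.lift ord0 i) (fintype.lift ord0 j') =
          fintype.lift ord0 (fintype.lift i j').
  by apply/val_inj; rewrite /= /bump /= !add1n ltnS addnS.
by rewrite vconsS ffunE.
Qed.

Lemma cone_frame l (v : frame R l.+1) :
  {uv : vgood (val v ord0) (frame_face ord0 v) | v = cone uv}.
Proof.
have uv : vgood (val v ord0) (frame_face ord0 v).
  by apply/forallP => j; rewrite /= ffunE; apply: frame_det2; exact: neq_lift.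
exists uv; apply/val_inj/ffunP => i /=.
by case: (unliftP ord0 i) => [j|] ->; rewrite ?vconsS ?vcons0 ?ffunE.
Qed.

Lemma exists_good l (vs : seq (frame R l)) : many_units R ->
  exists u, forall v, v \in vs -> vgood u v.
Proof.
move=> hR; pose K := (seq_sub vs * 'I_l.+1)%type.
pose f (k : 'I_#|{: K}|) (u : V) : R^o :=
  let p := enum_val k in det2 u (val (ssval p.1) p.2).
have f_lin k : linear (f k).
  by move=> a u v; rewrite /f /det2 !mxE /GRing.scale /=; ring.
pose F k : {linear V -> R^o} :=
  HB.pack (f k) (GRing.isLinear.Build _ _ _ _ (f k) (f_lin k)).
have F_surj k y : exists u, F k u = y.
  have [u uu] := frame_unimodular (ssval (enum_val k).1) (enum_val k).2.
  exists ((y / det2 u (val (ssval (enum_val k).1) (enum_val k).2)) *: u).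
  rewrite linearZ /= -[f k u]/(det2 u (val (ssval (enum_val k).1) (enum_val k).2)).
  exact: divrK.
have [u uP] := hR 2%N _ F isT F_surj.
exists u => v vvs; apply/forallP => j.
by have := uP (enum_rank (SeqSub vvs, j)); rewrite /F /= /f enum_rankK.
Qed.

Lemma frame_act1 l (v : frame R l) : frame_act (1%g : GL R 2) v = v.
Proof. by apply/val_inj/ffunP => j; rewrite ffunE /= mul1mx. Qed.

Lemma frame_actM l (g h : GL R 2) (v : frame R l) :
  frame_act (g * h)%g v = frame_act g (frame_act h v).
Proof. by apply/val_inj/ffunP => j; rewrite !ffunE /= mulmxA. Qed.

Definition GL2 : groupType := Group.clone (GL R 2) _.
Definition frameset l : gset GL2 :=
  @Gset GL2 (frame R l) (@frame_act R l) (@frame_act1 l) (@frame_actM l).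

Lemma frame_face_act l g i (v : frameset l.+1) :
  frame_face i (gact g v) = gact g (frame_face i v : frameset l).
Proof. by apply/val_inj/ffunP => j; rewrite !ffunE. Qed.

End GeneralPosition.

(** * Exactness of the rows *)

Section Rows.
Variable R : comUnitRingType.
Local Notation V := 'cV[R]_2.
Local Notation G := (GL2 R).
Local Notation X l := (frameset R l).
Local Notation E l := (chain (X l)).
Local Notation B := (chain (gset1 G)).

Definition dh l : E l.+1 -> E l :=
  flift (fun w : seq G * frame R l.+1 =>
    \sum_(i < l.+2) (bas (w.1, frame_face i w.2) : E l) *~ (-1) ^+ i).
HB.instance Definition _ l :=
  GRing.isZmodMorphism.Build _ _ (@dh l) (flift_is_zmod_morphism _).

Definition forget0 : E 0 -> B := forget.
HB.instance Definition _ :=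
  GRing.isZmodMorphism.Build _ _ forget0 (flift_is_zmod_morphism _).

Definition face l i : E l.+1 -> E l := @cmap G G (X l.+1) (X l) id (@frame_face R l i).
HB.instance Definition _ l i :=
  GRing.isZmodMorphism.Build _ _ (@face l i) (flift_is_zmod_morphism _).

Lemma dhE l y : dh y = \sum_(i < l.+2) face i y *~ (-1) ^+ i.
Proof.
elim/freeg_ind: y => [w||x y IHx IHy].
- rewrite /dh flift_bas; apply: eq_bigr => i _.
  by rewrite /face cmapU map_id.
- by rewrite raddf0 big1 // => i _; rewrite raddf0 mul0rz.
- rewrite raddfB /= IHx IHy -sumrB; apply: eq_bigr => i _.
  by rewrite raddfB /= mulrzBl.
Qed.

Lemma face_bd l i (y : E l.+1) : face i (bd y) = bd (face i y).
Proof.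
by rewrite /face cmap_bd => [|g h|g v]; [| | exact: frame_face_act].
Qed.

Lemma dh_bd l (y : E l.+1) : dh (bd y) = bd (dh y).
Proof.
rewrite [LHS]dhE [dh y]dhE [RHS]raddf_sum; apply: eq_bigr => i _.
by rewrite [RHS]raddfMz /= face_bd.
Qed.

Lemma pr_dh l q (y : E l.+1) : pr q (dh y) = dh (pr q y).
Proof.
rewrite [dh y]dhE [RHS]dhE [LHS]raddf_sum; apply: eq_bigr => i _.
by rewrite [LHS]raddfMz /= /face pr_cmap.
Qed.

Lemma homog_dh l q (y : E l.+1) : homog q y -> homog q (dh y).
Proof. by move/pr_homog <-; rewrite -pr_dh; exact: homog_pr. Qed.

Lemma forget0_bd y : forget0 (bd y) = bd (forget0 y).
Proof. exact: cmap_bd. Qed.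

(** The value 0 on frames not in general position with [u] is a filler: the cone formulas are stated
    on chains of good frames. *)
Definition hcone u l : E l -> E l.+1 :=
  flift (fun w : seq G * frame R l =>
    match @idP (vgood u w.2) with
    | ReflectT uv => bas (w.1, cone uv)
    | ReflectF _ => 0
    end).
HB.instance Definition _ u l :=
  GRing.isZmodMorphism.Build _ _ (@hcone u l) (flift_is_zmod_morphism _).

Lemma hconeU u l g (v : frame R l) (uv : vgood u v) :
  hcone u (bas (g, v) : E l) = bas (g, cone uv).
Proof.
rewrite /hcone flift_bas /=; case: {-}_ / idP => [uv'|]; last by rewrite uv.
by congr bas; congr pair; apply/val_inj.
Qed.

Definition good u l (w : seq G * frame R l) : Prop := vgood u w.2.

Lemma dh_hcone u l (y : E l.+1) :
  spanned (@good u l.+1) y -> dh (hcone u y) = y - hcone u (dh y).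
Proof.
move=> uy; apply: (spanned_eq (f := @dh _ \o @hcone u l.+1)
  (g := idfun \- (@hcone u l \o @dh _)) uy) => -[g v]; rewrite /good /= => uv.
rewrite (hconeU _ uv) /dh !flift_bas /= big_ord_recl /= face0_cone; congr (_ + _).
rewrite raddf_sum -sumrN; apply: eq_bigr => i _; rewrite faceS_cone raddfMz /= -mulrNz.
by rewrite (hconeU _ (vgood_face i uv)) exprS mulN1r.
Qed.

Lemma forget0_dh (y : E 1) : forget0 (dh y) = 0.
Proof.
move: y; apply: (eq_freeg (f := forget0 \o @dh 0) (g := \0)) => -[g v] /=.
rewrite /dh flift_bas raddf_sum big_ord_recl big_ord1 !raddfMz /=.
by rewrite /forget0 !cmapU /= mulr1z mulrN1z subrr.
Qed.

Section Point.
Variables (u : V) (pu : @gen_position R 0 (finfun (fun=> u))).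
Definition point : frame R 0 := Frame pu.
Definition pointed (y : B) : E 0 := @cmap G G (gset1 G) (X 0) id (fun=> point) y.
HB.instance Definition _ :=
  GRing.isZmodMorphism.Build _ _ pointed (flift_is_zmod_morphism _).

Lemma dh_hcone0 (y : E 0) :
  spanned (@good u 0) y -> dh (hcone u y) = y - pointed (forget0 y).
Proof.
move=> uy; apply: (spanned_eq (f := @dh _ \o @hcone u 0)
  (g := idfun \- (pointed \o forget0)) uy) => -[g v]; rewrite /good /= => uv.
rewrite (hconeU _ uv) /dh flift_bas /= big_ord_recl big_ord1 /= face0_cone.
rewrite /forget0 /pointed !cmapU /= !map_id mulr1z mulrN1z; congr (_ - bas _).
congr pair; apply/val_inj/ffunP => i; rewrite [LHS]ffunE [RHS]ffunE /= (ord1 i).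
have -> : @fintype.lift 2 (fintype.lift ord0 ord0) ord0 = ord0 by exact/val_inj.
by rewrite vcons0.
Qed.

Lemma forget0_pointed y : forget0 (pointed y) = y.
Proof.
rewrite /forget0 /pointed cmap_comp -[RHS]cmap_id; apply: eq_cmap => //.
by case.
Qed.
End Point.

Lemma dh_spanned u l (y : E l.+1) : spanned (@good u l.+1) y -> spanned (@good u l) (dh y).
Proof.
move=> uy; apply: spanned_add uy _ => -[g v] uv; rewrite /= /dh flift_bas /=.
elim/big_ind: _ => [||i _]; [exact: gen0 | exact: spannedD |].
have uvi : spanned (@good u l) (bas (g, frame_face i v)).
  by apply: spannedU; apply: vgood_face.
by rewrite -signr_odd; case: odd; rewrite ?mulrN1z ?mulr1z //; apply: spannedN.
Qed.

(** A frame is the cone, with its first vector as apex, over its first face. The cone formula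
    carries the vanishing from one length to the next. *)
Lemma dh_dh l (y : E l.+2) : dh (dh y) = 0.
Proof.
move: y; apply: (eq_freeg (f := @dh l \o @dh l.+1) (g := \0)) => -[g v] /=.
elim: l v => [|l IH] v; have [uv ->] := cone_frame v;
  rewrite -hconeU; set v' := frame_face ord0 v; set u := val v ord0.
  rewrite dh_hcone; last exact: spannedU.
  have pu : @gen_position R 0 (finfun (fun=> u)).
    apply/gen_position1; exists (val v ord_max); rewrite ffunE.
    exact: frame_det2.
  rewrite raddfB /= (dh_hcone0 pu); last by apply: dh_spanned; exact: spannedU.
  by rewrite forget0_dh raddf0; zmod.
rewrite dh_hcone; last exact: spannedU.
rewrite raddfB /= dh_hcone; last by apply: dh_spanned; exact: spannedU.
by rewrite IH raddf0; zmod.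
Qed.

Hypothesis hR : many_units R.

Lemma exists_good_chain l (y : E l) : exists u, spanned (@good u l) y.
Proof.
have [u uP] := exists_good [seq w.2 | w <- dom y] hR.
exists u; apply: spanned_sub (spanned_dom y) => w wy.
by apply: uP; apply: map_f.
Qed.

Lemma row_exact l q (y : E l.+1) : homog q y -> dh y = 0 ->
  exists2 y' : E l.+2, homog q y' & dh y' = y.
Proof.
move=> qy dy; have [u uy] := exists_good_chain y.
exists (pr q (hcone u y)); first exact: homog_pr.
by rewrite -pr_dh dh_hcone // dy raddf0 subr0 pr_homog.
Qed.

Lemma row_exact0 q (y : E 0) (x0 : frame R 0) : homog q y -> forget0 y = 0 ->
  exists2 y' : E 1, homog q y' & dh y' = y.
Proof.
move=> qy dy.
(* Including [x0] forces [u] to be unimodular even when the support of [y] is empty. *)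
have [u uP] := exists_good (x0 :: [seq w.2 | w <- dom y]) hR.
have uy : spanned (@good u 0) y.
  apply: spanned_sub (spanned_dom y) => w wy; apply: uP.
  by rewrite inE map_f ?orbT.
have pu : @gen_position R 0 (finfun (fun=> u)).
  apply/gen_position1; exists (val x0 ord0); rewrite ffunE det2_unitC.
  by have /forallP := uP x0 (mem_head _ _).
exists (pr q (hcone u y)); first exact: homog_pr.
by rewrite -pr_dh (dh_hcone0 pu) // dy raddf0 subr0 pr_homog.
Qed.

End Rows.

(** * Exactness of the columns of positive index *)

Section Columns.
Variable R : comUnitRingType.
Local Notation V := 'cV[R]_2.
Local Notation G := (GL2 R).

(** The first and last vectors form a basis, which a matrix moves by left multiplication; this
    exhibits the action as free. *)
Definition fbasis l (v : frame R l.+1) : 'M[R]_2 :=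
  colsmx (fun k : 'I_2 => if k == 0 then val v ord0 else val v ord_max).

Lemma fbasis_unit l (v : frame R l.+1) : fbasis v \in unitmx.
Proof. by rewrite unitmxE colsmx_det2; apply: frame_det2. Qed.

Definition fgroup l (v : frameset R l.+1) : G :=
  exist (fun A => A \in unitmx) (fbasis v) (fbasis_unit v).

Lemma fgroup_act l g (v : frameset R l.+1) : fgroup (gact g v) = (g * fgroup v)%g.
Proof.
apply/val_inj/matrixP => i j; rewrite !mxE /=.
case: ifP => j0; rewrite ffunE mxE; apply: eq_bigr => k _;
by rewrite !mxE j0.
Qed.

Lemma column_exact l q (y : chain (frameset R l.+1)) : homog q.+1 y -> bd y = 0 ->
  exists2 y' : chain (frameset R l.+1), homog q.+2 y' & bd y' = y.
Proof.
apply: (@free_exact _ _ (@fgroup l) (fun v => gact (fgroup v)^-1%g v)).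
- by move=> v; rewrite -gactM mulgV gact1.
- exact: fgroup_act.
- by move=> g v; rewrite fgroup_act invgM -gactM mulgVK.
Qed.

End Columns.

(** * The stabilizer of a vector *)

Section Stabilizer.
Variable R : comUnitRingType.
Local Notation V := 'cV[R]_2.
Local Notation G := (GL2 R).
Local Notation X0 := (frameset R 0).
Local Notation S := (affG R^o).

Definition GL1 : groupType := Group.clone (GL R 1) _.

Definition e2 : V := delta_mx 1 0.
Fact e2_gen : @gen_position R 0 (finfun (fun=> e2)).
Proof.
apply/gen_position1; exists (delta_mx 0 0); rewrite ffunE /det2 !mxE /=.
by rewrite mulr1 mul0r subr0 unitr1.
Qed.
Definition x0 : X0 := point e2_gen.

Lemma act_x0 (g : G) (x : X0) : gact g x0 = x <-> val g *m e2 = val x ord0.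
Proof.
split=> [<-|gx]; first by rewrite /= !ffunE.
by apply/val_inj/ffunP => k; rewrite !ffunE gx (ord1 k).
Qed.

Lemma x0_transitive (x : X0) : exists g : G, gact g x0 = x.
Proof.
have [u uw] := frame_unimodular x ord0; set w := val x ord0 in uw.
pose A := colsmx (fun k : 'I_2 => if k == 0 then u else w).
have Au : A \in unitmx by rewrite unitmxE colsmx_det2.
exists (exist (fun A => A \in unitmx) A Au : G); apply/act_x0.
by rewrite /= /e2 -colE; apply/colP => k; rewrite !mxE.
Qed.

(* (r, u) |-> [[u^-1, 0], [r u^-1, 1]]; the inverse makes it multiplicative.    *)
Definition stab_mx (p : S) : 'M[R]_2 :=
  \matrix_(i, j) if i == 0 then (if j == 0 then (val p.2)^-1 else 0)
                 else (if j == 0 then (p.1 : R) / val p.2 else 1).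

Lemma det_stab_mx p : \det (stab_mx p) = (val p.2)^-1.
Proof. by rewrite det22 !mxE /= mulr1 mul0r subr0. Qed.

Fact stab_mx_unit p : stab_mx p \in unitmx.
Proof. by rewrite unitmxE det_stab_mx unitrV (valP p.2). Qed.

Definition stab (p : S) : G := exist (fun A => A \in unitmx) _ (stab_mx_unit p).

Lemma ord2P (i : 'I_2) : i = 0 \/ i = 1.
Proof. by case: i => [[|[|//]] ?]; [left | right]; apply/val_inj. Qed.

Lemma mulmx2E m n (A : 'M[R]_(m, 2)) (B : 'M[R]_(2, n)) i j :
  (A *m B) i j = A i 0 * B 0 j + A i 1 * B 1 j.
Proof.
rewrite mxE !big_ord_recl big_ord0 addr0; congr (_ + A _ _ * B _ _); exact/val_inj.
Qed.

Lemma stabM : {morph stab : p q / (p * q)%g}.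
Proof.
case=> r u [s v]; apply/val_inj/matrixP => i j; rewrite /= mulmx2E !mxE /=.
have uu := valP u; have vu := valP v; rewrite invrM //.
case: (i == 0); case: (j == 0) => /=.
- by rewrite mul0r addr0 mulrC.
- by rewrite mulr0 mul0r addr0.
- rewrite /GRing.scale /= mul1r mulrDl; congr (_ + _); first by rewrite !mulrA mulrAC.
  by rewrite [_ * s]mulrC mulrACA mulrV // mulr1.
- by rewrite mulr0 add0r mulr1.
Qed.

Lemma stab_x0 p : gact (stab p) x0 = x0.
Proof.
by apply/act_x0; rewrite /= /e2 -colE ffunE; apply/colP => -[[|[|//]] ?]; rewrite !mxE.
Qed.

Lemma stabP (g : G) : gact g x0 = x0 -> exists p, stab p = g.
Proof.
move/act_x0; rewrite /= ffunE /e2 -colE => /colP gE.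
have := gE 0; have := gE 1; rewrite !mxE /= => g11 g01.
have g00 : val g 0 0 \is a GRing.unit.
  by have := valP g; rewrite unitmxE det22 g01 g11 mulr1 mul0r subr0.
pose u : units R := exist (fun a => a \is a GRing.unit) _ g00.
exists (val g 1 0 / val g 0 0, (u^-1)%g).
apply/val_inj/matrixP => i j; rewrite !mxE /= invrK divrK //.
by case: (ord2P i) => ->; case: (ord2P j) => ->; rewrite /= ?g01 ?g11.
Qed.

Lemma stab_inj : injective stab.
Proof.
move=> [r u] [s v] /(congr1 val) /matrixP E.
have := E 0 0; have := E 1 0; rewrite !mxE /= => rs /invr_inj uv'.
have {uv'} uv : u = v by exact/val_inj.
by move: rs; rewrite uv => /(mulIr _) ->; rewrite ?unitrV ?(valP v).
Qed.

Definition stab_inv (g : G) : S :=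
  if pselect (exists p, stab p = g) is left ex then projT1 (cid ex) else 1%g.

Lemma stab_invK : cancel stab stab_inv.
Proof.
move=> p; rewrite /stab_inv; case: pselect => [ex|[]]; last by exists p.
by apply: stab_inj; case: cid.
Qed.

Lemma stabK g : gact g x0 = x0 -> stab (stab_inv g) = g.
Proof. by move/stabP=> ex; rewrite /stab_inv; case: pselect => // ?; case: cid. Qed.

Definition sect (x : X0) : G := projT1 (cid (x0_transitive x)).

Lemma sectP x : gact (sect x) x0 = x.
Proof. by rewrite /sect; case: cid. Qed.

Lemma sectV x : gact (sect x)^-1%g x = x0.
Proof. by rewrite -{2}(sectP x) -gactM mulVg gact1. Qed.

Definition stab_chain : chain (gset1 S) -> chain X0 :=
  @cmap S G (gset1 S) X0 stab (fun=> x0).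
HB.instance Definition _ :=
  GRing.isZmodMorphism.Build _ _ stab_chain (flift_is_zmod_morphism _).
Definition unstab_chain : chain X0 -> chain (gset1 S) :=
  @cmap G S X0 (gset1 S) stab_inv (fun=> tt).
HB.instance Definition _ :=
  GRing.isZmodMorphism.Build _ _ unstab_chain (flift_is_zmod_morphism _).

Lemma stab_chain_bd y : stab_chain (bd y) = bd (stab_chain y).
Proof.
rewrite /stab_chain cmap_bd // => [p q|p q]; first exact: stabM.
by rewrite stab_x0.
Qed.

Lemma stab_chainK y : unstab_chain (stab_chain y) = y.
Proof.
rewrite /stab_chain /unstab_chain cmap_comp -[RHS]cmap_id; apply: eq_cmap.
  exact: stab_invK.
by case.
Qed.

Lemma unstab_gauge y : stab_chain (unstab_chain (gauge sect y)) = gauge sect y.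
Proof.
move: y; apply: (eq_freeg (f := stab_chain \o (unstab_chain \o gauge sect))
  (g := gauge sect)) => -[l x] /=.
rewrite gaugeU /unstab_chain /stab_chain !cmapU; congr bas.
congr pair; last exact: (esym (sectV x)).
rewrite /=; elim: l => [|g l IH] //=; rewrite IH stabK //.
by rewrite !gactM sectP sectV.
Qed.

(** Gauging by a section of the orbit map moves every simplex to the base point, where its entries
    lie in the stabilizer. *)
Lemma shapiro q (y : chain X0) : homog q y -> bd y = 0 ->
  exists w, [/\ homog q w, bd w = 0 & null (y - stab_chain w)].
Proof.
move=> qy dy; exists (unstab_chain (gauge sect y)); split.
- apply: homog_cmap; apply: spanned_add qy _ => -[l x] /= ql; rewrite gaugeU.
  by apply: spannedU; rewrite /= -ql; elim: l {ql} => //= g l ->.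
- rewrite -[LHS]stab_chainK stab_chain_bd unstab_gauge -gauge_bd dy !raddf0 //.
exists (- prism sect y); rewrite unstab_gauge raddfN /=.
by have := prism_bd sect y; rewrite dy raddf0 => E; zmod_from (esym E).
Qed.

Fact unit_scalar_mx (u : R) : u \is a GRing.unit -> (u%:M : 'M_1) \in unitmx.
Proof. by move=> uu; rewrite unitmxE det_scalar1. Qed.

Definition detmap (g : G) : GL1 :=
  exist (fun A => A \in unitmx) (\det (val g))%:M
    (unit_scalar_mx (etrans (esym (unitmxE _)) (valP g))).
Lemma detmapM : {morph detmap : g h / (g * h)%g}.
Proof. by move=> g h; apply/val_inj; rewrite /= det_mulmx scalar_mxM. Qed.

Definition GL12 : GL1 -> G := @GL1_GL2 R.
Lemma GL12M : {morph GL12 : g h / (g * h)%g}.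
Proof. exact: GL1_GL2M. Qed.

Lemma GL12E (a : GL1) (i j : 'I_2) : val (GL12 a) i j =
  if i == 0 then (if j == 0 then val a 0 0 else 0) else (if j == 0 then 0 else 1).
Proof.
have E0 : (0 : 'I_2) = lshift 1 (0 : 'I_1) by exact/val_inj.
have E1 : (1 : 'I_2) = rshift 1 (0 : 'I_1) by exact/val_inj.
pose T : 'M[R]_(1 + 1) := block_mx (val a) 0 0 1%:M.
rewrite -[LHS]/(T i j); case: (ord2P i) => ->; case: (ord2P j) => ->;
  rewrite ?eqxx ?[in T 0 _]E0 ?[in T _ 0]E0 ?[in T 1 _]E1 ?[in T _ 1]E1 /T.
- by rewrite block_mxEul.
- by rewrite block_mxEur mxE.
- by rewrite block_mxEdl mxE.
- by rewrite block_mxEdr mxE.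
Qed.

Lemma GL12_x0 a : gact (GL12 a) x0 = x0.
Proof.
apply/act_x0; rewrite ffunE /e2 -colE; apply/colP => i; rewrite mxE GL12E mxE /=.
by case: (ord2P i) => ->.
Qed.

Definition theta (p : S) : GL1 := detmap (stab p).

Lemma thetaM : {morph theta : p q / (p * q)%g}.
Proof. by move=> p q; rewrite /theta stabM detmapM. Qed.

(** Multiplication by 0 kills the additive part, leaving diag(u^-1, 1), which the determinant
    determines. *)
Lemma stab_scal0 p : stab (amap (scal 0) p) = GL12 (theta p).
Proof.
have th : val (theta p) 0 0 = (val p.2)^-1 by rewrite mxE eqxx det_stab_mx mulr1n.
by apply/val_inj/matrixP => i j; rewrite GL12E th !mxE /= /scal !mul0r.
Qed.

Definition pointed12 : chain (gset1 GL1) -> chain X0 :=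
  @cmap GL1 G (gset1 GL1) X0 GL12 (fun=> x0).
HB.instance Definition _ :=
  GRing.isZmodMorphism.Build _ _ pointed12 (flift_is_zmod_morphism _).

Lemma pointed12_bd y : pointed12 (bd y) = bd (pointed12 y).
Proof.
rewrite /pointed12 cmap_bd // => [p q|p q]; first exact: GL12M.
by rewrite GL12_x0.
Qed.

Lemma forget0_pointed12 y : forget0 (pointed12 y) = cmap1 GL12 y.
Proof.
rewrite /forget0 /pointed12 cmap_comp; apply: eq_cmap => //.
by case.
Qed.

Lemma forget0_stab y : forget0 (stab_chain y) = cmap1 stab y.
Proof.
rewrite /forget0 /stab_chain cmap_comp; apply: eq_cmap => //.
by case.
Qed.

Hypothesis hR : many_units R.

Lemma stabilizer_cycle q (y : chain X0) : homog q y -> bd y = 0 ->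
  exists w, [/\ homog q w, bd w = 0 & null (y - pointed12 (cmap1 theta w))]
         /\ null (forget0 y - cmap1 stab w).
Proof.
move=> qy dy; have [w [qw dw yw]] := shapiro qy dy; exists w; split; last first.
  case: yw => v dv; exists (forget0 v).
  by rewrite -forget0_bd dv raddfB /= forget0_stab.
split=> //.
have [v dv] := affine_homology hR qw dw.
have -> : pointed12 (cmap1 theta w) = stab_chain (cmap1 (amap (scal 0)) w).
  rewrite /pointed12 /stab_chain !cmap_comp; apply: eq_cmap => // p.
  by rewrite /= stab_scal0.
have n : null (stab_chain (w - cmap1 (amap (scal 0)) w)).
  by exists (stab_chain v); rewrite -stab_chain_bd dv.
have := nullD yw n; rewrite raddfB /=; congr null; zmod.
Qed.

Lemma column0_surj q (y : chain X0) : homog q y -> bd y = 0 ->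
  exists w : chain (gset1 GL1),
    [/\ homog q w, bd w = 0 & null (forget0 y - cmap1 GL12 w)].
Proof.
move=> qy dy; have [w [[qw dw [v dv]] _]] := stabilizer_cycle qy dy.
exists (cmap1 theta w); split; first exact: homog_cmap.
  by rewrite -(cmap1_bd _ thetaM) dw raddf0.
by exists (forget0 v); rewrite -forget0_bd dv raddfB /= forget0_pointed12.
Qed.

(** A bounding chain in [GL_2] is pushed by the determinant to one in [GL_1] for [cmap1 theta w],
    and [pointed12] carries it back to column 0. *)
Lemma column0_inj q (y : chain X0) : homog q y -> bd y = 0 ->
  null (forget0 y) -> null y.
Proof.
move=> qy dy ny; have [w [[qw dw yw] nw]] := stabilizer_cycle qy dy.
have [v dv] : null (cmap1 theta w).
  have : null (cmap1 stab w) by have := nullB ny nw; congr null; zmod.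
  by move/(null_cmap1 detmapM); rewrite cmap1_comp.
have := nullD yw (ex_intro _ (pointed12 v) (esym (pointed12_bd v))).
rewrite dv; congr null; zmod.
Qed.

End Stabilizer.

(** * The diagram chase *)

Section Coinvariants.
Variable R : comUnitRingType.
Local Notation G := (GL2 R).
Local Notation E l := (chain (frameset R l)).
Local Notation D l := {freeg (frame R l)}.

Definition vertex l : D l -> E l :=
  flift (fun v => bas ([::], v) : E l).
HB.instance Definition _ l :=
  GRing.isZmodMorphism.Build _ _ (@vertex l) (flift_is_zmod_morphism _).

Definition unvertex l : E l -> D l :=
  flift (fun w : seq G * frame R l => if w.1 is [::] then bas w.2 else 0).
HB.instance Definition _ l :=
  GRing.isZmodMorphism.Build _ _ (@unvertex l) (flift_is_zmod_morphism _).

Lemma vertexU l (v : frame R l) : vertex (bas v) = bas ([::], v).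
Proof. exact: flift_bas. Qed.

Lemma vertexK l (y : D l) : unvertex (vertex y) = y.
Proof.
move: y; apply: (eq_freeg (f := @unvertex l \o @vertex l) (g := idfun)) => v /=.
by rewrite vertexU /unvertex flift_bas.
Qed.

Lemma unvertexK l (y : E l) : homog 0 y -> vertex (unvertex y) = y.
Proof.
move=> y0; apply: (spanned_eq (f := @vertex l \o @unvertex l) (g := idfun) y0).
by case=> -[|//] x _ /=; rewrite /unvertex flift_bas vertexU.
Qed.

Lemma dh_vertex l (y : D l.+1) : dh (vertex y) = vertex (D_bd y).
Proof.
move: y; apply: (eq_freeg (f := @dh R l \o @vertex l.+1) (g := @vertex l \o @D_bd R l)).
move=> v /=; rewrite vertexU /dh flift_bas D_bd1 raddf_sum; apply: eq_bigr => i _ /=.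
by rewrite freegU_bas raddfMz /= vertexU.
Qed.

Lemma D_bd_bd l (y : D l.+2) : D_bd (D_bd y) = 0.
Proof. by rewrite -[LHS]vertexK -!dh_vertex dh_dh raddf0. Qed.

Lemma bd_edge l (g : G) (v : frame R l) :
  bd (bas ([:: g], v) : E l) = vertex (bas v - bas (frame_act g v)).
Proof.
rewrite -(KopU (X := frameset R l) g ([::], v)) bd_K Nop_nil.
by rewrite raddf0 addr0 LopU raddfB /= !vertexU.
Qed.

Definition edge l (g : G) : D l -> E l := flift (fun v => bas ([:: g], v) : E l).
HB.instance Definition _ l g :=
  GRing.isZmodMorphism.Build _ _ (@edge l g) (flift_is_zmod_morphism _).

Lemma edgeU l g (v : frame R l) : edge g (bas v) = bas ([:: g], v).
Proof. exact: flift_bas. Qed.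

Lemma homog_edge l g (y : D l) : homog 1 (edge g y).
Proof.
by apply: spanned_add (spanned_dom y) _ => v _; rewrite /= edgeU; apply: spannedU.
Qed.

Lemma D_act_bas l g (v : frame R l) : D_act g (bas v) = bas (frame_act g v).
Proof. exact: flift_bas. Qed.

Lemma bd_edges l g (y : D l) : bd (edge g y) = vertex (y - D_act g y).
Proof.
move: y; apply: (eq_freeg (f := @bd G (frameset R l) \o @edge l g)
  (g := @vertex l \o (idfun \- @D_act R l g))) => v /=.
by rewrite edgeU bd_edge D_act_bas.
Qed.

Lemma coinv_edges l (c : D l) : gen (coinv_rel (@D_act R l)) c <->
  exists2 x : E l, homog 1 x & bd x = vertex c.
Proof.
split=> [|[x x1 dx]].
  elim=> [|_ [g [a ->]]|x y _ [x' x1 dx] _ [y' y1 dy]].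
  - by exists 0; rewrite ?raddf0 //; exact: gen0.
  - exists (- edge g a); first by apply/spannedN/homog_edge.
    by rewrite raddfN /= bd_edges -raddfN opprB.
  - by exists (x' - y'); [exact: spannedB | rewrite !raddfB /= dx dy].
rewrite -[c]vertexK -dx.
apply: (spanned_add (f := @unvertex l \o @bd G (frameset R l)) x1).
case=> -[|g [|//]] v //= _; rewrite bd_edge vertexK -D_act_bas -opprB -sub0r.
by apply: genB; [exact: gen0 | apply: genS; exists g, (bas v)].
Qed.

(** The coinvariants of the image are cut out by edges of D_3, since every element of the image
    lifts there equivariantly. *)
Lemma im_coinv_edges (c : im_bd3 R) : gen (coinv_rel (@im_act R)) c <->
  exists2 x : E 3, homog 1 x & bd (dh x) = vertex (val c).
Proof.
split=> [|[x x1 dx]].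
  elim=> [|_ [g [a ->]]|x y _ [x' x1 dx] _ [y' y1 dy]].
  - by exists 0; rewrite ?raddf0 //; exact: gen0.
  - have /asboolP[b ba] := valP a.
    exists (- edge g b); first by apply/spannedN/homog_edge.
    rewrite !raddfN /= -dh_bd bd_edges dh_vertex -raddfN; congr vertex.
    by rewrite raddfB /= D_bd_act ba opprB.
  - by exists (x' - y'); [exact: spannedB | rewrite !raddfB /= dx dy].
suff [c' Gc' c'x] : exists2 c' : im_bd3 R, gen (coinv_rel (@im_act R)) c' &
    val c' = unvertex (bd (dh x)).
  by suff -> : c = c' by []; apply/val_inj; rewrite c'x dx vertexK.
elim: x1 {dx} => [|_ [[[|g [|//]] v] //= _ ->]|x' y _ [a Ga ax] _ [b Gb bx]].
- by exists 0; [exact: gen0 | rewrite !raddf0].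
- have cP : D_bd (bas v) \in im_pred (@D_bd R 2) by apply/asboolP; exists (bas v).
  pose a : im_bd3 R := exist (fun y => y \in im_pred (@D_bd R 2)) _ cP.
  exists (- (im_act g a - a)).
    by rewrite -sub0r; apply: genB; [exact: gen0 | apply: genS; exists g, a].
  rewrite -dh_bd bd_edge dh_vertex vertexK -D_act_bas (raddfB (@D_bd R 2)) /= D_bd_act.
  exact: opprB.
- by exists (a - b); [exact: genB | rewrite !raddfB /= ax bx].
Qed.

End Coinvariants.

Section Chase.
Variable R : comUnitRingType.
Hypothesis hR : many_units R.
Local Notation G := (GL2 R).
Local Notation E l := (chain (frameset R l)).
Local Notation B := (chain (gset1 G)).

(* The staircase of the double complex E p q = C_q(G; D_p).                    *)
Definition staircase (z : B) (c : im_bd3 R) : Prop :=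
  exists (x03 : E 0) (x12 : E 1) (x21 : E 2),
    [/\ homog 3 x03, homog 2 x12 & homog 1 x21] /\
    [/\ forget0 x03 = z, bd x03 = dh x12, bd x12 = dh x21
      & bd x21 = vertex (val c)].

Lemma staircaseB z z' c c' :
  staircase z c -> staircase z' c' -> staircase (z - z') (c - c').
Proof.
move=> [x [y [t [[hx hy ht] [xz xy yt tc]]]]] [x' [y' [t' [[hx' hy' ht'] [xz' xy' yt' tc']]]]].
exists (x - x'), (y - y'), (t - t'); split; first by split; exact: spannedB.
by rewrite !raddfB /= xz xz' xy xy' yt yt' tc tc'.
Qed.

Lemma staircase_exists z : homog 3 z -> bd z = 0 -> exists c, staircase z c.
Proof.
move=> z3 dz; pose x03 := pointed (e2_gen R) z.
have h03 : homog 3 x03 by exact: homog_cmap.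
have [|x12 h12 d12] := row_exact0 hR (x0 R) (homog_bd h03).
  by rewrite forget0_bd forget0_pointed.
have [|x21 h21 d21] := row_exact hR (homog_bd h12).
  by rewrite dh_bd d12 bd_bd.
have [|y hy dy] := row_exact hR (homog_bd h21).
  by rewrite dh_bd d21 bd_bd.
have cP : D_bd (unvertex y) \in im_pred (@D_bd R 2) by apply/asboolP; exists (unvertex y).
exists (exist (fun y => y \in im_pred (@D_bd R 2)) _ cP), x03, x12, x21; split=> //.
split=> //; first by rewrite forget0_pointed.
by rewrite /= -dh_vertex unvertexK.
Qed.

(** Gives at once independence of choices, vanishing on boundaries and vanishing on classes from
    [GL_1]. *)
Lemma staircase_zero z c (y : B) w : staircase z c -> homog 4 y ->
  homog 3 w -> bd w = 0 -> z = bd y + cmap1 (@GL12 R) w ->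
  gen (coinv_rel (@im_act R)) c.
Proof.
move=> [x03 [x12 [x21 [[h03 h12 h21] [xz d03 d12 d21]]]]] hy hw dw zE.
(* The correction removes the image in the bar complex of a point and leaves the boundary unchanged,
   because [w] is a cycle of the stabilizer. *)
pose u := x03 - bd (pointed (e2_gen R) y) - pointed12 w.
have hu : homog 3 u.
  apply: spannedB; last exact: homog_cmap.
  by apply: spannedB => //; apply/homog_bd/homog_cmap.
have fu : forget0 u = 0.
  rewrite /u !raddfB /= forget0_bd forget0_pointed forget0_pointed12 xz zE; zmod.
have [x13 h13 d13] := row_exact0 hR (x0 R) hu fu.
have du : bd u = dh x12.
  by rewrite /u !raddfB /= bd_bd -pointed12_bd dw !raddf0 d03; zmod.
have [||x22 h22 d22] := @row_exact _ hR _ 2 (x12 - bd x13).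
- by apply: spannedB => //; exact: homog_bd.
- by rewrite raddfB /= dh_bd d13 du subrr.
have [||x31 h31 d31] := @row_exact _ hR _ 1 (x21 - bd x22).
- by apply: spannedB => //; exact: homog_bd.
- by rewrite raddfB /= dh_bd d22 raddfB /= bd_bd d12; zmod.
apply/im_coinv_edges; exists x31 => //.
by rewrite d31 raddfB /= bd_bd subr0.
Qed.

(** Climbing columns 2 and 1 replaces [x03] by a cycle over the same [z]; [column0_surj] then moves
    it into [GL_1]. *)
Lemma staircase_inj z c : staircase z c -> gen (coinv_rel (@im_act R)) c ->
  exists (y : B) (w : chain (gset1 (GL1 R))),
    [/\ homog 3 w, bd w = 0 & z = bd y + cmap1 (@GL12 R) w].
Proof.
move=> [x03 [x12 [x21 [[h03 h12 h21] [xz d03 d12 d21]]]]] /im_coinv_edges[x31 h31 d31].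
have [||x22 h22 d22] := @column_exact R 1 0 (x21 - dh x31).
- by apply: spannedB => //; exact: homog_dh.
- by rewrite raddfB /= d31 d21 subrr.
have [||x13 h13 d13] := @column_exact R 0 1 (x12 - dh x22).
- by apply: spannedB => //; exact: homog_dh.
- by rewrite raddfB /= -dh_bd d22 raddfB /= dh_dh d12; zmod.
have [||w [hw dw [y dy]]] := @column0_surj R hR 3 (x03 - dh x13).
- by apply: spannedB => //; exact: homog_dh.
- by rewrite raddfB /= -dh_bd d13 raddfB /= dh_dh d03; zmod.
exists y, w; split=> //; move: dy; rewrite raddfB /= forget0_dh xz => ->; zmod.
Qed.

Lemma staircase_surj (c : im_bd3 R) : gen (coinv_rel (@D_act R 2)) (val c) ->
  exists z, [/\ homog 3 z, bd z = 0 & staircase z c].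
Proof.
move/coinv_edges=> [x21 h21 d21]; have /asboolP[b cb] := valP c.
have [||x12 h12 d12] := @column_exact R 0 0 (dh x21).
- exact: homog_dh.
- by rewrite -dh_bd d21 dh_vertex -cb D_bd_bd raddf0.
(* The obstruction to continuing lies in degree 2 of column 0 and dies in the homology of [GL_2],
   hence vanishes by injectivity. *)
have [|||y dy] := @column0_inj R hR 2 (dh x12).
- exact: homog_dh.
- by rewrite -dh_bd d12 dh_dh.
- by rewrite forget0_dh; exact: null0.
have hx : bd (pr 3 y) = dh x12.
  by rewrite -pr_bd dy pr_homog //; exact: homog_dh.
exists (forget0 (pr 3 y)); split; first by apply: homog_cmap; exact: homog_pr.
  by rewrite -forget0_bd hx forget0_dh.
exists (pr 3 y), x12, x21; do ![split=> //]; exact: homog_pr.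
Qed.

End Chase.

(** * The kernel of nu *)

Section KerNu.
Variable R : comUnitRingType.
Local Notation U := (units R).

Definition augmentation : {freeg (U * U)%type} -> int := flift (fun=> 1).
HB.instance Definition _ :=
  GRing.isZmodMorphism.Build _ _ augmentation (flift_is_zmod_morphism _).

Definition undrop : {freeg symbols R} -> {freeg (U * U)%type} :=
  flift (fun s => bas (val s) - bas (1%g, 1%g)).
HB.instance Definition _ :=
  GRing.isZmodMorphism.Build _ _ undrop (flift_is_zmod_morphism _).

(** On augmentation 0 the discarded coefficient of [1,1] can be recovered from the others. *)
Lemma undrop_drop11 x :
  undrop (drop11 x) = x - bas (1%g, 1%g) *~ augmentation x.
Proof.
elim/freeg_ind: x => [a||x y IHx IHy].
- rewrite /drop11 /augmentation !flift_bas mulr1z.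
  have [->|a1] := eqVneq a (1%g, 1%g).
    by rewrite insubF ?eqxx // raddf0 subrr.
  by rewrite insubT /undrop flift_bas.
- by rewrite !raddf0 addr0.
- by rewrite !raddfB /= IHx IHy; zmod.
Qed.

Definition frame_class (v : frame R 2) : {freeg (U * U)%type} := bas (frame_units v).

Lemma H0D2_iso_class y :
  H0D2_iso (qclass (coinv_rel (@D_act R 2)) y) = flift frame_class y.
Proof. exact: qlift_class. Qed.

Lemma calP_incl_class (c : im_bd3 R) :
  calP_incl (qclass _ c) = qclass (coinv_rel (@D_act R 2)) (val c).
Proof. exact: qlift_class. Qed.

(** A frame of four vectors has four faces, with signs 1 - 1 + 1 - 1. *)
Lemma augmentation_incl (y : calP R) : augmentation (H0D2_iso (calP_incl y)) = 0.
Proof.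
have [c ->] := qclassP y; rewrite calP_incl_class H0D2_iso_class.
have /asboolP[b <-] := valP c; move: b.
apply: (eq_freeg (f := augmentation \o (flift frame_class \o @D_bd R 2)) (g := \0)) => v /=.
rewrite D_bd1 !raddf_sum /=; under eq_bigr => i _ do
  rewrite freegU_bas !raddfMz /= flift_bas /frame_class /augmentation flift_bas.
by rewrite !big_ord_recl big_ord0.
Qed.

Lemma ker_nu (y : calP R) : nu y = 0 <-> calP_incl y = 0.
Proof.
split=> [ny|y0]; last by rewrite /nu /= y0 !raddf0.
apply: (bij_inj (@H0D2_iso_bij R)); rewrite raddf0.
have := undrop_drop11 (H0D2_iso (calP_incl y)).
by rewrite augmentation_incl mulr0z subr0 -[drop11 _]/(nu y) ny raddf0.
Qed.

End KerNu.

(** * The injection into calP *)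

Section Alpha.
Variable R : comUnitRingType.
Hypothesis hR : many_units R.
Local Notation G := (GL2 R).
Local Notation Z := (cycles (GL R 2) 3).
Local Notation cl := (qclass (coinv_rel (@im_act R))).

Definition cycle_chain (z : Z) : chain (gset1 G) := @to_chain G 3 (val z).
Fact cycle_chain_is_zmod_morphism : zmod_morphism cycle_chain.
Proof. by move=> x y; rewrite /cycle_chain raddfB. Qed.
HB.instance Definition _ :=
  GRing.isZmodMorphism.Build _ _ cycle_chain cycle_chain_is_zmod_morphism.

Lemma cycle_chain_bd z : bd (cycle_chain z) = 0.
Proof. by rewrite /cycle_chain -to_chain_bd; have /eqP -> := valP z; rewrite raddf0. Qed.

Lemma alpha_ex z : exists c, staircase (cycle_chain z) c.
Proof. exact: (staircase_exists hR (homog_to_chain _) (cycle_chain_bd z)). Qed.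

Definition alpha_rep z : im_bd3 R := projT1 (cid (alpha_ex z)).
Definition alpha0 (z : Z) : calP R := cl (alpha_rep z).

Lemma alpha_repP z : staircase (cycle_chain z) (alpha_rep z).
Proof. by rewrite /alpha_rep; case: cid. Qed.

(** The difference of two staircases over [z] is a staircase over 0. Additivity follows without any
    compatibility of the choices. *)
Lemma alpha0_unique z c : staircase (cycle_chain z) c -> alpha0 z = cl c.
Proof.
move=> zc; apply/eqP; rewrite -subr_eq0 /alpha0 -raddfB; apply/eqP/qclass_eq0.
apply: (@staircase_zero R hR _ _ 0 0 (staircaseB (alpha_repP z) zc)).
- exact: gen0.
- exact: gen0.
- by rewrite raddf0.
- by rewrite subrr !raddf0 addr0.
Qed.

Fact alpha0_is_zmod_morphism : zmod_morphism alpha0.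
Proof.
move=> x y; rewrite /alpha0 -raddfB; apply: alpha0_unique.
by rewrite raddfB; apply: staircaseB; exact: alpha_repP.
Qed.
HB.instance Definition _ :=
  GRing.isZmodMorphism.Build Z (calP R) alpha0 alpha0_is_zmod_morphism.

Fact alpha0_boundary (z : Z) : in_image (@bar_bd (GL R 2) 3) (val z) -> alpha0 z = 0.
Proof.
case=> b bz; apply/qclass_eq0.
apply: (@staircase_zero R hR _ _ (to_chain b) 0 (alpha_repP z)).
- exact: homog_to_chain.
- exact: gen0.
- by rewrite raddf0.
- by rewrite raddf0 addr0 -to_chain_bd bz.
Qed.

Definition alpha1 : homology (GL R 2) 3 -> calP R := qlift alpha0_boundary.
HB.instance Definition _ :=
  GRing.isZmodMorphism.Build _ _ alpha1 (qlift_is_zmod_morphism alpha0_boundary).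

Fact alpha1_image h : in_image (homology_map (@GL1_GL2 R) 3) h -> alpha1 h = 0.
Proof.
case=> k <-; have [w ->] := qclassP k.
rewrite /homology_map qlift_class /= /alpha1 qlift_class; apply/qclass_eq0.
apply: (@staircase_zero R hR _ _ 0 (@to_chain (GL1 R) 3 (val w)) (alpha_repP _)).
- exact: gen0.
- exact: homog_to_chain.
- by rewrite -to_chain_bd; have /eqP -> := valP w; rewrite raddf0.
- by rewrite raddf0 add0r /cycle_chain; exact: (to_chain_map (@GL1_GL2 R)).
Qed.

Definition alpha : coker (homology_map (@GL1_GL2 R) 3) -> calP R := qlift alpha1_image.
HB.instance Definition _ :=
  GRing.isZmodMorphism.Build _ _ alpha (qlift_is_zmod_morphism alpha1_image).

Lemma alpha_class z : alpha (qclass _ (qclass _ z)) = alpha0 z.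
Proof.
transitivity (alpha1 (qclass _ z)); first exact: qlift_class.
exact: qlift_class.
Qed.

Lemma alpha_inj : injective alpha.
Proof.
apply: raddf_inj => q /=; have [h ->] := qclassP q; have [z ->] := qclassP h.
rewrite alpha_class => /qclass_eq0/(staircase_inj hR (alpha_repP z)).
case=> y [w [hw dw zE]]; apply/qclass_eq0/genS.
have wP : @of_chain (GL1 R) 3 w \in @bar_cycle (GL1 R) 3.
  by rewrite -topredE /= -of_chain_bd dw raddf0.
pose w' : cycles (GL R 1) 3 := exist _ (@of_chain (GL1 R) 3 w) wP.
exists (qclass _ w').
transitivity (qclass (fun z : Z => in_image (@bar_bd (GL R 2) 3) (val z))
  (cycles_map (@GL1_GL2 R) w')); first exact: qlift_class.
apply/eqP; rewrite eq_sym -subr_eq0 -raddfB; apply/eqP/qclass_eq0/genS.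
exists (@of_chain G 4 y); rewrite -(@of_chain_bd G) raddfB /=.
rewrite -[val z](@to_chainK G) -/(cycle_chain z) zE raddfD /=.
have -> : of_chain 3 (cmap1 (@GL12 R) w) = bar_map (@GL1_GL2 R) (of_chain 3 w).
  apply: (can_inj (@to_chainK G 3)); rewrite of_chainK pr_cmap -of_chainK.
  by rewrite (to_chain_map (@GL1_GL2 R)).
by rewrite addrK.
Qed.

Lemma alpha_exact : exact_at alpha (@nu R).
Proof.
move=> y; split=> [/ker_nu|[q <-]].
  have [c ->] := qclassP y; rewrite calP_incl_class => /qclass_eq0.
  case/(staircase_surj hR) => z [hz dz zc].
  have zP : @of_chain G 3 z \in @bar_cycle G 3.
    by rewrite -topredE /= -of_chain_bd dz raddf0.
  exists (qclass _ (qclass _ (exist _ (@of_chain G 3 z) zP : Z))).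
  rewrite alpha_class; apply: alpha0_unique.
  by rewrite /cycle_chain /= of_chainK pr_homog.
have [h ->] := qclassP q; have [z ->] := qclassP h; rewrite alpha_class.
apply/ker_nu; rewrite calP_incl_class; apply/qclass_eq0.
have [x03 [x12 [x21 [[_ _ h21] [_ _ _ d21]]]]] := alpha_repP z.
by apply/coinv_edges; exists x21.
Qed.

End Alpha.

(** * The cokernel of nu and Milnor K-theory *)

Section UnitGroup.
Variable R : comUnitRingType.
Local Notation U := (units R).

Lemma umulC (a b : U) : (a * b = b * a)%g.
Proof. by apply/val_inj; rewrite /= mulrC. Qed.

Definition um1 : U := exist (fun a => a \is a GRing.unit) (- 1) (etrans (unitrN _) (unitr1 R)).

Lemma um1_sqr : (um1 * um1 = 1)%g.
Proof. by apply/val_inj; rewrite /= mulrN1 opprK. Qed.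

Hypothesis hR : many_units R.

Lemma exists_unit_diff (a b : U) : exists u d e : U,
  val d = val u - val a /\ val e = val u - val b.
Proof.
have [r ru /andP[ra /andP[rb _]]] := exists_unit_shift [:: - val a; - val b] hR.
by exists (exist (fun a => a \is a GRing.unit) r ru), (exist (fun a => a \is a GRing.unit) _ ra),
  (exist (fun a => a \is a GRing.unit) _ rb).
Qed.

End UnitGroup.

Lemma eqD (A : zmodType) (a b c d : A) : a = b -> c = d -> a + c = b + d.
Proof. by move=> -> ->. Qed.
Lemma eqB (A : zmodType) (a b c d : A) : a = b -> c = d -> a - c = b - d.
Proof. by move=> -> ->. Qed.

(* The relation coming from the frame (e1, e2, x e1 + y e2, xs e1 + yt e2). *)
Definition cocycle (R : comUnitRingType) (A : zmodType) (b : units R -> units R -> A) :=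
  forall x y s t d : units R, val d = val t - val s ->
    b (y * d)%g s - b (um1 R * x * d)%g t + b (x * s)%g (y * t)%g - b x y = 0.

Section SymbolCocycle.
Variables (R : comUnitRingType) (A : zmodType).
Local Notation U := (units R).
Variable b : U -> U -> A.
Hypothesis bMl : forall x y z, b (x * y)%g z = b x z + b y z.
Hypothesis bMr : forall x y z, b x (y * z)%g = b x y + b x z.
Hypothesis b_opp : forall x y : U, val x + val y = 0 -> b x y = 0.
Hypothesis b_steinberg : forall x y : U, val x + val y = 1 -> b x y = 0.

Lemma symbol1l z : b 1%g z = 0.
Proof. have := bMl 1%g 1%g z; rewrite mul1g => E; zmod_from (esym E). Qed.

Lemma symbol1r z : b z 1%g = 0.
Proof. have := bMr z 1%g 1%g; rewrite mul1g => E; zmod_from (esym E). Qed.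

Lemma symbolVl x z : b x^-1%g z = - b x z.
Proof. have := bMl x^-1%g x z; rewrite mulVg symbol1l => E; zmod_from (esym E). Qed.

Lemma symbolVr x z : b z x^-1%g = - b z x.
Proof. have := bMr z x^-1%g x; rewrite mulVg symbol1r => E; zmod_from (esym E). Qed.

Lemma symbol_um1 x : b x (um1 R) = - b x x.
Proof.
have : b x (um1 R * x)%g = 0 by apply: b_opp; rewrite /= mulN1r subrr.
by rewrite bMr => E; zmod_from E.
Qed.

Lemma symbol_sym x y : b y x = - b x y.
Proof.
have E : b (x * y)%g (um1 R * (x * y))%g = 0 by apply: b_opp; rewrite /= mulN1r subrr.
move: E; rewrite !(bMl, bMr) !symbol_um1 => E; zmod_from E.
Qed.

(** After bimultiplicative expansion, what remains is the Steinberg relation for s/t + d/t = 1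
    combined with {t, -1} = -{t, t}. *)
Lemma symbol_cocycle : cocycle b.
Proof.
move=> x y s t d dE.
have : b (s * t^-1)%g (d * t^-1)%g = 0.
  by apply: b_steinberg; rewrite /= dE -mulrDl addrC subrK mulrV ?(valP t).
have := symbol_um1 t.
rewrite !(bMl, bMr, symbolVl, symbolVr) (symbol_sym (um1 R) t) (symbol_sym y s)
  (symbol_sym d s) (symbol_sym d t).
move=> E1 E2; zmod_from (eqB E1 E2).
Qed.
End SymbolCocycle.

(** * From the cocycle relation to Steinberg symbols *)

Section CocycleSymbol.
Variables (R : comUnitRingType) (A : zmodType).
Hypothesis hR : many_units R.
Local Notation U := (units R).
Variable b : U -> U -> A.
Hypothesis b11 : b 1%g 1%g = 0.
Hypothesis b_cocycle : cocycle b.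

Let cross x x' y y' := b x y - b x' y - b x y' + b x' y'.

(** In [cocycle] the first two terms depend on [y] alone and on [x] alone, so a mixed difference in
    x and y eliminates them. *)
Lemma cross_scale1 (s t d x x' y y' : U) : val d = val t - val s ->
  cross (x * s)%g (x' * s)%g (y * t)%g (y' * t)%g = cross x x' y y'.
Proof.
move=> dE; have E x1 y1 := b_cocycle x1 y1 dE; rewrite /cross.
zmod_from (eqB (eqB (E x y) (E x' y)) (eqB (E x y') (E x' y'))).
Qed.

(* Each (s, t) is a product of two pairs with s - t a unit. *)
Lemma cross_scale s t x x' y y' :
  cross (x * s)%g (x' * s)%g (y * t)%g (y' * t)%g = cross x x' y y'.
Proof.
have [u [d [e [dE eE]]]] := exists_unit_diff hR 1%g (s * t^-1)%g.
have dE' : val (um1 R * d)%g = val (1%g : U) - val u by rewrite /= dE /=; ring.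
rewrite -(cross_scale1 x x' y y' dE').
have eE' : val (e * t * u^-1)%g = val t - val (u^-1 * s)%g.
  rewrite /= eE /= !mulrBl mulrVK ?(valP t) // mulrAC mulrV ?(valP u) // mul1r.
  by rewrite [_ * val s]mulrC.
rewrite -(cross_scale1 (x * u)%g (x' * u)%g (y * 1)%g (y' * 1)%g eE').
by rewrite !mulg1 -!(mulgA _ u) !mulVKg.
Qed.

Let bb s t := cross s 1%g t 1%g.

(** The rectangle from 1 to xs splits at s, and scaling identifies the upper piece with the
    rectangle from 1 to x. *)
Lemma bbMl x s t : bb (x * s)%g t = bb x t + bb s t.
Proof.
rewrite /bb -{1}(cross_scale s 1%g x 1%g t 1%g) !mulg1 mul1g /cross; zmod.
Qed.

Lemma bbMr x s t : bb x (s * t)%g = bb x s + bb x t.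
Proof.
rewrite /bb -{1}(cross_scale 1%g t x 1%g s 1%g) !mulg1 mul1g /cross; zmod.
Qed.

Lemma bb1l t : bb 1%g t = 0. Proof. by rewrite /bb /cross; zmod. Qed.
Lemma bb1r t : bb t 1%g = 0. Proof. by rewrite /bb /cross; zmod. Qed.

Let p s := b s 1%g.
Let q t := b 1%g t.

Lemma b_decomp s t : b s t = bb s t + p s + q t.
Proof. by rewrite /bb /cross /p /q b11; zmod. Qed.

Lemma cocycle_expand (x y s t d : U) : val d = val t - val s ->
  bb y s + bb d s + p (y * d)%g + q s - bb (um1 R) t - bb d t
  - p (um1 R * x * d)%g - q t + bb s y + bb s t + p (x * s)%g + q (y * t)%g
  - p x - q y = 0.
Proof.
move=> dE; have := b_cocycle x y dE; rewrite !b_decomp !(bbMl, bbMr) => E.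
zmod_from E.
Qed.

Lemma p_eq0 s : p s = 0.
Proof.
have [e [d [_ [dE _]]]] := exists_unit_diff hR 1%g 1%g.
(* With s = 1, t = -d and difference -e, the two occurrences of [p x] cancel and [p (x * e)] is the
   only term involving x; so [p] is constant, equal to its value 0 at 1. *)
have tE : val (um1 R * e)%g = val (um1 R * d)%g - val (1%g : U).
  by rewrite /= dE /=; ring.
have pe x : p (x * e)%g = p e.
  have := eqB (cocycle_expand x 1%g tE) (cocycle_expand 1%g 1%g tE).
  rewrite !mulg1 mul1g => E.
  have K z : (um1 R * z * (um1 R * e) = z * e)%g.
    by rewrite (umulC _ z) -mulgA (mulgA (um1 R)) um1_sqr mul1g.
  have := K 1%g; rewrite mulg1 mul1g => K1.
  by move: E; rewrite K K1 => E; zmod_from (esym E).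
have pz z : p z = p e by rewrite -[z](mulgVK e) pe.
by rewrite pz -(pz 1%g) /p b11.
Qed.

Lemma cocycle_q (y s t d : U) : val d = val t - val s ->
  bb y s + bb d s + q s - bb (um1 R) t - bb d t
  - q t + bb s y + bb s t + q (y * t)%g - q y = 0.
Proof.
by move=> dE; have := cocycle_expand 1%g y dE; rewrite !p_eq0 => E; zmod_from E.
Qed.

Lemma q1 : q 1%g = 0. Proof. exact: b11. Qed.

Lemma cocycle_q1 (s t d : U) : val d = val t - val s ->
  bb d s + q s - bb (um1 R) t - bb d t + bb s t = 0.
Proof.
move=> dE; have := cocycle_q 1%g dE; rewrite bb1l bb1r mul1g q1 => E; zmod_from E.
Qed.

Lemma cocycle_q2 (y s t d : U) : val d = val t - val s ->
  bb y s + bb s y + q (y * t)%g - q y - q t = 0.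
Proof. by move=> dE; have E := eqB (cocycle_q y dE) (cocycle_q1 dE); zmod_from E. Qed.

(** In [cocycle_q2] the element [s] occurs only through its symmetrized pairing with [y]; comparison
    with s = 1, for one t admissible in both cases, makes that vanish. *)
Lemma bb_anti y s : bb y s = - bb s y.
Proof.
have [t [d [e [dE eE]]]] := exists_unit_diff hR s 1%g.
have := eqB (cocycle_q2 y dE) (cocycle_q2 y eE); rewrite bb1l bb1r => E; zmod_from E.
Qed.

Lemma qM y t : q (y * t)%g = q y + q t.
Proof.
have [s [d [_ [dE _]]]] := exists_unit_diff hR t t.
have dE' : val (um1 R * d)%g = val t - val s by rewrite /= dE /=; ring.
have := cocycle_q2 y dE'; rewrite bb_anti => E; zmod_from E.
Qed.

Lemma qV t : q t^-1%g = - q t.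
Proof. have := qM t^-1%g t; rewrite mulVg q1 => E; zmod_from (esym E). Qed.

Lemma q_steinberg (l m : U) : val l + val m = 1 -> q l = bb l m.
Proof.
move=> lm; have mE : val m = val (1%g : U) - val l.
  by transitivity ((1 : R) - val l); rewrite // -lm [RHS]addrC addKr.
have := cocycle_q1 mE; rewrite !bb1r bb_anti => E; zmod_from E.
Qed.

(** Take s = lt and d = tm with l + m = 1 in [cocycle_q1]. *)
Lemma q_square t : q t = bb (um1 R) t - bb t t.
Proof.
have [l [d [_ [dE _]]]] := exists_unit_diff hR 1%g 1%g.
pose m := (um1 R * d)%g.
have lm : val l + val m = 1 by rewrite /= dE /=; ring.
have tE : val (t * m)%g = val t - val (l * t)%g.
  by rewrite /m /= dE /=; ring.
clearbody m.
have := cocycle_q1 tE; rewrite !(bbMl, bbMr) qM (q_steinberg lm) (bb_anti l t) (bb_anti m l).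
by move=> E; zmod_from E.
Qed.

Lemma q_double t : q t + q t = 0.
Proof.
have E1 : bb (um1 R) t + bb (um1 R) t = 0 by rewrite -bbMl um1_sqr bb1l.
have E2 := bb_anti t t; rewrite !q_square; zmod_from (eqB E1 E2).
Qed.

(** Antisymmetry gives q(l) + q(m) = 0. The pair 1/l, -m/l also sums to 1, so 3q(l) = q(-1), and q
    is 2-torsion. *)
Lemma q_good (l m : U) : val l + val m = 1 -> q l = q (um1 R).
Proof.
move=> lm; have ml : val m + val l = 1 by rewrite addrC.
have E1 : q l + q m = 0.
  by rewrite (q_steinberg lm) (q_steinberg ml) (bb_anti m l) subrr.
have mV : val (l^-1)%g + val (um1 R * m * l^-1)%g = 1.
  rewrite /= mulN1r -{1}[(val l)^-1]mul1r -mulrDl -lm addrK mulrV //; exact: (valP l).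
have Vm : val (um1 R * m * l^-1)%g + val (l^-1)%g = 1 by rewrite addrC.
have := eqD (q_steinberg mV) (q_steinberg Vm).
rewrite (bb_anti _ (l^-1)%g) !qM qV => E2.
zmod_from (eqB (eqB E1 E2) (q_double l)).
Qed.

(** Generic l and m have l, m and lm all good, meaning that subtracting 1 leaves a unit;
    multiplicativity gives q(-1) = 2q(-1). Any t is a product of two good units. *)
Lemma q_eq0 t : q t = 0.
Proof.
have good (l d : U) : val d = val l - val (1%g : U) -> q l = q (um1 R).
  by move=> dE; apply: (@q_good _ (um1 R * d)%g); rewrite /= dE /=; ring.
have qm : q (um1 R) = 0.
  have [l [d [_ [dE _]]]] := exists_unit_diff hR 1%g 1%g.
  have [m [e [f [eE fE]]]] := exists_unit_diff hR 1%g l^-1%g.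
  have lfE : val (l * f)%g = val (l * m)%g - val (1%g : U).
    by rewrite /= fE mulrBr /= mulrV ?(valP l).
  have := qM l m; rewrite (good _ _ dE) (good _ _ eE) (good _ _ lfE) => E.
  zmod_from (esym E).
have [l [d [e [dE eE]]]] := exists_unit_diff hR 1%g t.
have eE' : val (um1 R * e * l^-1)%g = val (t * l^-1)%g - val (1%g : U).
  by rewrite /= eE mulN1r opprB mulrBl mulrV ?(valP l).
by rewrite -[t](mulgVK l) qM (good _ _ dE) (good _ _ eE') qm addr0.
Qed.

Lemma b_bb s t : b s t = bb s t.
Proof. by rewrite b_decomp p_eq0 q_eq0 !addr0. Qed.

Lemma cocycle_mull x y z : b (x * y)%g z = b x z + b y z.
Proof. by rewrite !b_bb bbMl. Qed.

Lemma cocycle_mulr x y z : b x (y * z)%g = b x y + b x z.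
Proof. by rewrite !b_bb bbMr. Qed.

Lemma cocycle_steinberg (x y : U) : val x + val y = 1 -> b x y = 0.
Proof. by move=> xy; rewrite b_bb -(q_steinberg xy) q_eq0. Qed.

Lemma cocycle_opp (x y : U) : val x + val y = 0 -> b x y = 0.
Proof.
move=> xy; have -> : y = (um1 R * x)%g.
  by apply/val_inj; rewrite /= mulN1r; apply/eqP; rewrite -addr_eq0 addrC xy.
rewrite b_bb bbMr (bb_anti x (um1 R)).
by have := q_square x; rewrite q_eq0 => E; zmod_from E.
Qed.

End CocycleSymbol.

(** * The presentation of the cokernel *)

Section K2Exact.
Variable R : comUnitRingType.
Local Notation U := (units R).

Definition sym (a c : U) : K2M R := qclass (@K2M_rel R) (bas (a, c)).

Lemma sym_mull x y z : sym (x * y)%g z = sym x z + sym y z.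
Proof.
have /qclass_eq0 : gen (@K2M_rel R)
    (bas ((x * y)%g, z) - bas (x, z) - bas (y, z)) by apply/genS/K2M_mull.
rewrite !raddfB /= /sym => E; zmod_from E.
Qed.

Lemma sym_mulr x y z : sym x (y * z)%g = sym x y + sym x z.
Proof.
have /qclass_eq0 : gen (@K2M_rel R)
    (bas (x, (y * z)%g) - bas (x, y) - bas (x, z)) by apply/genS/K2M_mulr.
rewrite !raddfB /= /sym => E; zmod_from E.
Qed.

Lemma sym_opp (x y : U) : val x + val y = 0 -> sym x y = 0.
Proof. by move=> xy; apply/qclass_eq0/genS/K2M_opp. Qed.

Lemma sym_steinberg (x y : U) : val x + val y = 1 -> sym x y = 0.
Proof. by move=> xy; apply/qclass_eq0/genS/K2M_steinberg. Qed.

Lemma widen0 : widen_ord (leqnSn 2) 0 = ord0. Proof. exact/val_inj. Qed.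
Lemma widen1 : widen_ord (leqnSn 2) 1 = fintype.lift ord0 ord0. Proof. exact/val_inj. Qed.

Lemma frame_units_eq (v : frame R 2) (a : U * U) :
  val v ord_max = val a.1 *: val v ord0 + val a.2 *: val v (fintype.lift ord0 ord0) ->
  frame_units v = a.
Proof.
move=> vE; have cE : frame_coord v = \col_i (if i == 0 then val a.1 else val a.2).
  apply: (can_inj (mulKmx (frame_basis_unit v))).
  rewrite /frame_coord mulKVmx ?frame_basis_unit // vE.
  apply/colP => i; rewrite mulmx2E !mxE /=.
  by rewrite widen0 widen1; ring.
case: a cE {vE} => a1 a2 cE; congr pair; apply/val_inj; rewrite /= cE !mxE //=.
Qed.

Lemma frame_unitsE (v : frame R 2) : val v ord_max =
  val (frame_units v).1 *: val v ord0
  + val (frame_units v).2 *: val v (fintype.lift ord0 ord0).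
Proof.
have -> : val v ord_max = frame_basis v *m frame_coord v.
  by rewrite /frame_coord mulKVmx ?frame_basis_unit.
rewrite /=; move: (frame_coord v) => c; apply/colP => i; rewrite mulmx2E !mxE /=.
by rewrite widen0 widen1; ring.
Qed.

Local Notation o1 := (fintype.lift ord0 ord0).
Local Notation o2 := (fintype.lift ord0 (fintype.lift ord0 ord0)).
Local Notation o3 := (fintype.lift ord0 (fintype.lift ord0 (fintype.lift ord0 ord0))).

Lemma face_vertex (v : frame R 3) (i : 'I_4) (j : 'I_3) k : bump i j = val k ->
  val (frame_face i v) j = val v k.
Proof. by move=> ijk; rewrite ffunE; congr (val v _); exact/val_inj. Qed.

(** The first two faces come from v_3 = yd v_1 + s v_2 and v_3 = -xd v_0 + t v_2, where d = t -
    s. *)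
Lemma faces_units (v : frame R 3) (x y s t d : U) : val d = val t - val s ->
  val v o2 = val x *: val v ord0 + val y *: val v o1 ->
  val v o3 = val (x * s)%g *: val v ord0 + val (y * t)%g *: val v o1 ->
  [/\ frame_units (frame_face ord0 v) = ((y * d)%g, s),
      frame_units (frame_face o1 v) = ((um1 R * x * d)%g, t),
      frame_units (frame_face o2 v) = ((x * s)%g, (y * t)%g)
    & frame_units (frame_face o3 v) = (x, y)].
Proof.
move=> dE v2 v3; split; apply: frame_units_eq.
- rewrite (@face_vertex _ _ _ o3) // (@face_vertex _ _ ord0 o1) //.
  rewrite (@face_vertex _ _ _ o2) // v2 v3 /= dE.
  by apply/colP => i; rewrite !mxE /=; ring.
- rewrite (@face_vertex _ _ _ o3) // (@face_vertex _ _ ord0 ord0) //.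
  rewrite (@face_vertex _ _ _ o2) // v2 v3 /= dE.
  by apply/colP => i; rewrite !mxE /=; ring.
- by rewrite (@face_vertex _ _ _ o3) // (@face_vertex _ _ ord0 ord0) // (@face_vertex _ _ _ o1).
- by rewrite (@face_vertex _ _ _ o2) // (@face_vertex _ _ ord0 ord0) // (@face_vertex _ _ _ o1).
Qed.

Lemma frame3_coord (v : frame R 3) : exists x y s t d : U,
  [/\ val d = val t - val s,
      val v o2 = val x *: val v ord0 + val y *: val v o1
    & val v o3 = val (x * s)%g *: val v ord0 + val (y * t)%g *: val v o1].
Proof.
have := frame_unitsE (frame_face o3 v); have := frame_unitsE (frame_face o2 v).
rewrite (@face_vertex _ _ _ o3) // (@face_vertex _ _ ord0 ord0) // (@face_vertex _ _ _ o1) //.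
rewrite (@face_vertex _ _ _ o2) // (@face_vertex _ _ ord0 ord0) // (@face_vertex _ _ _ o1) //.
case: (frame_units _) => x' y' v3; case: (frame_units _) => x y v2 /=.
(* With s = x'/x and t = y'/y, the determinant of v_2 and v_3 is xy(t - s) times that of v_0 and
   v_1. *)
have du : val (y' * y^-1)%g - val (x' * x^-1)%g \is a GRing.unit.
  have d23 : det2 (val v o2) (val v o3) \is a GRing.unit by exact: frame_det2.
  have E : det2 (val v o2) (val v o3) =
      val x * val y * (val (y' * y^-1)%g - val (x' * x^-1)%g) * det2 (val v ord0) (val v o1).
    have -> : val x * val y * (val (y' * y^-1)%g - val (x' * x^-1)%g) =
              val x * val y' - val y * val x'.
      have xV : val x * (val x)^-1 = 1 by rewrite mulrV ?(valP x).
      have yV : val y * (val y)^-1 = 1 by rewrite mulrV ?(valP y).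
      rewrite mulrBr /=; congr (_ - _).
        by rewrite -[RHS]mulr1 -yV /=; ring.
      by rewrite -[RHS]mulr1 -xV /=; ring.
    by rewrite v2 v3 /det2 !mxE /=; ring.
  by move: d23; rewrite E !unitrM => /andP[/andP[_ ->]].
exists x, y, (x' * x^-1)%g, (y' * y^-1)%g, (exist (fun a => a \is a GRing.unit) _ du).
have K (a c : U) : (a * (c * a^-1) = c)%g by rewrite umulC mulgVK.
split; [by [] | exact: v2 | rewrite v3 /=].
by congr (_ *: _ + _ *: _); [exact: (congr1 val (esym (K x x'))) |
  exact: (congr1 val (esym (K y y')))].
Qed.

Lemma frame3_exists (x y s t d : U) : val d = val t - val s ->
  exists v : frame R 3,
    val v o2 = val x *: val v ord0 + val y *: val v o1 /\
    val v o3 = val (x * s)%g *: val v ord0 + val (y * t)%g *: val v o1.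
Proof.
move=> dE; pose e1 : 'cV[R]_2 := delta_mx 0 0; pose e2 : 'cV[R]_2 := delta_mx 1 0.
pose w := [:: e1; e2; val x *: e1 + val y *: e2; val (x * s)%g *: e1 + val (y * t)%g *: e2].
have uP (a : U) : val a \is a GRing.unit by exact: valP.
have wP (i j : 'I_4) : (i < j)%N -> det2 w`_i w`_j \is a GRing.unit.
  case: i j => [[|[|[|[|//]]]] ilt] [[|[|[|[|//]]]] jlt] //= _.
  - by rewrite (_ : det2 _ _ = 1) ?unitr1 // /det2 !mxE /=; ring.
  - by rewrite (_ : det2 _ _ = val y) // /det2 !mxE /=; ring.
  - by rewrite (_ : det2 _ _ = val (y * t)%g) // /det2 !mxE /=; ring.
  - by rewrite (_ : det2 _ _ = - val x) ?unitrN // /det2 !mxE /=; ring.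
  - by rewrite (_ : det2 _ _ = - val (x * s)%g) ?unitrN // /det2 !mxE /=; ring.
  - rewrite (_ : det2 _ _ = val (x * y * d)%g) // /det2 !mxE /= dE /=; ring.
have vP : @gen_position R 3 (finfun (fun i : 'I_4 => w`_i)).
  apply/gen_position2 => i j; rewrite !ffunE neq_ltn => /orP[|]; first exact: wP.
  by move/wP; rewrite det2_unitC.
by exists (Frame vP); rewrite /= !ffunE.
Qed.

Definition beta : {freeg symbols R} -> K2M R := flift (fun a => sym (val a).1 (val a).2).
HB.instance Definition _ :=
  GRing.isZmodMorphism.Build _ _ beta (flift_is_zmod_morphism _).

Lemma beta_drop11 x : beta (drop11 x) = flift (fun a => sym a.1 a.2) x.
Proof.
move: x; apply: (eq_freeg (f := beta \o @drop11 R)) => a /=.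
rewrite /drop11 !flift_bas; have [->|a1] := eqVneq a (1%g, 1%g).
  by rewrite insubF ?eqxx // raddf0 (symbol1l sym_mull).
by rewrite insubT /beta flift_bas.
Qed.

Lemma beta_surj y : exists x, beta x = y.
Proof.
have [x ->] := qclassP y; exists (drop11 x); rewrite beta_drop11; move: x.
apply: (eq_freeg (f := flift (fun a => sym a.1 a.2)) (g := qclass _)) => -[a c] /=.
by rewrite flift_bas.
Qed.

Lemma nu_class (c : im_bd3 R) : nu (qclass _ c) = drop11 (flift (@frame_class R) (val c)).
Proof. by rewrite /nu /= calP_incl_class H0D2_iso_class. Qed.

Lemma frame_class_bd (v : frame R 3) (x y s t d : U) :
  val d = val t - val s ->
  val v o2 = val x *: val v ord0 + val y *: val v o1 ->
  val v o3 = val (x * s)%g *: val v ord0 + val (y * t)%g *: val v o1 ->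
  flift (@frame_class R) (D_bd (bas v)) =
  bas ((y * d)%g, s) - bas ((um1 R * x * d)%g, t) + bas ((x * s)%g, (y * t)%g) - bas (x, y).
Proof.
move=> dE v2 v3; have [f0 f1 f2 f3] := faces_units dE v2 v3.
rewrite D_bd1 raddf_sum /= !big_ord_recl big_ord0 !freegU_bas !raddfMz /= !flift_bas.
rewrite /frame_class f0 f1 f2 f3 !exprS expr0 !mulr1 !mulN1r !opprK.
by rewrite !mulr1z !mulrN1z; zmod.
Qed.

Hypothesis hR : many_units R.

Lemma beta_exact : exact_at (@nu R) beta.
Proof.
move=> y; split=> [by0|[q <-]]; last first.
  have [c ->] := qclassP q; rewrite nu_class beta_drop11.
  have /asboolP[b <-] := valP c; move: b.
  apply: (eq_freeg (f := flift (fun a => sym a.1 a.2) \o (flift (@frame_class R) \o @D_bd R 2))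
    (g := \0)) => v /=.
  have [x [z [s [t [d [dE v2 v3]]]]]] := frame3_coord v.
  rewrite (frame_class_bd dE v2 v3) !(raddfB, raddfD) /= !flift_bas.
  exact: (symbol_cocycle sym_mull sym_mulr sym_opp sym_steinberg).
(* The universal cocycle with value 0 at (1,1). Being a symbol, it defines a map from [K2M] to the
   cokernel whose composite with [beta] is the quotient map. *)
pose b (a c : U) : coker (@nu R) := qclass _ (drop11 (bas (a, c))).
have b11 : b 1%g 1%g = 0 by rewrite /b [drop11 _]drop11_11 raddf0.
have b_coc : cocycle b.
  move=> x z s t d dE; have [v [v2 v3]] := frame3_exists x z dE.
  rewrite /b -!(raddfB, raddfD) /= -(frame_class_bd dE v2 v3).
  apply/qclass_eq0/genS.
  have cP : D_bd (bas v) \in im_pred (@D_bd R 2) by apply/asboolP; exists (bas v).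
  pose c : im_bd3 R := exist (fun y => y \in im_pred (@D_bd R 2)) _ cP.
  by exists (qclass _ c); exact: nu_class.
have gP x : K2M_rel x -> flift (fun a : U * U => b a.1 a.2) x = 0.
  case=> [a1 a2 c|a c1 c2|a c ac|a c ac].
  - by rewrite !raddfB /= !flift1 (cocycle_mull hR b11 b_coc); zmod.
  - by rewrite !raddfB /= !flift1 (cocycle_mulr hR b11 b_coc); zmod.
  - by rewrite flift1; exact: (cocycle_opp hR b11 b_coc).
  - by rewrite flift1; exact: (cocycle_steinberg hR b11 b_coc).
have : qlift gP (beta y) = qclass _ y.
  move: (y); apply: (eq_freeg (f := qlift gP \o beta) (g := qclass _)) => a /=.
  have -> : beta (bas a) = qclass _ (bas (val a)).
    by rewrite /beta flift_bas /sym -surjective_pairing.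
  transitivity (flift (fun a : U * U => b a.1 a.2) (bas (val a))).
    exact: qlift_class.
  by rewrite flift_bas /b -surjective_pairing [drop11 _]drop11_symbol.
rewrite by0 raddf0 => /esym/qclass_eq0.
elim=> [|//|x z _ [x' <-] _ [z' <-]]; first by exists 0; rewrite raddf0.
by exists (x' - z'); rewrite raddfB.
Qed.

End K2Exact.

Theorem theorem2p5 (R : comUnitRingType) (hR : many_units R) :
  exists (alpha : {additive coker (homology_map (@GL1_GL2 R) 3) -> calP R})
         (beta : {additive {freeg (symbols R)} -> K2M R}),
    [/\ injective alpha,
        exact_at alpha (@nu R),
        exact_at (@nu R) beta
      & forall y, exists x, beta x = y].
Proof.
exists (alpha hR), (@beta R); split.
- exact: alpha_inj.
- exact: alpha_exact.
- exact: beta_exact.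
- exact: beta_surj.
Qed.
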